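(* Let $\{\beta_{k_1},\dots,\beta_{k_s}\}=\Phi^-\setminus(\Phi_1'^-\cup\dots\cup\Phi_d'^-)$ with $k_1<\dots<k_s$, where $\Phi_1',\dots,\Phi_d'$ are the irreducible root subsystems of $\Phi$ attached to $I'$ in the context. There exist $x_{k_1},\dots,x_{k_s}\in\mathcal E^{P_J}$ such that $$g_1:=n(\overline w)^{-1}u_{\beta_{k_s}}(x_{k_s})\cdots u_{\beta_{k_1}}(x_{k_1})$$ satisfies $g_1\mathcal Y\in P_J(\mathcal E)$ and $g_1.A_G(s(v))\in\mathrm{Lie}(P_J)(\mathcal E^{P_J})$. Moreover, $$g_1\,u(v,f)\,n(\overline w)\in U_{\Psi^+}(\mathcal E)\le P_J(\mathcal E),$$ where $u(v,f)$ is the first factor in the Bruhat decomposition of $\mathcal Y$ and $U_{\Psi^+}$ is the product of the root groups corresponding to the roots in $\Psi^+$.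
   Context: Groups. $C$ is an algebraically closed field of characteristic zero and $G(C)\le\mathrm{GL}_n(C)$ is a classical group of Lie rank $l$ of type $A_l,B_l,C_l,D_l$ or $G_2$ ($l=2$), with Lie algebra $\mathfrak g$, root system $\Phi$ with respect to a maximal torus $T$ whose Lie algebra $\mathfrak h$ consists of diagonal matrices, basis $\Delta=\{\alpha_1,\dots,\alpha_l\}$, $m=|\Phi^-|$, and $\Phi^-=\{\beta_1,\dots,\beta_m\}$ numbered so that $\beta_i=-\alpha_i$ for $i\le l$ and $|\mathrm{ht}(\beta_i)|\le|\mathrm{ht}(\beta_j)|$ for $i\le j$. $\{H_i\}\cup\{X_\alpha\}$ is a Chevalley basis of $\mathfrak g$; $u_\alpha(x)=\exp(xX_\alpha)$ parametrizes the root group $U_\alpha$; for $x=(x_1,\dots,x_m)$ put $u(x)=u_{\beta_1}(x_1)\cdots u_{\beta_m}(x_m)$; for $x=(x_1,\dots,x_l)$ with invertible entries put $t(x)=t_1(x_1)\cdots t_l(x_l)$, where $t_i(x)$ is the image of $\mathrm{diag}(x,x^{-1})$ under the homomorphism $\mathrm{SL}_2\to\langle U_{\alpha_i},U_{-\alpha_i}\rangle$ attached to $\alpha_i$. $U^-$ is generated by all $U_\beta$, $\beta\in\Phi^-$, and $B^-=TU^-$. $\mathcal W$ is the Weyl group, $w_{\alpha_i}$ the simple reflections, $\overline w$ the longest element, $n(w)\in N_G(T)$ a fixed representative of $w\in\mathcal W$. For $J\subseteq\{1,\dots,l\}$ let $\mathcal W_J=\langle w_{\alpha_j}\mid j\in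 J\rangle$, $P_J=\bigcup_{w\in\mathcal W_J}B^-n(w)B^-$, $\Psi=\Phi\cap\langle\alpha_j\mid j\in J\rangle_{\mathbb Z\text{-span}}$, $\Psi^{\pm}=\Psi\cap\Phi^{\pm}$. Gauge action: $g.A=gAg^{-1}+\partial(g)g^{-1}$. Generic extension. $F=C(z)$ with derivation $d/dz$; $v=(v_1,\dots,v_l)$ are differential indeterminates over $F$; $\{\cdot\}$ and $\langle\cdot\rangle$ denote generated differential rings and differential fields. Let $\gamma_1,\dots,\gamma_l\in\Phi^+$ be the complementary roots, i.e. $\mathfrak b^+=\mathrm{ad}(\sum_i X_{-\alpha_i})(\mathfrak u^+)\oplus\sum_i\mathfrak g_{\gamma_i}$ (where $\mathfrak u^+$ is the sum of the positive root spaces and $\mathfrak b^+=\mathfrak h\oplus\mathfrak u^+$), and let $A_G(t_1,\dots,t_l)=\sum_i X_{\alpha_i}+\sum_i t_iX_{-\gamma_i}$. The following data (known to exist from earlier work) are fixed: constants $c_1,\dots,c_l\in C^\times$; $C$-linearly independent homogeneous polynomials $g_1(v),\dots,g_l(v)\in\mathbb Z[v]$ of degree one (not to be confused with the matrix $g_1$); $s(v)=(s_1(v),\dots,s_l(v))$ with $s_i(v)\in C\{v\}$ differentially algebraically independent over $F$; differential polynomials $f=(f_{l+1},\dots,f_m)$ in $C\{v\}$; such that (1) $A_{\rm Liou}(v)=\sum_i g_i(v)H_i+\sum_i c_iX_{\beta_i}$ defines a Picard–Vessiot extension $\mathcal E$ of $F\langle v\rangle$ with differential Galois group $B^-(C)$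 and fundamental matrix $t(\exp)\,u(\mathrm{int})$, $\exp=(\exp_1,\dots,\exp_l)$, $\mathrm{int}=(\mathrm{int}_1,\dots,\mathrm{int}_m)$, $\partial(\exp_i)\exp_i^{-1}=g_i(v)$; (2) $\mathcal Y=u(v,f)\,n(\overline w)\,t(\exp)\,u(\mathrm{int})$ satisfies $\partial(\mathcal Y)\mathcal Y^{-1}=A_G(s(v))$, and $\mathcal E$ is a Picard–Vessiot extension of $F\langle s(v)\rangle$ for $\partial(y)=A_G(s(v))y$ with differential Galois group $G(C)$, where $g\in G(C)$ acts by $\mathcal Y\mapsto\mathcal Yg$. For a closed subgroup $H\le G$, $\mathcal E^H$ is the fixed field of $H(C)$. Partition. $I=\{1,\dots,l\}=I'\cup I''$ is a partition, $I'=\{i_1,\dots,i_r\}$, $I''=\{i_{r+1},\dots,i_l\}$, $J=\{j\mid\alpha_j=\overline w(-\alpha_i)\text{ for some }i\in I'\}$, $v_{\rm base}=(v_{i_{r+1}},\dots,v_{i_l})$; $\mathcal E^{P_J}=F\langle s(v),v_{\rm base}\rangle$. Let $\Delta_1'\cup\dots\cup\Delta_d'=\{\alpha_i\mid i\in I'\}$ be the unique partition such that $\Delta_1',\dots,\Delta_d'$ are bases of maximal irreducible root subsystems $\Phi_1',\dots,\Phi_d'$ of $\Phi$ (the irreducible components of the root subsystem generated by $\{\alpha_i\mid i\in I'\}$); $\Phi_i'^-=\Phi_i'\cap\Phi^-$. *)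

(* Defs.v *)
From HB Require Import structures.
From mathcomp Require Import all_boot all_order all_fingroup all_algebra.
From mathcomp Require Import mpoly.

Set Implicit Arguments.
Unset Strict Implicit.
Unset Printing Implicit Defensive.

Import GRing.Theory Num.Theory.
Local Open Scope ring_scope.

(* Roots are given by their integer coordinates with respect to a fixed basis
   Delta, so a root is a column vector and the simple roots are the unit
   vectors.  A coroot is a linear form on these coordinates. *)

Definition simple (l : nat) (i : 'I_l) : 'cV[int]_l := delta_mx i 0.

Definition pairing (l : nat) (b : 'cV[int]_l) (c : 'rV[int]_l) : int :=
  (c *m b) 0 0.

(* Reflection x |-> x - <x, c> a, acting on columns from the left. *)
Definition reflection (l : nat) (a : 'cV[int]_l) (c : 'rV[int]_l) : 'M[int]_l :=
  1%:M - a *m c.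

Definition nonneg_root (l : nat) (a : 'cV[int]_l) : bool :=
  [forall i, 0 <= a i 0].
Definition nonpos_root (l : nat) (a : 'cV[int]_l) : bool :=
  [forall i, a i 0 <= 0].

(* Bourbaki's axioms for a reduced root system; root_sign says that the simple
   roots form a basis of the root system. *)
Record root_system (l : nat) := RootSystem {
  roots : seq 'cV[int]_l;
  coroot : 'cV[int]_l -> 'rV[int]_l;
  roots_uniq : uniq roots;
  simple_root : forall i, simple i \in roots;
  pairing_coroot : forall a, a \in roots -> pairing a (coroot a) = 2;
  reflection_root : forall a b, a \in roots -> b \in roots ->
    reflection a (coroot a) *m b \in roots;
  root_reduced : forall a b (x y : int), a \in roots -> b \in roots ->
    x != 0 -> x *: a = y *: b -> b = a \/ b = - a;
  root_sign : forall a, a \in roots -> nonneg_root a || nonpos_root a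
}.

Definition pos_root (l : nat) (R : root_system l) (a : 'cV[int]_l) : bool :=
  (a \in roots R) && nonneg_root a.
Definition neg_root (l : nat) (R : root_system l) (a : 'cV[int]_l) : bool :=
  (a \in roots R) && nonpos_root a.

Definition height (l : nat) (a : 'cV[int]_l) : int := \sum_i a i 0.

(* entry (i, j) is <alpha_i, alpha_j^vee> *)
Definition cartan_matrix (l : nat) (R : root_system l) : 'M[int]_l :=
  \matrix_(i, j) pairing (simple i) (coroot R (simple j)).

Variant lie_type := TypeA | TypeB | TypeC | TypeD | TypeG2.

(* C_2 and D_3 are B_2 and A_3 up to renumbering. *)
Definition valid_rank (ty : lie_type) (l : nat) : bool :=
  match ty with
  | TypeA => (1 <= l)%N
  | TypeB => (2 <= l)%N
  | TypeC => (3 <= l)%N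
  | TypeD => (4 <= l)%N
  | TypeG2 => l == 2
  end.

(* Bourbaki's Cartan matrices, with indices starting at 0. *)
Definition standard_cartan (ty : lie_type) (l i j : nat) : int :=
  if i == j then 2 else
  let adjacent := (i.+1 == j) || (j.+1 == i) in
  match ty with
  | TypeA => if adjacent then -1 else 0
  | TypeB =>
      if (i.+1 == j) && (j.+1 == l) then -2 else if adjacent then -1 else 0
  | TypeC =>
      if (j.+1 == i) && (i.+1 == l) then -2 else if adjacent then -1 else 0
  | TypeD =>
      if (maxn i j).+1 == l
      then (if (minn i j).+3 == l then -1 else 0)
      else (if adjacent then -1 else 0)
  | TypeG2 => if i == 0%N then -1 else -3
  end.

Definition has_type (l : nat) (R : root_system l) (ty : lie_type) : Prop :=
  valid_rank ty l /\
  exists s : 'S_l, forall i j,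
    cartan_matrix R (s i) (s j) = standard_cartan ty l i j.

(* Phi^- = {beta_1, ..., beta_m} with m = l + p. *)
Definition neg_numbering (l p : nat) (R : root_system l)
    (beta : 'I_(l + p) -> 'cV[int]_l) : Prop :=
  [/\ injective beta,
      forall a, neg_root R a <-> exists j, a = beta j,
      forall i : 'I_l, beta (lshift p i) = - simple i
    & forall i j : 'I_(l + p), (i <= j)%N ->
        `|height (beta i)| <= `|height (beta j)| ].

(* For a set S of indices, [supported S a] says that a lies in the Z-span of
   the simple roots alpha_i, i in S. *)
Definition supported (l : nat) (S : {set 'I_l}) (a : 'cV[int]_l) : bool :=
  [forall i, (i \in S) || (a i 0 == 0)].

Definition subsystem (l : nat) (R : root_system l) (S : {set 'I_l}) :
    pred 'cV[int]_l :=
  fun a => (a \in roots R) && supported S a.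

Definition irreducible_roots (l : nat) (R : root_system l)
    (A : pred 'cV[int]_l) : Prop :=
  (exists a, A a) /\
  forall Q : pred 'cV[int]_l,
    (forall a b, A a -> A b -> Q a -> ~~ Q b -> pairing a (coroot R b) = 0) ->
    (forall a, A a -> Q a) \/ (forall a, A a -> ~~ Q a).

(* D is the partition of {alpha_i | i in S} into bases of maximal irreducible
   root subsystems. *)
Definition irreducible_components (l : nat) (R : root_system l)
    (S : {set 'I_l}) (D : {set {set 'I_l}}) : Prop :=
  partition D S /\
  forall B, B \in D ->
    irreducible_roots R (subsystem R B) /\
    forall B' : {set 'I_l}, B \subset B' -> B' \subset S ->
      irreducible_roots R (subsystem R B') -> B' = B.

Definition simple_reflection (l : nat) (R : root_system l) (i : 'I_l) :
    'M[int]_l :=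
  reflection (simple i) (coroot R (simple i)).

Definition weyl_word (l : nat) (R : root_system l) (s : seq 'I_l) : 'M[int]_l :=
  \prod_(i <- s) simple_reflection R i.

(* Simple reflections are involutions, so words suffice to generate. *)
Definition parabolic_weyl (l : nat) (R : root_system l) (S : {set 'I_l})
    (w : 'M[int]_l) : Prop :=
  exists2 s : seq 'I_l, all (mem S) s & w = weyl_word R s.

Definition weyl (l : nat) (R : root_system l) : 'M[int]_l -> Prop :=
  parabolic_weyl R [set: 'I_l].

Definition has_length (l : nat) (R : root_system l) (w : 'M[int]_l) (k : nat) :
    Prop :=
  (exists2 s, w = weyl_word R s & size s = k) /\
  (forall s, w = weyl_word R s -> (k <= size s)%N).

Definition longest (l : nat) (R : root_system l) (w0 : 'M[int]_l) : Prop :=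
  exists2 k, has_length R w0 k &
    forall w k', has_length R w k' -> (k' <= k)%N.

Definition eval_mx (K : comNzRingType) (n : nat) (f : {mpoly K[n * n]})
    (g : 'M[K]_n) : K :=
  f.@[fun q => mxvec g 0 q].

Definition vanishes_on (C : fieldType) (n : nat) (H : 'M[C]_n -> Prop)
    (f : {mpoly C[n * n]}) : Prop :=
  forall g, H g -> eval_mx f g = 0.

(* H(K), for a subgroup H of GL_n defined over C and given by its C-points *)
Definition points (C K : fieldType) (iota : {rmorphism C -> K}) (n : nat)
    (H : 'M[C]_n -> Prop) (g : 'M[K]_n) : Prop :=
  g \in unitmx /\
  forall f, vanishes_on H f -> eval_mx (map_mpoly iota f) g = 0.

(* Lie(H)(K): tangent space of H at the identity, over K *)
Definition lie_points (C K : fieldType) (iota : {rmorphism C -> K}) (n : nat)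
    (H : 'M[C]_n -> Prop) (Y : 'M[K]_n) : Prop :=
  forall f, vanishes_on H f ->
    \sum_q eval_mx (map_mpoly iota f^`M(q)) 1%:M * mxvec Y 0 q = 0.

Definition is_subgroup (K : fieldType) (n : nat) (H : 'M[K]_n -> Prop) : Prop :=
  [/\ forall g, H g -> g \in unitmx, H 1%:M,
      forall g h, H g -> H h -> H (g *m h)
    & forall g, H g -> H (invmx g)].

Definition closed_subgroup (C : fieldType) (n : nat) (H : 'M[C]_n -> Prop) :
    Prop :=
  is_subgroup H /\
  forall g, g \in unitmx ->
    (forall f, vanishes_on H f -> eval_mx f g = 0) -> H g.

(* An algebraic group is connected iff it is an irreducible variety. *)
Definition connected_group (C : fieldType) (n : nat) (H : 'M[C]_n -> Prop) :
    Prop :=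
  forall f1 f2 : {mpoly C[n * n]}, vanishes_on H (f1 * f2) ->
    vanishes_on H f1 \/ vanishes_on H f2.

Inductive generated (K : fieldType) (n : nat) (S : 'M[K]_n -> Prop) :
    'M[K]_n -> Prop :=
| gen_one : generated S 1%:M
| gen_in g : S g -> generated S g
| gen_mul g h : generated S g -> generated S h -> generated S (g *m h)
| gen_inv g : generated S g -> generated S (invmx g).

Definition bracket (K : fieldType) (n : nat) (A B : 'M[K]_n) : 'M[K]_n :=
  A *m B - B *m A.

Definition chevalley_seq (C : fieldType) (l n : nat) (R : root_system l)
    (H : 'I_l -> 'M[C]_n) (X : 'cV[int]_l -> 'M[C]_n) : seq 'M[C]_n :=
  [seq H i | i <- enum 'I_l] ++ [seq X a | a <- roots R].

(* Humphreys, 25.2: [X_a, X_{-a}] is the coroot H_a, H_i = H_{alpha_i}, and the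
   structure constants satisfy N_{a,b} = - N_{-a,-b}.  In addition the Cartan
   subalgebra spanned by the H_i consists of diagonal matrices. *)
Definition chevalley_basis (C : fieldType) (l n : nat) (R : root_system l)
    (H : 'I_l -> 'M[C]_n) (X : 'cV[int]_l -> 'M[C]_n) : Prop :=
  [/\ free (chevalley_seq R H X),
      forall i, is_diag_mx (H i),
      forall i a, a \in roots R ->
        bracket (H i) (X a) = (pairing a (coroot R (simple i)))%:~R *: X a,
      forall a, a \in roots R ->
        exists2 c : 'I_l -> int,
          coroot R a = \sum_i c i *: coroot R (simple i)
          & bracket (X a) (X (- a)) = \sum_i (c i)%:~R *: H i
    & (exists N : 'cV[int]_l -> 'cV[int]_l -> C,
        forall a b, a \in roots R -> b \in roots R -> a + b \in roots R ->
          bracket (X a) (X b) = N a b *: X (a + b) /\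
          N a b = - N (- a) (- b)) /\
      (forall a b, a \in roots R -> b \in roots R ->
        a + b != 0 -> a + b \notin roots R -> bracket (X a) (X b) = 0) ].

(* Exponential of a nilpotent n x n matrix. *)
Definition nilexp (K : fieldType) (n : nat) (A : 'M[K]_n) : 'M[K]_n :=
  \sum_(k < n) (k`!%:R)^-1 *: A ^+ k.

Definition uroot (K : fieldType) (l n : nat) (X : 'cV[int]_l -> 'M[K]_n)
    (a : 'cV[int]_l) (x : K) : 'M[K]_n :=
  nilexp (x *: X a).

(* Image of [[0, x], [-1/x, 0]] under the homomorphism from SL_2 sending
   [[1, x], [0, 1]] to u_a(x) and [[1, 0], [x, 1]] to u_{-a}(x). *)
Definition wroot (K : fieldType) (l n : nat) (X : 'cV[int]_l -> 'M[K]_n)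
    (a : 'cV[int]_l) (x : K) : 'M[K]_n :=
  uroot X a x *m uroot X (- a) (- x^-1) *m uroot X a x.

(* Image of diag(x, 1/x) = [[0, x], [-1/x, 0]] * [[0, -1], [1, 0]]. *)
Definition hroot (K : fieldType) (l n : nat) (X : 'cV[int]_l -> 'M[K]_n)
    (a : 'cV[int]_l) (x : K) : 'M[K]_n :=
  wroot X a x *m wroot X a (-1).

Definition torus_elt (K : fieldType) (l n : nat) (X : 'cV[int]_l -> 'M[K]_n)
    (x : 'I_l -> K) : 'M[K]_n :=
  \prod_(i < l) hroot X (simple i) (x i).

Definition unip_elt (K : fieldType) (l n m : nat) (X : 'cV[int]_l -> 'M[K]_n)
    (beta : 'I_m -> 'cV[int]_l) (x : 'I_m -> K) : 'M[K]_n :=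
  \prod_(j < m) uroot X (beta j) (x j).

Definition torus (K : fieldType) (l n : nat) (X : 'cV[int]_l -> 'M[K]_n)
    (t : 'M[K]_n) : Prop :=
  exists2 x : 'I_l -> K, (forall i, x i != 0) & t = torus_elt X x.

Definition neg_unipotent (K : fieldType) (l n : nat) (R : root_system l)
    (X : 'cV[int]_l -> 'M[K]_n) : 'M[K]_n -> Prop :=
  generated (fun g => exists a x, neg_root R a /\ g = uroot X a x).

Definition neg_borel (K : fieldType) (l n : nat) (R : root_system l)
    (X : 'cV[int]_l -> 'M[K]_n) (b : 'M[K]_n) : Prop :=
  exists t u, [/\ torus X t, neg_unipotent R X u & b = t *m u].

(* G is a connected closed subgroup of GL_n whose Lie algebra has the Chevalley
   basis {H_i} u {X_a}, of one of the types A_l, B_l, C_l, D_l, G_2. *)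
Definition group_of_type (C : fieldType) (l n : nat) (ty : lie_type)
    (R : root_system l) (H : 'I_l -> 'M[C]_n) (X : 'cV[int]_l -> 'M[C]_n)
    (G : 'M[C]_n -> Prop) : Prop :=
  [/\ has_type R ty, closed_subgroup G, connected_group G,
      chevalley_basis R H X
    & forall Y, lie_points idfun G Y <-> Y \in <<chevalley_seq R H X>>%VS].

(* a(t) = c, where a(t) is the value at t of the root a as a character of T *)
Definition root_value (C : fieldType) (l n : nat) (X : 'cV[int]_l -> 'M[C]_n)
    (a : 'cV[int]_l) (t : 'M[C]_n) (c : C) : Prop :=
  t *m X a *m invmx t = c *: X a.

(* nw w lies in N_G(T) and represents w, that is (w a)(t) = a(nw^-1 t nw). *)
Definition weyl_representatives (C : fieldType) (l n : nat) (R : root_system l)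
    (X : 'cV[int]_l -> 'M[C]_n) (G : 'M[C]_n -> Prop)
    (nw : 'M[int]_l -> 'M[C]_n) : Prop :=
  forall w, weyl R w ->
  [/\ G (nw w),
      forall t, torus X t <-> torus X (nw w *m t *m invmx (nw w))
    & forall t a c, torus X t -> a \in roots R ->
        root_value X (w *m a) t c ->
        root_value X a (invmx (nw w) *m t *m nw w) c ].

Definition parabolic (C : fieldType) (l n : nat) (R : root_system l)
    (X : 'cV[int]_l -> 'M[C]_n) (nw : 'M[int]_l -> 'M[C]_n) (J : {set 'I_l})
    (g : 'M[C]_n) : Prop :=
  exists w b1 b2, [/\ parabolic_weyl R J w, neg_borel R X b1, neg_borel R X b2
                    & g = b1 *m nw w *m b2].

Definition opposite_set (l : nat) (w0 : 'M[int]_l) (S : {set 'I_l}) :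
    {set 'I_l} :=
  [set j | [exists i in S, simple j == w0 *m - simple i]].

(* The product of the root groups U_a, a in Psi^+, where Psi is the subsystem
   of J; the roots of Psi^+ are ordered as their negatives are by beta. *)
Definition Psi_pos_unipotent (K : fieldType) (l n m : nat)
    (X : 'cV[int]_l -> 'M[K]_n) (beta : 'I_m -> 'cV[int]_l) (J : {set 'I_l})
    (g : 'M[K]_n) : Prop :=
  exists y : 'I_m -> K,
    g = \prod_(j < m | supported J (beta j)) uroot X (- beta j) (y j).

(* The positive roots are the - beta_j; the gamma_i satisfy
   b^+ = ad(sum_i X_{-alpha_i})(u^+) (+) sum_i g_{gamma_i}. *)
Definition complementary_roots (C : fieldType) (l p n : nat)
    (R : root_system l) (H : 'I_l -> 'M[C]_n) (X : 'cV[int]_l -> 'M[C]_n)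
    (beta : 'I_(l + p) -> 'cV[int]_l) (gamma : 'I_l -> 'cV[int]_l) : Prop :=
  let uplus := (\sum_(j < l + p) <[X (- beta j)]>)%VS in
  let bplus := (\sum_(i < l) <[H i]> + uplus)%VS in
  let image := (linfun (bracket (\sum_(i < l) X (- simple i))) @: uplus)%VS in
  [/\ forall i, pos_root R (gamma i),
      bplus = (image + \sum_(i < l) <[X (gamma i)]>)%VS
    & directv (image + \sum_(i < l) <[X (gamma i)]>) ].

Definition A_G (K : fieldType) (l n : nat) (X : 'cV[int]_l -> 'M[K]_n)
    (gamma : 'I_l -> 'cV[int]_l) (t : 'I_l -> K) : 'M[K]_n :=
  \sum_(i < l) X (simple i) + \sum_(i < l) t i *: X (- gamma i).

Definition derivation (E : fieldType) (d : E -> E) : Prop :=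
  (forall x y, d (x + y) = d x + d y) /\
  (forall x y, d (x * y) = d x * y + x * d y).

Inductive field_gen (E : fieldType) (S : E -> Prop) : E -> Prop :=
| fg_in x : S x -> field_gen S x
| fg_one : field_gen S 1
| fg_sub x y : field_gen S x -> field_gen S y -> field_gen S (x - y)
| fg_mul x y : field_gen S x -> field_gen S y -> field_gen S (x * y)
| fg_inv x : field_gen S x -> field_gen S x^-1.

Inductive dring_gen (E : fieldType) (d : E -> E) (S : E -> Prop) : E -> Prop :=
| dr_in x : S x -> dring_gen d S x
| dr_one : dring_gen d S 1
| dr_sub x y : dring_gen d S x -> dring_gen d S y -> dring_gen d S (x - y)
| dr_mul x y : dring_gen d S x -> dring_gen d S y -> dring_gen d S (x * y)
| dr_der x : dring_gen d S x -> dring_gen d S (d x).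

Inductive dfield_gen (E : fieldType) (d : E -> E) (S : E -> Prop) : E -> Prop :=
| df_in x : S x -> dfield_gen d S x
| df_one : dfield_gen d S 1
| df_sub x y : dfield_gen d S x -> dfield_gen d S y -> dfield_gen d S (x - y)
| df_mul x y : dfield_gen d S x -> dfield_gen d S y -> dfield_gen d S (x * y)
| df_inv x : dfield_gen d S x -> dfield_gen d S x^-1
| df_der x : dfield_gen d S x -> dfield_gen d S (d x).

Definition in_image (C E : fieldType) (iota : C -> E) (x : E) : Prop :=
  exists c, x = iota c.

Definition adjoin (E : fieldType) (I : Type) (S : E -> Prop) (a : I -> E)
    (x : E) : Prop :=
  S x \/ exists i, x = a i.

Definition rational_field (C E : fieldType) (iota : C -> E) (z : E) :
    E -> Prop :=
  field_gen (adjoin (in_image iota) (fun _ : unit => z)).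

Definition alg_independent (E : fieldType) (F : E -> Prop) (r : nat)
    (a : 'I_r -> E) : Prop :=
  forall f : {mpoly E[r]}, (forall m, F f@_m) -> f.@[a] = 0 -> f = 0.

Definition diff_independent (E : fieldType) (d : E -> E) (F : E -> Prop)
    (r : nat) (a : 'I_r -> E) : Prop :=
  forall N : nat, alg_independent F
    (fun q : 'I_(r * N) =>
       mxvec (\matrix_(i < r, k < N) iter k d (a i)) 0 q).

Definition diff_automorphism (E : fieldType) (d : E -> E) (K : E -> Prop)
    (sigma : {rmorphism E -> E}) : Prop :=
  [/\ bijective sigma, forall x, sigma (d x) = d (sigma x)
    & forall x, K x -> sigma x = x].

(* E is a Picard-Vessiot extension of K (with constants iota C) for
   d(y) = A y with fundamental matrix Y. *)
Definition picard_vessiot (C E : fieldType) (iota : C -> E) (d : E -> E)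
    (n : nat) (K : E -> Prop) (A Y : 'M[E]_n) : Prop :=
  [/\ forall i j, K (A i j),
      Y \in unitmx,
      map_mx d Y = A *m Y,
      forall x, dfield_gen d (adjoin K (fun ij => Y ij.1 ij.2)) x
    & forall x, d x = 0 <-> in_image iota x ].

Definition acts_as (C E : fieldType) (iota : {rmorphism C -> E}) (n : nat)
    (Y : 'M[E]_n) (sigma : {rmorphism E -> E}) (g : 'M[C]_n) : Prop :=
  map_mx sigma Y = Y *m map_mx iota g.

(* The differential Galois group of E over K, represented on the solution space
   by the fundamental matrix Y, is H(C). *)
Definition galois_group_is (C E : fieldType) (iota : {rmorphism C -> E})
    (d : E -> E) (n : nat) (K : E -> Prop) (Y : 'M[E]_n)
    (H : 'M[C]_n -> Prop) : Prop :=
  (forall sigma : {rmorphism E -> E}, diff_automorphism d K sigma ->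
     exists2 g, H g & acts_as iota Y sigma g) /\
  (forall g, H g -> exists2 sigma : {rmorphism E -> E},
     diff_automorphism d K sigma & acts_as iota Y sigma g).

Definition fixed_field (C E : fieldType) (iota : {rmorphism C -> E})
    (d : E -> E) (n : nat) (K : E -> Prop) (Y : 'M[E]_n)
    (H : 'M[C]_n -> Prop) (x : E) : Prop :=
  forall (sigma : {rmorphism E -> E}) (g : 'M[C]_n),
    diff_automorphism d K sigma -> H g -> acts_as iota Y sigma g ->
    sigma x = x.

Definition gauge (E : fieldType) (d : E -> E) (n : nat) (g A : 'M[E]_n) :
    'M[E]_n :=
  g *m A *m invmx g + map_mx d g *m invmx g.

Definition ext_mx (C E : fieldType) (iota : C -> E) (l n : nat)
    (X : 'cV[int]_l -> 'M[C]_n) : 'cV[int]_l -> 'M[E]_n :=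
  fun a => map_mx iota (X a).

(* The vector (v, f) = (v_1, ..., v_l, f_{l+1}, ..., f_m). *)
Definition concat (E : Type) (l p : nat) (v : 'I_l -> E) (f : 'I_p -> E) :
    'I_(l + p) -> E :=
  fun j => match split j with inl i => v i | inr k => f k end.

Definition lin_forms (E : fieldType) (l : nat) (M : 'M[int]_l) (v : 'I_l -> E) :
    'I_l -> E :=
  fun i => \sum_(j < l) (M i j)%:~R * v j.

Definition A_Liou (C E : fieldType) (iota : C -> E) (l p n : nat)
    (H : 'I_l -> 'M[C]_n) (X : 'cV[int]_l -> 'M[C]_n)
    (beta : 'I_(l + p) -> 'cV[int]_l) (c : 'I_l -> C) (M : 'M[int]_l)
    (v : 'I_l -> E) : 'M[E]_n :=
  \sum_(i < l) lin_forms M v i *: map_mx iota (H i)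
  + \sum_(i < l) iota (c i) *: map_mx iota (X (beta (lshift p i))).

(* Main.v *)
Require Import Defs.
From HB Require Import structures.
From mathcomp Require Import all_boot all_order all_fingroup all_algebra.
From mathcomp Require Import mpoly zify ring.

(* A word in root elements with negative roots can be put in any order that
   refines a filtration by ideals.  Taking first the negative roots outside the
   subsystem of I', u(v, f) = u_1 u_2 with u_1 the product over these roots and
   u_2 a product over the negative roots supported on I'.  Hence
   g_1 = n(w0)^-1 u_1^-1 satisfies g_1 u(v, f) n(w0) = n(w0)^-1 u_2 n(w0), which
   is a product over Psi^+, and q = g_1 Y = psi t(exp) u(int) is a point of P_J.

   Since g_1.A = d(q) q^-1, the gauge transform is a logarithmic derivative of a
   point of P_J, hence lies in Lie(P_J).  If sigma corresponds to g in P_J(C),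
   then sigma(g_1) g_1^-1 = sigma(q) g^-1 q^-1 stabilises the parabolic
   subalgebra p_J; its conjugate by n(w0) is a product over the roots outside
   the subsystem of I', whose action on the Cartan subalgebra determines its
   coordinates, so sigma fixes the coordinates of g_1.

   All of this takes place in the matrix group: P_J is a group because G(C)
   contains the root groups and T(C) is its own centraliser, and both facts come
   from the description of the two differential Galois groups. *)

Set Implicit Arguments.
Unset Strict Implicit.
Unset Printing Implicit Defensive.

Import Order.TTheory GRing.Theory Num.Theory.
Local Open Scope ring_scope.
Local Notation roots := Defs.roots.

(** The group is known only through its $C$-points and its Lie algebra, and the root system only
    through its axioms, so structure theory is replaced by three devices. First, finiteness of the
    root list does the work of an invariant inner product: a wrong relation between coroots would
    produce infinitely many roots. Second, the Cartan subalgebra is diagonal, so every matrix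
    position has a definite weight and a root coordinate is a single matrix entry. Third, identities
    in the groups come from logarithmic derivatives instead of commutator formulas: to reorder a
    product, its parameters are scaled by an indeterminate and the resulting linear equation is
    integrated along the chain of ideals. The same principle shows that the image of
    $\mathrm{diag}(x,x^{-1})$ is a diagonal matrix of powers of $x$. This last step needs many
    elements with nonzero derivative, so it is carried out over $\mathcal E$, where $z$ provides
    them, and then descends to $C$. *)

Lemma mem_eq (T : eqType) (s : seq T) x y : x \in s -> x = y -> y \in s.
Proof. by move=> + <-. Qed.

Lemma int_ge1 (t : int) : 0 <= t -> t != 0 -> 1 <= t.
Proof. lia. Qed.

(** * Reflections, coroots and the Weyl group in coordinates *)

Section RootSystem.
Variables (l : nat) (R : root_system l).
Implicit Types (a b : 'cV[int]_l) (i j : 'I_l) (s : seq 'I_l) (J : {set 'I_l}).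

Lemma reflectionE a (c : 'rV_l) b :
  reflection a c *m b = b - pairing b c *: a.
Proof.
rewrite /reflection mulmxBl mul1mx -mulmxA; congr (_ - _).
by rewrite [c *m b]mx11_scalar mul_mx_scalar.
Qed.

Lemma pairingD a b (c : 'rV_l) : pairing (a + b) c = pairing a c + pairing b c.
Proof. by rewrite /pairing mulmxDr mxE. Qed.

Lemma pairingZ (k : int) a (c : 'rV_l) : pairing (k *: a) c = k * pairing a c.
Proof. by rewrite /pairing -scalemxAr mxE. Qed.

Lemma pairingN a (c : 'rV_l) : pairing (- a) c = - pairing a c.
Proof. by rewrite -scaleN1r pairingZ mulN1r. Qed.

Lemma pairingB a b (c : 'rV_l) : pairing (a - b) c = pairing a c - pairing b c.
Proof. by rewrite pairingD pairingN. Qed.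

Lemma pairing_simple i (c : 'rV_l) : pairing (simple i) c = c 0 i.
Proof.
rewrite /pairing mxE (bigD1 i) //= big1 ?addr0 => [|j ji].
  by rewrite mxE !eqxx mulr1.
by rewrite mxE (negPf ji) mulr0.
Qed.

Lemma simpleE i j : simple i j 0 = (j == i)%:R.
Proof. by rewrite mxE eqxx andbT. Qed.

Lemma col_simple a : a = \sum_i a i 0 *: simple i.
Proof.
apply/colP=> j; rewrite summxE (bigD1 j) //= big1 ?addr0 => [|i ij].
  by rewrite mxE simpleE eqxx mulr1.
by rewrite mxE simpleE eq_sym (negPf ij) mulr0.
Qed.

Lemma scale_col_neq0 (k : int) a : k != 0 -> a != 0 -> k *: a != 0.
Proof.
move=> k0 a0; apply: contra a0 => /eqP E; apply/eqP/colP=> i; rewrite mxE.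
by move/colP/(_ i)/eqP: E; rewrite !mxE mulf_eq0 (negPf k0) => /eqP.
Qed.

(** Finiteness of the root list in usable form: the next arguments about coroots end by producing an
    infinite arithmetic progression of roots. *)
Lemma roots_no_ray a b : b != 0 -> ~ forall k, a + b *+ k \in roots R.
Proof.
move=> b0 h; have : uniq [seq a + b *+ k | k <- iota 0 (size (roots R)).+1].
  rewrite map_inj_uniq ?iota_uniq // => k1 k2 /addrI E.
  have [i bi] : exists i, b i 0 != 0.
    apply/existsP; apply: contraR b0 => /existsPn H0.
    by apply/eqP/colP=> i; rewrite mxE; apply/eqP; move: (H0 i); rewrite negbK.
  move: E; rewrite -!scaler_nat => /colP/(_ i); rewrite !mxE.
  by move/(mulIf bi)/eqP; rewrite eqr_nat => /eqP.
move/uniq_leq_size => /(_ (roots R)); rewrite size_map size_iota ltnn.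
by move=> H; have // : false; apply: H => x /mapP [k _ ->].
Qed.

Lemma root_neq0 a : a \in roots R -> a != 0.
Proof.
move=> ra; apply/eqP=> a0; have := pairing_coroot ra.
by rewrite a0 -[0 : 'cV_l](scale0r 0) pairingZ mul0r.
Qed.

Lemma roots_opp a : a \in roots R -> - a \in roots R.
Proof.
move=> ra; have := reflection_root ra ra.
by rewrite reflectionE pairing_coroot // scaler_nat mulr2n opprD addrA subrr sub0r.
Qed.

Lemma roots_oppE a : (- a \in roots R) = (a \in roots R).
Proof. by apply/idP/idP => /roots_opp; rewrite ?opprK. Qed.

Lemma nonneg_rootN a : nonneg_root (- a) = nonpos_root a.
Proof. by apply: eq_forallb => i; rewrite mxE oppr_ge0. Qed.

Lemma nonpos_rootN a : nonpos_root (- a) = nonneg_root a.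
Proof. by rewrite -nonneg_rootN opprK. Qed.

Lemma root_nonpos a : a \in roots R -> nonpos_root a = ~~ nonneg_root a.
Proof.
move=> ra; have := root_sign ra; case: (boolP (nonneg_root a)) => //= /forallP p _.
apply/negP=> /forallP n; move/eqP: (root_neq0 ra); apply; apply/colP=> i.
by rewrite mxE; apply/eqP; rewrite eq_le p n.
Qed.

Lemma root_nonneg a : a \in roots R -> nonneg_root a = ~~ nonpos_root a.
Proof. by move=> ra; rewrite root_nonpos // negbK. Qed.

Lemma root_pos_coord a i : a \in roots R -> 0 < a i 0 -> nonneg_root a.
Proof.
move=> ra h; rewrite root_nonneg //; apply/negP=> /forallP /(_ i).
by rewrite leNgt h.
Qed.

Lemma root_neg_coord a i : a \in roots R -> a i 0 < 0 -> nonpos_root a.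
Proof.
by move=> ra h; rewrite -nonneg_rootN; apply: (@root_pos_coord _ i); rewrite ?roots_opp // mxE oppr_gt0.
Qed.

Lemma simple_nonneg i : nonneg_root (simple i).
Proof. by apply/forallP=> j; rewrite simpleE; case: (_ == _). Qed.

(** The composite of the two reflections along [a] is the transvection $x\mapsto x+(c'(x)-c(x))a$.
    Since $c'-c$ vanishes on [a], iterating it on a simple root where the forms differ would give
    infinitely many roots. *)
Lemma coroot_unique a (c c' : 'rV_l) : pairing a c = 2 -> pairing a c' = 2 ->
  (forall b, b \in roots R -> reflection a c *m b \in roots R) ->
  (forall b, b \in roots R -> reflection a c' *m b \in roots R) -> c = c'.
Proof.
move=> p p' h h'; apply/rowP=> i; rewrite -!pairing_simple; apply/eqP.
apply/negPn/negP=> ne; set d := (pairing (simple i) c' - pairing (simple i) c) *: a.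
have a0 : a != 0.
  by apply/eqP=> a0; move: p; rewrite a0 -[0 : 'cV_l](scale0r 0) pairingZ mul0r.
have d0 : d != 0 by apply: scale_col_neq0; rewrite // subr_eq0 eq_sym.
have step x : x \in roots R -> pairing x c' - pairing x c = pairing (simple i) c' - pairing (simple i) c ->
  x + d \in roots R.
  move=> rx e; have := h _ (h' _ rx); rewrite !reflectionE pairingB pairingZ p.
  by move/mem_eq; apply; rewrite /d -e; apply/colP=> k; rewrite !mxE; ring.
apply: (@roots_no_ray (simple i) d d0) => k.
suff [] : simple i + d *+ k \in roots R /\ pairing (simple i + d *+ k) c' - pairing (simple i + d *+ k) c =
   pairing (simple i) c' - pairing (simple i) c by [].
elim: k => [|k [ih ih2]]; first by rewrite addr0 simple_root.
rewrite mulrSr addrA; split; first exact: step.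
by rewrite pairingD [pairing (_ + d) c]pairingD /d !pairingZ p p' opprD addrACA subrr addr0.
Qed.

(** If $\langle a,b^\vee\rangle=0$ and $\langle b,a^\vee\rangle=m\ne 0$, then $(s_as_b)^2$ sends
    $b+xa$ to $b+(x-2m)a$, which again yields infinitely many roots. [step] and [step'] are the two
    applications of $s_as_b$. *)
Lemma coroot_orth_sym a b : a \in roots R -> b \in roots R ->
  pairing a (coroot R b) = 0 -> pairing b (coroot R a) = 0.
Proof.
move=> ra rb e; apply/eqP/negPn/negP=> m0; set m := pairing _ _ in m0.
have d0 : (- (m + m)) *: a != 0.
  apply: scale_col_neq0; last exact: root_neq0 ra.
  by move: m0; lia.
apply: (roots_no_ray d0 (a := b)); elim=> [|k ih]; first by rewrite addr0.
have step (x : int) : b + x *: a \in roots R -> - b + (m - x) *: a \in roots R.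
  move=> h; have := reflection_root ra (reflection_root rb h).
  rewrite !reflectionE !(pairingD, pairingZ, pairingN) !pairing_coroot // e -/m.
  by move/mem_eq; apply; apply/colP=> i; rewrite !mxE; ring.
have step' (x : int) : - b + x *: a \in roots R -> b - (m + x) *: a \in roots R.
  move=> h; have := reflection_root ra (reflection_root rb h).
  rewrite !reflectionE !(pairingD, pairingZ, pairingN) !pairing_coroot // e -/m.
  by move/mem_eq; apply; apply/colP=> i; rewrite !mxE; ring.
have : b + (- (m + m) * k%:R) *: a \in roots R.
  by move: ih; rewrite -scaler_nat scalerA mulrC.
move/step/step'/mem_eq; apply.
apply/colP=> i; rewrite mulrSr -[_ *: a *+ k]scaler_nat !mxE; ring.
Qed.

Lemma simple_reflectionE i a : simple_reflection R i *m a =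
  a - pairing a (coroot R (simple i)) *: simple i.
Proof. exact: reflectionE. Qed.

Lemma simple_reflectionK i : simple_reflection R i *m simple_reflection R i = 1%:M.
Proof.
rewrite {2}/simple_reflection /reflection mulmxBr mulmx1 mulmxA simple_reflectionE.
rewrite pairing_coroot ?simple_root // scaler_nat mulr2n opprD addrA subrr sub0r.
by rewrite mulNmx opprK /simple_reflection /reflection subrK.
Qed.

Lemma simple_reflection_root i a :
  a \in roots R -> simple_reflection R i *m a \in roots R.
Proof. by move=> ra; apply: reflection_root; rewrite ?simple_root. Qed.

Lemma simple_reflection_simple i : simple_reflection R i *m simple i = - simple i.
Proof.
rewrite simple_reflectionE pairing_coroot ?simple_root // scaler_nat mulr2n.
by rewrite opprD addrA subrr sub0r.
Qed.

Lemma simple_reflection_coord i j a : i != j ->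
  (simple_reflection R j *m a) i 0 = a i 0.
Proof.
by move=> ij; rewrite simple_reflectionE mxE [in X in _ + X]mxE [in X in _ - X]mxE simpleE (negPf ij) mulr0 subr0.
Qed.

(** The root has a positive coordinate away from $i$. The reflection leaves it unchanged, and one
    positive coordinate decides the sign of a root. *)
Lemma simple_reflection_nonneg i a : a \in roots R -> nonneg_root a ->
  a != simple i -> nonneg_root (simple_reflection R i *m a).
Proof.
move=> ra na ai; have [j ji aj] : exists2 j, j != i & a j 0 != 0.
  apply/exists_inP; apply: contraR ai; rewrite negb_exists_in => /forall_inP H.
  have E : 1 *: a = a i 0 *: simple i.
    apply/colP=> j; rewrite !mxE eqxx andbT; case: (eqVneq j i) => [->|ji].
      by rewrite mul1r mulr1.
    by move: (H j ji); rewrite negbK => /eqP ->; rewrite !mulr0.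
  have [] := root_reduced ra (simple_root R i) _ E => // [-> //|Ea].
  move: (simple_nonneg i); rewrite Ea nonneg_rootN root_nonpos // na.
  by [].
apply: (@root_pos_coord _ j); first exact: simple_reflection_root.
rewrite simple_reflection_coord //; move/forallP: na => /(_ j).
by rewrite le_eqVlt eq_sym (negPf aj).
Qed.

Lemma weyl_word_cat s1 s2 : weyl_word R (s1 ++ s2) = weyl_word R s1 *m weyl_word R s2.
Proof. by rewrite /weyl_word big_cat. Qed.

Lemma weyl_word_cons i s : weyl_word R (i :: s) = simple_reflection R i *m weyl_word R s.
Proof. by rewrite /weyl_word big_cons. Qed.

Lemma weyl_word1 i : weyl_word R [:: i] = simple_reflection R i.
Proof. by rewrite /weyl_word big_seq1. Qed.

Lemma weyl_word_nil : weyl_word R [::] = 1%:M.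
Proof. by rewrite /weyl_word big_nil. Qed.

Lemma weyl_word_rcons i s : weyl_word R (rcons s i) = weyl_word R s *m simple_reflection R i.
Proof. by rewrite -cats1 weyl_word_cat weyl_word1. Qed.

Lemma weyl_word_revK s : weyl_word R s *m weyl_word R (rev s) = 1%:M.
Proof.
elim: s => [|i s ih]; first by rewrite weyl_word_nil mul1mx.
rewrite rev_cons weyl_word_rcons weyl_word_cons mulmxA -[_ *m _ *m weyl_word R (rev s)]mulmxA.
by rewrite ih mulmx1 simple_reflectionK.
Qed.

Lemma weyl_word_Krev s : weyl_word R (rev s) *m weyl_word R s = 1%:M.
Proof. by rewrite -{2}[s]revK weyl_word_revK. Qed.

Lemma weyl_word_root s a : a \in roots R -> weyl_word R s *m a \in roots R.
Proof.
move=> ra; elim: s => [|i s ih]; first by rewrite weyl_word_nil mul1mx.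
by rewrite weyl_word_cons -mulmxA simple_reflection_root.
Qed.

Lemma weyl_word_rootE s a : (weyl_word R s *m a \in roots R) = (a \in roots R).
Proof.
apply/idP/idP; last exact: weyl_word_root.
by move/(weyl_word_root (rev s)); rewrite mulmxA weyl_word_Krev mul1mx.
Qed.

Lemma weyl_word_coord J s i a : all (mem J) s -> i \notin J ->
  (weyl_word R s *m a) i 0 = a i 0.
Proof.
move=> + iJ; elim: s => [|j s ih] /=; first by rewrite weyl_word_nil mul1mx.
move=> /andP [jJ /ih <-]; rewrite weyl_word_cons -mulmxA simple_reflection_coord //.
by apply: contraNneq iJ => ->.
Qed.

(** The form on the right defines the conjugate of the reflection in [a], which permutes the roots,
    so [coroot_unique] applies. *)
Lemma coroot_weyl_word s a : a \in roots R ->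
  coroot R (weyl_word R s *m a) = coroot R a *m weyl_word R (rev s).
Proof.
move=> ra; have rb := weyl_word_root s ra.
have p : pairing (weyl_word R s *m a) (coroot R a *m weyl_word R (rev s)) = 2.
  rewrite /pairing -mulmxA (mulmxA (weyl_word R (rev s))) weyl_word_Krev mul1mx.
  exact: pairing_coroot.
apply: (coroot_unique _ p) => // [|b rb'|b rb']; first exact: pairing_coroot.
  exact: reflection_root.
have -> : reflection (weyl_word R s *m a) (coroot R a *m weyl_word R (rev s)) =
  weyl_word R s *m reflection a (coroot R a) *m weyl_word R (rev s).
  by rewrite /reflection mulmxBr mulmxBl mulmx1 weyl_word_revK !mulmxA.
by rewrite -!mulmxA weyl_word_root // reflection_root // weyl_word_root.
Qed.

Lemma weyl_word_conj_simple s i j : weyl_word R s *m simple i = simple j ->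
  simple_reflection R j *m weyl_word R s = weyl_word R s *m simple_reflection R i.
Proof.
move=> e; rewrite /simple_reflection -[in LHS]e coroot_weyl_word ?simple_root //.
rewrite /reflection mulmxBr mulmxBl mulmx1 mul1mx -!mulmxA weyl_word_Krev.
by rewrite mulmx1.
Qed.

(** Reading the word from the right, $\alpha_i$ becomes negative at some letter $j$. A simple
    reflection makes no positive root negative except its own simple root, so at that moment the
    root is $\alpha_j$. Then $s_jw=ws_i$ for the part $w$ to the right of the letter, and the letter
    cancels. *)
Lemma weyl_exchange s i : nonpos_root (weyl_word R s *m simple i) ->
  exists2 s', weyl_word R s *m simple_reflection R i = weyl_word R s' &
    (size s').+1 = size s.
Proof.
elim: s => [|j s ih] h.
  by move: h; rewrite weyl_word_nil mul1mx root_nonpos ?simple_root // simple_nonneg.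
case: (boolP (nonpos_root (weyl_word R s *m simple i))) => [/ih [s' e1 e2]|h2].
  by exists (j :: s'); rewrite ?weyl_word_cons -?mulmxA ?e1 //= e2.
exists s => //; have rs := weyl_word_root s (simple_root R i).
have e : weyl_word R s *m simple i = simple j.
  apply/eqP/negPn/negP => /(simple_reflection_nonneg rs).
  rewrite (root_nonneg rs) h2 => /(_ isT).
  rewrite mulmxA -weyl_word_cons root_nonneg ?h //.
  by rewrite weyl_word_root ?simple_root.
by rewrite weyl_word_cons -mulmxA -(weyl_word_conj_simple e) mulmxA simple_reflectionK mul1mx.
Qed.

(** If the word ends in $s_i$, the rest sends $\alpha_i$ to a negative root, and exchange rewrites
    the whole product with two letters fewer. Hence the induction on a bound for the length. *)
Lemma weyl_word_nonneg_eq1 s :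
  (forall i, nonneg_root (weyl_word R s *m simple i)) -> weyl_word R s = 1%:M.
Proof.
have [k] := ubnP (size s); elim: k s => // k ih s sk h.
elim/last_ind: s sk h => [|s i _] sk h; first exact: weyl_word_nil.
have := h i; rewrite weyl_word_rcons -mulmxA simple_reflection_simple mulmxN nonneg_rootN.
case/weyl_exchange=> s' e1 e2; rewrite e1; apply: ih.
  by move: sk; rewrite size_rcons -e2; lia.
by move=> j; rewrite -e1 -weyl_word_rcons.
Qed.

Lemma weyl_word_min_length s : exists2 s', weyl_word R s' = weyl_word R s &
  has_length R (weyl_word R s) (size s').
Proof.
pose P k := [exists t : k.-tuple 'I_l, weyl_word R t == weyl_word R s].
have exP : exists k, P k.
  by exists (size s); apply/existsP; exists (in_tuple s).
case: (ex_minnP exP) => k /existsP [t /eqP et] mink; exists t => //.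
rewrite size_tuple; split; first by exists t; rewrite ?size_tuple.
move=> s' e; apply: mink; apply/existsP; exists (in_tuple s').
by rewrite /= e.
Qed.

(** * The longest element *)

Lemma longest_word w : longest R w -> exists s, w = weyl_word R s.
Proof. by case=> k [[s -> _] _] _; exists s. Qed.

(** If $w\alpha_i$ were positive, a shortest word for $ws_i$ could be exchanged at $i$, giving $w$ a
    word shorter than its length. *)
Lemma longest_simple w i : longest R w -> nonpos_root (w *m simple i).
Proof.
case=> k [[s -> sk] mink] maxk; rewrite root_nonpos ?weyl_word_root ?simple_root //.
apply/negP=> h; have [s' e1 l1] := weyl_word_min_length (rcons s i).
have := maxk _ _ l1.
have : nonpos_root (weyl_word R s' *m simple i).
  by rewrite e1 weyl_word_rcons -mulmxA simple_reflection_simple mulmxN nonpos_rootN.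
case/weyl_exchange=> s2 e2 e3.
have : weyl_word R s = weyl_word R s2.
  by rewrite -e2 e1 weyl_word_rcons -mulmxA simple_reflectionK mulmx1.
move/mink; lia.
Qed.

Lemma mulmx_col (w : 'M[int]_l) a k : (w *m a) k 0 = \sum_i a i 0 * (w *m simple i) k 0.
Proof.
rewrite {1}[a]col_simple mulmx_sumr summxE; apply: eq_bigr => i _.
by rewrite -scalemxAr mxE.
Qed.

Lemma longest_nonneg w a : longest R w -> nonneg_root a -> nonpos_root (w *m a).
Proof.
move=> hw /forallP na; apply/forallP=> k; rewrite mulmx_col.
apply: sumr_le0 => i _; apply: mulr_ge0_le0; first exact: na.
by have /forallP := longest_simple i hw; apply.
Qed.

Lemma longest_nonpos w a : longest R w -> nonpos_root a -> nonneg_root (w *m a).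
Proof.
by move=> hw; rewrite -nonneg_rootN => /(longest_nonneg hw); rewrite mulmxN nonpos_rootN.
Qed.

Lemma longest_involution w : longest R w -> w *m w = 1%:M.
Proof.
move=> hw; have [s e] := longest_word hw; rewrite e -weyl_word_cat.
apply: weyl_word_nonneg_eq1 => i; rewrite weyl_word_cat -e -mulmxA.
by apply/longest_nonpos/longest_simple.
Qed.

Lemma longest_root w a : longest R w -> (w *m a \in roots R) = (a \in roots R).
Proof. by move=> hw; have [s ->] := longest_word hw; exact: weyl_word_rootE. Qed.

(** The matrix $-w$ is its own inverse and has nonnegative integer entries, so it is a permutation
    matrix. *)
Lemma longest_permutes_simple w i : longest R w ->
  exists j, w *m simple i = - simple j.
Proof.
move=> hw; have ww := longest_involution hw.
have nn j k : 0 <= (- (w *m simple j)) k 0.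
  by rewrite mxE oppr_ge0; have /forallP := longest_simple j hw.
have E k : (simple i) k 0 = \sum_j (- (w *m simple i)) j 0 * (- (w *m simple j)) k 0.
  rewrite -[simple i in LHS]mul1mx -ww -mulmxA mulmx_col.
  have N a m : (- a : 'cV[int]_l) m 0 = - a m 0 by rewrite mxE.
  by apply: eq_bigr => j _; rewrite !N mulrNN.
have [j j0] : exists j, (- (w *m simple i)) j 0 != 0.
  apply/existsP; apply: contraT => /existsPn H.
  have : simple i i 0 = 0.
    by rewrite E big1 // => j _; move: (H j); rewrite negbK => /eqP ->; rewrite mul0r.
  by rewrite simpleE eqxx.
(* All terms of the expansion [E] of $\alpha_i$ are nonnegative, so the term with a positive
   coefficient is bounded by $\alpha_i$ coordinate by coordinate. *)
exists j; have jp : 1 <= (- (w *m simple i)) j 0.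
  exact: int_ge1.
have le k : (- (w *m simple j)) k 0 <= simple i k 0.
  rewrite E (bigD1 j) //= -[X in X <= _]addr0; apply: lerD.
    by rewrite -[X in X <= _]mul1r; apply: ler_wpM2r.
  by apply: sumr_ge0 => m _; apply: mulr_ge0.
have ij : - (w *m simple j) = simple i.
  have : - (w *m simple j) != 0.
    by rewrite oppr_eq0; apply: root_neq0; rewrite longest_root // simple_root.
  have z k : k != i -> (- (w *m simple j)) k 0 = 0.
    move=> ki; apply/eqP; rewrite eq_le nn andbT.
    by have := le k; rewrite simpleE (negPf ki).
  move=> n0; have ni : (- (w *m simple j)) i 0 != 0.
    apply: contraNneq n0 => zi; apply/eqP/colP=> k; rewrite [RHS]mxE.
    by case: (eqVneq k i) => [->|/z].
  apply/colP=> k; case: (eqVneq k i) => [->|ki]; last by rewrite z // simpleE (negPf ki).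
  apply/eqP; rewrite eq_le le /= simpleE eqxx mulr1n.
  exact: int_ge1.
by rewrite -ij mulmxN mulmxA ww mul1mx.
Qed.

Lemma longest_coord w i j a : longest R w -> w *m simple i = - simple j ->
  (w *m a) j 0 = - a i 0.
Proof.
move=> hw e; rewrite mulmx_col (bigD1 i) //= e big1 => [|k ki].
  by rewrite mxE simpleE eqxx mulrN1 addr0.
have [m em] := longest_permutes_simple k hw; rewrite em mxE simpleE.
case: eqVneq => [jm|]; last by rewrite oppr0 mulr0.
move: em; rewrite -jm -e => /(congr1 (mulmx w)).
rewrite !mulmxA longest_involution // !mul1mx => /colP /(_ k).
by rewrite !simpleE eqxx (negPf ki).
Qed.

Lemma in_opposite_set w i j J : longest R w -> w *m simple i = - simple j ->
  (j \in opposite_set w J) = (i \in J).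
Proof.
move=> hw e; rewrite inE; apply/exists_inP/idP => [[k kJ /eqP]|iJ]; last first.
  by exists i => //; rewrite mulmxN e opprK.
move=> ek; suff -> : i = k by [].
have : w *m simple i = w *m simple k by rewrite e ek mulmxN opprK.
move/(congr1 (mulmx w)); rewrite !mulmxA longest_involution // !mul1mx.
by move/colP/(_ i); rewrite !simpleE eqxx; case: (i =P k).
Qed.

Lemma supported_longest w J a : longest R w ->
  supported (opposite_set w J) (w *m a) = supported J a.
Proof.
move=> hw; apply/forallP/forallP => h i.
  have [j e] := longest_permutes_simple i hw.
  by have := h j; rewrite (in_opposite_set _ hw e) (longest_coord _ hw e) oppr_eq0.
have [j e] := longest_permutes_simple i hw.
have e' : w *m simple j = - simple i.
  by rewrite -[simple i]mul1mx -(longest_involution hw) -mulmxA e mulmxN opprK.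
by have := h j; rewrite (in_opposite_set _ hw e') (longest_coord _ hw e') oppr_eq0.
Qed.

Lemma supported_longest' w J a : longest R w ->
  supported J (w *m a) = supported (opposite_set w J) a.
Proof.
by move=> hw; rewrite -(supported_longest _ _ hw) mulmxA longest_involution // mul1mx.
Qed.

Lemma height_longest w a : longest R w -> height (w *m a) = - height a.
Proof.
move=> hw; rewrite /height; under eq_bigr do rewrite mulmx_col.
rewrite exchange_big /= -sumrN; apply: eq_bigr => i _.
have [j ->] := longest_permutes_simple i hw.
rewrite -mulr_sumr (bigD1 j) //= big1 => [|k kj].
  by rewrite mxE simpleE eqxx addr0 mulrN1.
by rewrite mxE simpleE (negPf kj) oppr0.
Qed.

(** Greedy construction: while some $\alpha_j$ with $j\in J$ is not sent to a negative root,
    appending $s_j$ increases the number of inversions, which is bounded by the number of roots. *)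
Lemma weyl_word_flips J : exists2 s, all (mem J) s &
  forall j, j \in J -> nonpos_root (weyl_word R s *m simple j).
Proof.
pose inv s := [seq a <- roots R | nonneg_root a && nonpos_root (weyl_word R s *m a)].
have inv_lt s j : ~~ nonpos_root (weyl_word R s *m simple j) ->
    (size (inv s) < size (inv (rcons s j)))%N.
  move=> nj; have rj := weyl_word_root s (simple_root R j).
  pose t := simple j :: map (mulmx (simple_reflection R j)) (inv s).
  have -> : (size (inv s)).+1 = size t by rewrite /= size_map.
  apply: uniq_leq_size => [|x].
    have ui : uniq (inv s) by rewrite filter_uniq // roots_uniq.
    have inj : injective (mulmx (simple_reflection R j) : 'cV_l -> 'cV_l).
      by move=> x y /(congr1 (mulmx (simple_reflection R j))); rewrite !mulmxA simple_reflectionK !mul1mx.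
    rewrite /= map_inj_uniq // ui andbT.
    apply/negP=> /mapP [a]; rewrite mem_filter => /andP [/andP [na _] ra] e.
    suff e2 : a = - simple j.
      by move: na; rewrite e2 nonneg_rootN root_nonpos ?simple_root // simple_nonneg.
    by rewrite -[a]mul1mx -(simple_reflectionK j) -mulmxA -e simple_reflection_simple.
  rewrite inE => /predU1P [->|/mapP [a]].
    by rewrite mem_filter simple_root simple_nonneg weyl_word_rcons -mulmxA simple_reflection_simple mulmxN nonpos_rootN root_nonneg ?nj.
  rewrite !mem_filter => /andP [/andP [na na2] ra] ->.
  rewrite simple_reflection_root // weyl_word_rcons -mulmxA (mulmxA (simple_reflection R j)) simple_reflectionK mul1mx na2 !andbT.
  by apply: simple_reflection_nonneg => //; apply: contraNneq nj => <-.
suff H k s : all (mem J) s -> (size (roots R) <= k + size (inv s))%N ->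
  exists2 s, all (mem J) s & forall j, j \in J -> nonpos_root (weyl_word R s *m simple j).
  by apply: (H (size (roots R)) [::]) => //; exact: leq_addr.
elim: k s => [|k ih] s sJ sk.
  exists s => // j _; apply: contraT => /inv_lt.
  have : (size (inv (rcons s j)) <= size (roots R))%N by rewrite size_filter count_size.
  lia.
case: (boolP [forall j in J, nonpos_root (weyl_word R s *m simple j)]) => [/forall_inP|].
  by exists s.
rewrite negb_forall_in => /exists_inP [j jJ /inv_lt nj].
apply: (ih (rcons s j)); last by lia.
by rewrite all_rcons sJ andbT.
Qed.

Lemma supported_weyl_word J s a : all (mem J) s ->
  supported J (weyl_word R s *m a) = supported J a.
Proof.
move=> sJ; apply: eq_forallb => i; case: (boolP (i \in J)) => //= iJ.
by rewrite (weyl_word_coord _ sJ).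
Qed.

Lemma weyl_word_flips_supported J s a :
  (forall j, j \in J -> nonpos_root (weyl_word R s *m simple j)) ->
  supported J a -> nonneg_root a -> nonpos_root (weyl_word R s *m a).
Proof.
move=> hs /forallP sa /forallP na; apply/forallP=> k; rewrite mulmx_col.
apply: sumr_le0 => j _; case/orP: (sa j) => [/hs/forallP /(_ k)|/eqP ->].
  exact: mulr_ge0_le0.
by rewrite mul0r.
Qed.

(** Such a vector is fixed by the whole Weyl group. Let $w$ flip the simple roots at its positive
    coordinates; the other simple roots stay positive under $w$. Then every term of $wa=\sum_j
    a_j\,w\alpha_j$ has nonpositive coordinates, so $a$ has no positive coordinate. The same holds
    for $-a$. *)
Lemma pairing_simple_coroots_eq0 a :
  (forall i, pairing a (coroot R (simple i)) = 0) -> a = 0.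
Proof.
have key x : (forall i, pairing x (coroot R (simple i)) = 0) -> forall i, x i 0 <= 0.
  move=> hx i; rewrite leNgt; apply/negP=> xi.
  pose S := [set i | 0 < x i 0]; have [s sS fl] := weyl_word_flips S.
  have e : weyl_word R s *m x = x.
    elim: (s) => [|j t ih]; first by rewrite weyl_word_nil mul1mx.
    by rewrite weyl_word_cons -mulmxA ih simple_reflectionE hx scale0r subr0.
  move: xi; rewrite -e mulmx_col ltNge => /negP; apply.
  apply: sumr_le0 => j _; case: (boolP (j \in S)) => jS.
    apply: mulr_ge0_le0; first by move: jS; rewrite inE => /ltW.
    by have /forallP := fl j jS.
  apply: mulr_le0_ge0; first by move: jS; rewrite inE -leNgt.
  have : nonneg_root (weyl_word R s *m simple j).
    apply: (@root_pos_coord _ j); first by rewrite weyl_word_root ?simple_root.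
    by rewrite (weyl_word_coord _ sS) // simpleE eqxx.
  by move/forallP.
move=> h; apply/colP=> i; rewrite mxE; apply/eqP; rewrite eq_le key //=.
by have := key (- a) _ i; rewrite mxE oppr_le0; apply=> j; rewrite pairingN h oppr0.
Qed.

Lemma eq_root_pairing a b :
  (forall i, pairing a (coroot R (simple i)) = pairing b (coroot R (simple i))) ->
  a = b.
Proof.
move=> h; apply/eqP; rewrite -subr_eq0; apply/eqP/pairing_simple_coroots_eq0 => i.
by rewrite pairingB h subrr.
Qed.

Lemma det_cartan : \det (cartan_matrix R) != 0.
Proof.
apply/negP=> /det0P [x x0 ex]; case/eqP: x0; apply: trmx_inj; rewrite trmx0.
apply: pairing_simple_coroots_eq0 => i; move/rowP/(_ i): ex; rewrite !mxE => e.
rewrite /pairing mxE -[RHS]e; apply: eq_bigr => j _.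
by rewrite !mxE pairing_simple mulrC.
Qed.

(** * Irreducible components *)

Definition orthogonal_split (A Q : pred 'cV[int]_l) :=
  forall a b, A a -> A b -> Q a -> ~~ Q b -> pairing a (coroot R b) = 0.

(** A root outside [Q] would be orthogonal to every simple root in its support, which makes $\langle
    a,a^\vee\rangle$ zero instead of 2. *)
Lemma split_simple_subsystem J Q : orthogonal_split (subsystem R J) Q ->
  (forall j, j \in J -> Q (simple j)) -> forall a, subsystem R J a -> Q a.
Proof.
move=> hQ hJ a ha; apply/negPn/negP=> na; have /andP [ra sa] := ha.
have := pairing_coroot ra; rewrite {1}[a]col_simple.
suff -> : pairing (\sum_i a i 0 *: simple i) (coroot R a) = 0 by [].
rewrite /pairing mulmx_sumr summxE big1 // => i _; rewrite -/(pairing _ _) pairingZ.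
move/forallP/(_ i)/orP: sa => [iJ|/eqP ->]; last by rewrite mul0r.
rewrite hQ ?mulr0 ?hJ // /subsystem simple_root; apply/forallP=> j.
by rewrite simpleE; case: (j =P i) => [->|_]; rewrite ?iJ ?orbT.
Qed.

Lemma subsystem_simple J j : j \in J -> subsystem R J (simple j).
Proof.
move=> jJ; rewrite /subsystem simple_root; apply/forallP=> i.
by rewrite simpleE; case: (i =P j) => [->|_]; rewrite ?jJ ?orbT.
Qed.

Lemma orthogonal_splitC J Q : orthogonal_split (subsystem R J) Q ->
  orthogonal_split (subsystem R J) (predC Q).
Proof.
move=> hQ a b ha hb /= na; rewrite negbK => qb.
have /andP [ra _] := ha; have /andP [rb _] := hb.
by apply: coroot_orth_sym; rewrite // hQ.
Qed.

Lemma split_simple_irreducible J : J != set0 ->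
  (forall Q, orthogonal_split (subsystem R J) Q ->
     (forall j, j \in J -> Q (simple j)) \/ (forall j, j \in J -> ~~ Q (simple j))) ->
  irreducible_roots R (subsystem R J).
Proof.
case/set0Pn=> j jJ h; split; first by exists (simple j); exact: subsystem_simple.
move=> Q hQ; case: (h Q hQ) => hs; first by left; exact: split_simple_subsystem.
right=> a ha; apply: (@split_simple_subsystem J (predC Q)) => //.
exact: orthogonal_splitC.
Qed.

Definition support_set a : {set 'I_l} := [set i | a i 0 != 0].

Lemma supported_support J a : supported J a = (support_set a \subset J).
Proof.
apply/forallP/subsetP => h i; first by rewrite inE => ai; have := h i; rewrite (negPf ai) orbF.
by case: (boolP (a i 0 == 0)) => ai; rewrite ?orbT // h // inE.
Qed.

(* If the support split into orthogonal parts S1 and S2, an element of W_S1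
   would make the S1-part of a nonpositive while fixing its S2-part, producing
   a root with coordinates of both signs. *)
Lemma support_irreducible a : a \in roots R ->
  irreducible_roots R (subsystem R (support_set a)).
Proof.
wlog na : a / nonneg_root a.
  move=> H ra; case/orP: (root_sign ra) => na; first exact: H.
  have -> : support_set a = support_set (- a).
    by apply/setP=> i; rewrite !inE mxE oppr_eq0.
  by apply: H; rewrite ?nonneg_rootN ?roots_opp.
move=> ra; apply: split_simple_irreducible.
  apply/set0Pn/existsP; apply: contraR (root_neq0 ra) => /existsPn H.
  by apply/eqP/colP=> i; move: (H i); rewrite inE negbK mxE => /eqP.
move=> Q hQ; set S := support_set a.
case: (boolP [exists j in S, Q (simple j)]) => [/exists_inP [j jS qj]|]; last first.
  by rewrite negb_exists_in => /forall_inP; right.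
case: (boolP [exists j in S, ~~ Q (simple j)]) => [/exists_inP [k kS qk]|]; last first.
  by rewrite negb_exists_in => /forall_inP H; left=> i /H; rewrite negbK.
pose S1 := [set i in S | Q (simple i)].
have [s sS fl] := weyl_word_flips S1.
have fixS2 m : m \in S -> ~~ Q (simple m) -> weyl_word R s *m simple m = simple m.
  move=> mS qm; elim: (s) sS => [|i t ih] /=; first by rewrite weyl_word_nil mul1mx.
  rewrite inE => /andP [/andP [iS qi] /ih tS].
  rewrite weyl_word_cons -mulmxA tS simple_reflectionE (_ : pairing _ _ = 0) ?scale0r ?subr0 //.
  by apply: coroot_orth_sym; rewrite ?simple_root // hQ // subsystem_simple.
have rb := weyl_word_root s ra.
have nb : nonneg_root (weyl_word R s *m a).
  apply: (@root_pos_coord _ k) => //; rewrite (weyl_word_coord _ sS); last by rewrite inE (negPf qk) andbF.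
  by move: kS; rewrite inE lt_def => -> /=; move/forallP: na; apply.
pose a1 : 'cV_l := \sum_(i in S1) a i 0 *: simple i.
have coord i : i \in S1 -> (weyl_word R s *m a) i 0 = (weyl_word R s *m a1) i 0.
  move=> iS; rewrite {1}[a]col_simple (bigID (mem S1)) /= mulmxDr mxE -/a1.
  rewrite -[RHS]addr0; congr (_ + _); rewrite mulmx_sumr summxE big1 // => m mS1.
  rewrite -scalemxAr mxE; case: (boolP (m \in S)) => mS; last first.
    by move: mS; rewrite inE negbK => /eqP ->; rewrite mul0r.
  have qm : ~~ Q (simple m) by apply: contra mS1 => qm; rewrite inE mS.
  rewrite fixS2 // simpleE; case: eqVneq => [im|]; last by rewrite mulr0.
  by move: mS1; rewrite -im iS.
have a1_neg i : (weyl_word R s *m a1) i 0 <= 0.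
  rewrite mulmx_sumr summxE; apply: sumr_le0 => m mS1; rewrite -scalemxAr mxE.
  apply: mulr_ge0_le0; first by move/forallP: na; apply.
  by have /forallP := fl m mS1.
have a1_out i : i \notin S1 -> (weyl_word R s *m a1) i 0 = 0.
  move=> iS; rewrite (weyl_word_coord _ sS) // summxE big1 // => m mS.
  by rewrite mxE simpleE; case: eqVneq => [im|]; [move: iS; rewrite im mS|rewrite mulr0].
have z : weyl_word R s *m a1 = 0.
  apply/colP=> i; rewrite [RHS]mxE; case: (boolP (i \in S1)) => iS; last exact: a1_out.
  apply/eqP; rewrite eq_le a1_neg /= -coord //; move/forallP: nb; exact.
have : a1 = 0 by rewrite -[a1]mul1mx -(weyl_word_Krev s) -mulmxA z mulmx0.
move/colP/(_ j); rewrite mxE summxE (bigD1 j) /=; last by rewrite inE jS qj.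
rewrite big1 => [|i /andP [_ ij]]; last by rewrite mxE simpleE eq_sym (negPf ij) mulr0.
rewrite mxE simpleE eqxx mulr1 addr0 => aj; move: jS; rewrite inE aj eqxx.
by [].
Qed.

(** A splitting of the union is trivial on each part, and the common index forces the same
    alternative on both. *)
Lemma irreducible_union J1 J2 j : j \in J1 -> j \in J2 ->
  irreducible_roots R (subsystem R J1) -> irreducible_roots R (subsystem R J2) ->
  irreducible_roots R (subsystem R (J1 :|: J2)).
Proof.
move=> j1 j2 [_ h1] [_ h2]; apply: split_simple_irreducible.
  by apply/set0Pn; exists j; rewrite inE j1.
move=> Q hQ.
have sub (J : {set 'I_l}) a : J \subset J1 :|: J2 -> subsystem R J a -> subsystem R (J1 :|: J2) a.
  move=> /subsetP JJ /andP [ra sa]; rewrite /subsystem ra; apply/forallP=> i.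
  by case/orP: (forallP sa i) => [/JJ ->|->] //; rewrite orbT.
have q1 : orthogonal_split (subsystem R J1) Q.
  by move=> a b ha hb; apply: hQ; apply: (sub J1); rewrite ?subsetUl.
have q2 : orthogonal_split (subsystem R J2) Q.
  by move=> a b ha hb; apply: hQ; apply: (sub J2); rewrite ?subsetUr.
have c1 := subsystem_simple j1; have c2 := subsystem_simple j2.
case: (h1 Q q1) => H1; case: (h2 Q q2) => H2.
- by left=> i; rewrite inE => /orP [] iJ; [apply: H1|apply: H2]; exact: subsystem_simple.
- by have := H2 _ c2; rewrite (H1 _ c1).
- by have := H1 _ c1; rewrite (H2 _ c2).
- by right=> i; rewrite inE => /orP [] iJ; [apply: H1|apply: H2]; exact: subsystem_simple.
Qed.

(** The support of a root is irreducible, so its union with a component meeting it is irreducible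
    and equals that component by maximality. This turns the complement of the $\Phi_i'^-$ into the
    condition of not being supported on $I'$. *)
Lemma supported_components J D a : irreducible_components R J D ->
  a \in roots R -> supported J a = [exists B in D, supported B a].
Proof.
move=> [/and3P [/eqP cD tD D0] hD] ra; apply/idP/exists_inP => [sa|[B BD]]; last first.
  rewrite !supported_support => /subset_trans; apply.
  by rewrite -cD; exact: bigcup_sup.
have irr := support_irreducible ra; move: sa; rewrite supported_support => sa.
have [i iS] : exists i, i \in support_set a.
  apply/existsP; apply: contraR (root_neq0 ra) => /existsPn H.
  by apply/eqP/colP=> i; move: (H i); rewrite inE negbK mxE => /eqP.
have := subsetP sa i iS; rewrite -cD => /bigcupP [B BD iB].
have [irrB maxB] := hD B BD; exists B => //; rewrite supported_support.
have <- : B :|: support_set a = B; last exact: subsetUr.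
apply: maxB; rewrite ?subsetUl //; last exact: (irreducible_union iB iS).
by rewrite subUset sa andbT -cD; exact: bigcup_sup.
Qed.

(** * Roots of the parabolic subalgebra *)

Definition parabolic_root J a := nonpos_root a || supported J a.

Lemma supportedD J a b : supported J a -> supported J b -> supported J (a + b).
Proof.
move=> /forallP ha /forallP hb; apply/forallP=> i; rewrite mxE.
by case/orP: (ha i) => [->//|/eqP ->]; case/orP: (hb i) => [->//|/eqP ->]; rewrite addr0 eqxx orbT.
Qed.

Lemma supportedN J a : supported J (- a) = supported J a.
Proof. by apply: eq_forallb => i; rewrite mxE oppr_eq0. Qed.

(** This form of the condition is visibly stable under $\mathcal W_J$, which changes only the
    coordinates in $J$; nonpositivity alone is not. *)
Lemma parabolic_rootP J a : a \in roots R ->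
  reflect (supported J a \/ exists2 i, i \notin J & a i 0 < 0) (parabolic_root J a).
Proof.
move=> ra; apply: (iffP idP) => [|[sa|[i iJ ai]]]; last 2 first.
- by rewrite /parabolic_root sa orbT.
- by rewrite /parabolic_root (root_neg_coord ra ai).
case: (boolP (supported J a)) => sa; first by left.
rewrite /parabolic_root (negPf sa) orbF => /forallP na; right.
move: sa; rewrite negb_forall => /existsP [i]; rewrite negb_or => /andP [iJ ai].
by exists i; rewrite // lt_def eq_sym ai na.
Qed.

Lemma parabolic_root_le J a i : a \in roots R -> parabolic_root J a -> i \notin J -> a i 0 <= 0.
Proof.
move=> ra /orP [/forallP na _|/forallP /(_ i) sa iJ]; first exact: na.
by move: sa; rewrite (negPf iJ) => /eqP ->.
Qed.

Lemma parabolic_rootD J a b : a \in roots R -> b \in roots R -> a + b \in roots R ->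
  parabolic_root J a -> parabolic_root J b -> parabolic_root J (a + b).
Proof.
move=> ra rb rab pa pb; have [pa' pb'] := (pa, pb); apply/parabolic_rootP => //.
case: (parabolic_rootP J ra) pa => // -[sa|[i iJ ai]] pa.
  case: (parabolic_rootP J rb) pb => // -[sb|[i iJ bi]] pb; first by left; exact: supportedD.
  right; exists i => //; rewrite mxE -[ltRHS]addr0; apply: ler_ltD bi.
  exact: parabolic_root_le ra pa' iJ.
right; exists i => //; rewrite mxE -[ltRHS]addr0; apply: ltr_leD ai _.
exact: parabolic_root_le rb pb' iJ.
Qed.

Lemma parabolic_root_weyl J s a : a \in roots R -> all (mem J) s ->
  parabolic_root J a -> parabolic_root J (weyl_word R s *m a).
Proof.
move=> ra sJ; have rb := weyl_word_root s ra.
case: (parabolic_rootP J ra) => // -[sa|[i iJ ai]] _; apply/parabolic_rootP => //.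
  by left; rewrite supported_weyl_word.
by right; exists i => //; rewrite (weyl_word_coord _ sJ).
Qed.

End RootSystem.

(** * Matrix exponentials *)

Section Exponential.
Variables (R : comUnitRingType) (n : nat).
Hypothesis natU : forall k, (k.+1%:R : R) \is a GRing.unit.
Implicit Types (A B Y : 'M[R]_n) (x y : R).

Definition lie A B := A *m B - B *m A.

Lemma expZmx x A k : (x *: A) ^+ k = x ^+ k *: A ^+ k.
Proof.
elim: k => [|k ih]; first by rewrite !expr0 scale1r.
by rewrite !exprS ih -!mulmxE -scalemxAl -scalemxAr scalerA.
Qed.

Lemma expmxS A k : A ^+ k.+1 = A *m A ^+ k.
Proof. by rewrite exprS. Qed.

Lemma expmxSr A k : A ^+ k.+1 = A ^+ k *m A.
Proof. by rewrite exprSr. Qed.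

Lemma expmx_eq0 A k : A ^+ n = 0 -> (n <= k)%N -> A ^+ k = 0.
Proof. by move=> nil nk; rewrite -(subnK nk) exprD nil mulr0. Qed.

Lemma fact_unit k : (k`!%:R : R) \is a GRing.unit.
Proof. by elim: k => [|k ih]; rewrite ?unitr1 // factS natrM unitrM natU ih. Qed.

Lemma fact_bin_inv k i : (i <= k)%N ->
  (k`!%:R : R)^-1 *+ 'C(k, i) = i`!%:R^-1 * (k - i)`!%:R^-1.
Proof.
move=> ik; apply: (mulrI (fact_unit k)); rewrite -[_^-1 *+ _]mulr_natr mulrA divrr ?fact_unit // mul1r.
apply: (mulIr (fact_unit i)); apply: (mulIr (fact_unit (k - i))).
rewrite -mulrA -natrM -natrM (bin_fact ik) mulrAC -!mulrA.
by rewrite mulKr ?fact_unit // mulVr ?fact_unit // mulr1.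
Qed.

(** Summation along antidiagonals. The bound [m + m] covers all pairs of the square, and the
    vanishing hypothesis removes the rest of the triangle. *)
Lemma sum_square_triangle (V : zmodType) m (F : nat -> nat -> V) :
  (forall i j, (m <= i)%N || (m <= j)%N -> F i j = 0) ->
  \sum_(0 <= i < m) \sum_(0 <= j < m) F i j =
  \sum_(0 <= k < m + m) \sum_(0 <= i < k.+1) F i (k - i)%N.
Proof.
move=> F0.
have -> : \sum_(0 <= k < m + m) \sum_(0 <= i < k.+1) F i (k - i)%N =
  \sum_(0 <= k < m + m) \sum_(0 <= i < m + m | (i <= k)%N) F i (k - i)%N.
  rewrite [LHS]big_nat [RHS]big_nat; apply: eq_bigr => k /andP [_ km].
  rewrite (big_nat_widen 0 k.+1 (m + m)) //.
rewrite [RHS](exchange_big_dep_nat xpredT) //=.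
rewrite [RHS](@big_cat_nat _ _ _ m) ?leq_addr //= [X in _ = _ + X]big_nat [X in _ = _ + X]big1 ?addr0; last first.
  by move=> i /andP [mi _]; rewrite big1 // => j _; rewrite F0 ?mi.
rewrite [LHS]big_nat [RHS]big_nat; apply: eq_bigr => i /andP [_ im].
have -> : \sum_(0 <= k < m + m | (i <= k)%N) F i (k - i)%N = \sum_(i <= k < m + m) F i (k - i)%N.
  by rewrite (big_nat_widenl i 0).
rewrite -{2}[i]add0n big_addn.
rewrite [RHS](@big_cat_nat _ _ _ m) //=; last by lia.
rewrite [X in _ = _ + X]big_nat [X in _ = _ + X]big1 ?addr0; last first.
  by move=> j /andP [mj _]; rewrite addnK F0 ?mj ?orbT.
by apply: eq_bigr => j _; rewrite addnK.
Qed.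

(** This is [nilexp] over a ring: the reordering argument exponentiates matrices with polynomial
    entries. Over a field the two are convertible. *)
Definition mexp A : 'M[R]_n := \sum_(k < n) (k`!%:R)^-1 *: A ^+ k.

Lemma mexp_widen A N : A ^+ n = 0 -> (n <= N)%N ->
  mexp A = \sum_(0 <= k < N) (k`!%:R)^-1 *: A ^+ k.
Proof.
move=> nil nN; rewrite /mexp -(big_mkord xpredT (fun k => (k`!%:R)^-1 *: A ^+ k)).
rewrite [RHS](@big_cat_nat _ _ _ n) //= [X in _ = _ + X]big_nat [X in _ = _ + X]big1 ?addr0 //.
by move=> k /andP [nk _]; rewrite expmx_eq0 // scaler0.
Qed.

Lemma expmx_scale0 x A : A ^+ n = 0 -> (x *: A) ^+ n = 0.
Proof. by move=> nil; rewrite expZmx nil scaler0. Qed.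

Lemma mexpD A x y : A ^+ n = 0 ->
  mexp ((x + y) *: A) = mexp (x *: A) *m mexp (y *: A).
Proof.
move=> nil; have nilZ z := expmx_scale0 z nil.
rewrite (mexp_widen (nilZ _) (leq_addl n n)) !(mexp_widen (nilZ _) (leqnn n)).
pose F i j := (i`!%:R^-1 * j`!%:R^-1) *: (x ^+ i * y ^+ j *: A ^+ (i + j)).
transitivity (\sum_(0 <= i < n) \sum_(0 <= j < n) F i j); last first.
  rewrite mulmx_suml; apply: eq_bigr => i _; rewrite mulmx_sumr; apply: eq_bigr => j _.
  rewrite /F !expZmx exprD -mulmxE -!scalemxAl -!scalemxAr !scalerA.
  by congr (_ *: _); ring.
rewrite sum_square_triangle => [|i j h]; last first.
  rewrite /F expmx_eq0 ?scaler0 //; lia.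
apply: eq_bigr => k _; rewrite expZmx [x + y]addrC exprDn big_mkord scaler_suml scaler_sumr.
apply: eq_bigr => i _; have ik : (i <= k)%N by rewrite -ltnS.
rewrite /F.
rewrite subnKC // -fact_bin_inv // !scalerA [x ^+ i * _]mulrC; congr (_ *: _).
by rewrite mulrnAl mulrnAr.
Qed.

Lemma mexp0 : mexp 0 = 1%:M.
Proof.
rewrite /mexp; case: n => [|m]; first by apply/matrixP => -[].
rewrite big_ord_recl expr0 fact0 invr1 scale1r big1 ?addr0 // => i _.
by rewrite exprS mul0r scaler0.
Qed.

Lemma mexpNK A x : A ^+ n = 0 -> mexp (x *: A) *m mexp (- x *: A) = 1%:M.
Proof. by move=> nil; rewrite -mexpD // subrr scale0r mexp0. Qed.

Lemma mexpKN A x : A ^+ n = 0 -> mexp (- x *: A) *m mexp (x *: A) = 1%:M.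
Proof. by move=> nil; rewrite -mexpD // addNr scale0r mexp0. Qed.

(** Binomial theorem for two commuting operators, left multiplication by $A$ and right
    multiplication by $-A$. *)
Lemma iter_lie A Y k : iter k (lie A) Y =
  \sum_(0 <= i < k.+1) (A ^+ i *m Y *m (- A) ^+ (k - i)) *+ 'C(k, i).
Proof.
elim: k => [|k ih].
  by rewrite big_nat1 /= !expr0 bin0 mulr1n mul1mx mulmx1.
have mnr (B Z : 'M[R]_n) m : B *m (Z *+ m) = (B *m Z) *+ m by exact: mulrnAr.
have mnl (B Z : 'M[R]_n) m : (B *+ m) *m Z = (B *m Z) *+ m by exact: mulrnAl.
rewrite iterS ih /lie mulmx_sumr mulmx_suml.
rewrite [in RHS]big_nat_recl //= bin0 mulr1n.
under [X in _ = _ + X]eq_bigr do rewrite binS mulrnDr.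
rewrite big_split /= [X in _ = _ + (X + _)]big_nat_recr //=.
rewrite bin_small // mulr0n addr0.
have -> : \sum_(0 <= i < k.+1) A *m (A ^+ i *m Y *m (- A) ^+ (k - i) *+ 'C(k, i)) =
  \sum_(0 <= i < k.+1) A ^+ i.+1 *m Y *m (- A) ^+ (k.+1 - i.+1) *+ 'C(k, i).
  by apply: eq_bigr => i _; rewrite mnr expmxS subSS !mulmxA.
rewrite addrA [RHS]addrC; congr (_ + _).
rewrite -sumrN big_nat_recl //= bin0 mulr1n; congr (_ + _).
  by rewrite !subn0 expmxSr !mulmxA mulmxN.
rewrite [LHS]big_nat [RHS]big_nat; apply: eq_bigr => i /andP [_ ik].
rewrite mnl -mulNrn; congr (_ *+ _).
by rewrite subSS -(subnSK ik) [(- A) ^+ _.+1]expmxSr mulmxA mulmxN.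
Qed.

(** $\mathrm{Ad}(\exp A)=\exp(\mathrm{ad}\,A)$. The bound is [n + n] because $A^n=0$ only forces the
    powers of $\mathrm{ad}\,A$ from $2n-1$ on to vanish. *)
Lemma mexp_conj A Y N : A ^+ n = 0 -> (n + n <= N)%N ->
  mexp A *m Y *m mexp (- A) = \sum_(0 <= k < N) (k`!%:R)^-1 *: iter k (lie A) Y.
Proof.
move=> nil nN; have nilN : (- A) ^+ n = 0 by rewrite exprNn nil mulr0.
pose F i j := (i`!%:R^-1 * j`!%:R^-1) *: (A ^+ i *m Y *m (- A) ^+ j).
have F0 i j : (n <= i)%N || (n <= j)%N -> F i j = 0.
  rewrite /F => /orP [] h; first by rewrite (expmx_eq0 nil h) !mul0mx scaler0.
  by rewrite (expmx_eq0 nilN h) mulmx0 scaler0.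
have T k : (k`!%:R)^-1 *: iter k (lie A) Y = \sum_(0 <= i < k.+1) F i (k - i)%N.
  rewrite iter_lie scaler_sumr [LHS]big_nat [RHS]big_nat.
  apply: eq_bigr => i /andP [_ ik]; rewrite /F -fact_bin_inv // -scaler_nat scalerA.
  by rewrite mulr_natr.
rewrite [RHS](@big_cat_nat _ _ _ (n + n)%N) //= [X in _ = _ + X]big_nat.
rewrite [X in _ = _ + X]big1 ?addr0 => [|k /andP [nk _]]; last first.
  rewrite T big_nat big1 // => i /andP [_ ik]; apply: F0; lia.
rewrite (eq_bigr _ (fun k _ => T k)) -sum_square_triangle //.
rewrite (mexp_widen nil (leqnn n)) (mexp_widen nilN (leqnn n)) !mulmx_suml.
apply: eq_bigr => i _; rewrite mulmx_sumr; apply: eq_bigr => j _.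
by rewrite /F -!scalemxAl -scalemxAr scalerA.
Qed.

Lemma lie0r A : lie A 0 = 0.
Proof. by rewrite /lie mulmx0 mul0mx subrr. Qed.

Lemma mexp_conj_lie1 A Y : A ^+ n = 0 -> lie A Y = 0 ->
  mexp A *m Y *m mexp (- A) = Y.
Proof.
move=> nil e; rewrite (mexp_conj _ nil (leqnSn _)) big_nat_recl //= fact0 invr1 scale1r.
rewrite big1 ?addr0 // => k _; suff -> : lie A (iter k (lie A) Y) = 0 by rewrite scaler0.
by elim: k => [|k ih] /=; [exact: e|rewrite ih lie0r].
Qed.

Lemma mexp_conj_lie2 A Y : A ^+ n = 0 -> lie A (lie A Y) = 0 ->
  mexp A *m Y *m mexp (- A) = Y + lie A Y.
Proof.
move=> nil e; rewrite (mexp_conj (N := (n + n).+2) _ nil) //; last by lia.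
rewrite !big_nat_recl //= fact0 invr1 !scale1r addrA.
rewrite big1 ?addr0 // => k _; suff -> : lie A (lie A (iter k (lie A) Y)) = 0 by rewrite scaler0.
by elim: k => [|k ih] /=; [exact: e|rewrite ih lie0r].
Qed.

Lemma mexp_conj_lie3 A Y : A ^+ n = 0 -> lie A (lie A (lie A Y)) = 0 ->
  mexp A *m Y *m mexp (- A) = Y + lie A Y + 2%:R^-1 *: lie A (lie A Y).
Proof.
move=> nil e; rewrite (mexp_conj (N := (n + n).+3) _ nil) //; last by lia.
rewrite !big_nat_recl //= fact0 invr1 !scale1r !addrA.
rewrite big1 ?addr0 // => k _.
suff -> : lie A (lie A (lie A (iter k (lie A) Y))) = 0 by rewrite scaler0.
by elim: k => [|k ih] /=; [exact: e|rewrite ih lie0r].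
Qed.

Variable D : R -> R.
Hypothesis DD : forall x y, D (x + y) = D x + D y.
Hypothesis DM : forall x y, D (x * y) = D x * y + x * D y.

Lemma der0 : D 0 = 0.
Proof. by apply: (addIr (D 0)); rewrite -DD !add0r. Qed.

Lemma der_sum I r (P : pred I) F : D (\sum_(i <- r | P i) F i) = \sum_(i <- r | P i) D (F i).
Proof. exact: (big_morph D DD der0). Qed.

Lemma derMmx m p q (A : 'M[R]_(m, p)) (B : 'M[R]_(p, q)) :
  map_mx D (A *m B) = map_mx D A *m B + A *m map_mx D B.
Proof.
apply/matrixP=> i j; rewrite !mxE der_sum -big_split /=; apply: eq_bigr => k _.
by rewrite !mxE DM.
Qed.

Lemma derDmx m p (A B : 'M[R]_(m, p)) : map_mx D (A + B) = map_mx D A + map_mx D B.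
Proof. by apply/matrixP=> i j; rewrite !mxE DD. Qed.

Lemma derZmx m p x (A : 'M[R]_(m, p)) :
  map_mx D (x *: A) = D x *: A + x *: map_mx D A.
Proof. by apply/matrixP=> i j; rewrite !mxE DM. Qed.

Lemma der1 : D 1 = 0.
Proof. by apply: (addIr (D 1)); rewrite add0r -{3}[1]mulr1 DM mulr1 mul1r. Qed.

Lemma der1mx p : map_mx D 1%:M = 0 :> 'M_p.
Proof.
by apply/matrixP=> i j; rewrite !mxE; case: (_ == _); rewrite ?mulr1n ?mulr0n ?der1 ?der0.
Qed.

Lemma der_sum_mx I r (P : pred I) m p (F : I -> 'M[R]_(m, p)) :
  map_mx D (\sum_(i <- r | P i) F i) = \sum_(i <- r | P i) map_mx D (F i).
Proof.
by apply/matrixP=> i j; rewrite mxE !summxE der_sum; apply: eq_bigr => k _; rewrite mxE.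
Qed.

Lemma derX x k : D (x ^+ k.+1) = k.+1%:R * x ^+ k * D x.
Proof.
elim: k => [|k ih]; first by rewrite !expr1 expr0 !mul1r.
rewrite exprS DM ih exprS -[k.+2%:R]/(k.+1.+1%:R) [k.+1.+1%:R]mulrSr; ring.
Qed.

Lemma der_natV k : D (k.+1%:R)^-1 = 0.
Proof.
have dn m : D m%:R = 0 by elim: m => [|m ih]; rewrite ?der0 // mulrSr DD ih der1 addr0.
apply: (mulrI (natU k)); rewrite mulr0; apply: (addrI (D k.+1%:R * k.+1%:R^-1)).
by rewrite -DM divrr ?natU // der1 dn mul0r add0r.
Qed.

Lemma der_factV k : D (k`!%:R)^-1 = 0.
Proof. by have := der_natV k`!.-1; rewrite prednK ?fact_gt0. Qed.

Lemma der_mexp A x : A ^+ n = 0 -> map_mx D A = 0 ->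
  map_mx D (mexp (x *: A)) = D x *: A *m mexp (x *: A).
Proof.
move=> nil dA; have nilZ := expmx_scale0 x nil.
have dAk k : map_mx D (A ^+ k) = 0.
  elim: k => [|k ih]; first by rewrite expr0 der1mx.
  by rewrite expmxS derMmx dA ih mul0mx mulmx0 addr0.
rewrite {1}(mexp_widen nilZ (leqnSn _)) (mexp_widen nilZ (leqnn _)).
rewrite big_nat_recl // derDmx expr0 derZmx der1mx scaler0 addr0 der_factV scale0r add0r.
rewrite der_sum_mx mulmx_sumr; apply: eq_bigr => k _.
rewrite !expZmx !derZmx dAk scaler0 addr0 der_factV scale0r add0r derX.
rewrite expmxS -!scalemxAl -!scalemxAr !scalerA; congr (_ *: _).
rewrite factS natrM invrM ?natU ?fact_unit // -!mulrA mulKr ?natU //.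
by rewrite mulrA mulrC.
Qed.

End Exponential.

Lemma map_mexp (R S : comUnitRingType) (phi : {rmorphism R -> S}) n (A : 'M[R]_n) :
  (forall k, (k.+1%:R : R) \is a GRing.unit) ->
  map_mx phi (mexp A) = mexp (map_mx phi A).
Proof.
move=> natU; have mX k : map_mx phi (A ^+ k) = (map_mx phi A) ^+ k.
  elim: k => [|k ih]; first by rewrite !expr0 [LHS]map_mx1.
  by rewrite !expmxS map_mxM ih.
rewrite /mexp; apply/matrixP=> i j; rewrite mxE !summxE rmorph_sum; apply: eq_bigr => k _.
by rewrite !mxE rmorphM rmorphV ?fact_unit // rmorph_nat -mX mxE.
Qed.

(** * Linear spans of matrices over a ring *)

(** Inductive, so that linear maps are followed generator by generator, over a field and over a
    polynomial ring alike. *)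
Inductive lspan (R : comUnitRingType) n (S : 'M[R]_n -> Prop) : 'M[R]_n -> Prop :=
| lspan0 : lspan S 0
| lspan_addZ x Y Z : S Y -> lspan S Z -> lspan S (x *: Y + Z).

Section Span.
Variables (R : comUnitRingType) (n : nat).
Implicit Types (S T : 'M[R]_n -> Prop) (A Y Z : 'M[R]_n).

Lemma lspan_in S Y : S Y -> lspan S Y.
Proof. by move=> h; rewrite -[Y]scale1r -[_ *: _]addr0; apply: lspan_addZ => //; apply: lspan0. Qed.

Lemma lspanD S Y Z : lspan S Y -> lspan S Z -> lspan S (Y + Z).
Proof.
move=> + hZ; elim=> [|x A B hA _ ih]; first by rewrite add0r.
by rewrite -addrA; apply: lspan_addZ.
Qed.

Lemma lspanZ S x Y : lspan S Y -> lspan S (x *: Y).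
Proof.
elim=> [|y A B hA _ ih]; first by rewrite scaler0; apply: lspan0.
by rewrite scalerDr scalerA; apply: lspan_addZ.
Qed.

Lemma lspanN S Y : lspan S Y -> lspan S (- Y).
Proof. by rewrite -scaleN1r; apply: lspanZ. Qed.

Lemma lspan_sum S I r (P : pred I) F :
  (forall i, P i -> lspan S (F i)) -> lspan S (\sum_(i <- r | P i) F i).
Proof. by move=> h; elim/big_ind: _ => //; [apply: lspan0|apply: lspanD]. Qed.

Lemma lspan_linear S (P : 'M[R]_n -> Prop) (f : 'M[R]_n -> 'M[R]_n) :
  P 0 -> (forall x Y Z, P Y -> P Z -> P (x *: Y + Z)) ->
  (forall x Y Z, f (x *: Y + Z) = x *: f Y + f Z) ->
  (forall Y, S Y -> P (f Y)) -> forall Y, lspan S Y -> P (f Y).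
Proof.
move=> P0 PD fl h Y; elim=> [|x A B hA _ ih]; last by rewrite fl; apply: PD => //; apply: h.
by have := fl (- 1) 0 0; rewrite scaleN1r oppr0 addr0 scaleN1r addNr => ->.
Qed.

Lemma lspan_trans S T Y : (forall Z, S Z -> lspan T Z) -> lspan S Y -> lspan T Y.
Proof.
move=> h; apply: (@lspan_linear S (lspan T) id) => //; first exact: lspan0.
by move=> x A B hA hB; apply: lspanD => //; apply: lspanZ.
Qed.

Lemma lspan_sub S T Y : (forall Z, S Z -> T Z) -> lspan S Y -> lspan T Y.
Proof. by move=> h; apply: lspan_trans => Z /h; apply: lspan_in. Qed.

Lemma lspan_conj S T g h Y : (forall Z, S Z -> lspan T (g *m Z *m h)) ->
  lspan S Y -> lspan T (g *m Y *m h).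
Proof.
move=> H; apply: (@lspan_linear S (lspan T) (fun Y => g *m Y *m h)) => //; first exact: lspan0.
  by move=> x A B hA hB; apply: lspanD => //; apply: lspanZ.
by move=> x A B; rewrite mulmxDr mulmxDl -scalemxAr -scalemxAl.
Qed.

Lemma lieZl x A B : lie (x *: A) B = x *: lie A B.
Proof. by rewrite /lie -scalemxAl -scalemxAr scalerBr. Qed.

Lemma lieZr x A B : lie A (x *: B) = x *: lie A B.
Proof. by rewrite /lie -scalemxAl -scalemxAr scalerBr. Qed.

Lemma lieDr A B Z : lie A (B + Z) = lie A B + lie A Z.
Proof. by rewrite /lie mulmxDl mulmxDr opprD addrACA. Qed.

Lemma lieDl A B Z : lie (A + B) Z = lie A Z + lie B Z.
Proof. by rewrite /lie mulmxDl mulmxDr opprD addrACA. Qed.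

Lemma lieC A B : lie A B = - lie B A.
Proof. by rewrite /lie opprB. Qed.

Lemma liexx A : lie A A = 0.
Proof. by rewrite /lie subrr. Qed.

Lemma lieNr A B : lie A (- B) = - lie A B.
Proof. by rewrite -scaleN1r lieZr scaleN1r. Qed.

Lemma lieNl A B : lie (- A) B = - lie A B.
Proof. by rewrite -scaleN1r lieZl scaleN1r. Qed.

Lemma lie_suml I r (P : pred I) (F : I -> 'M[R]_n) B : lie (\sum_(i <- r | P i) F i) B = \sum_(i <- r | P i) lie (F i) B.
Proof. by rewrite /lie mulmx_suml mulmx_sumr -sumrB. Qed.

Lemma lspan_lie S T A Y : (forall Z, S Z -> lspan T (lie A Z)) ->
  lspan S Y -> lspan T (lie A Y).
Proof.
move=> H; apply: (@lspan_linear S (lspan T) (lie A)) => //; first exact: lspan0.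
  by move=> x B C hB hC; apply: lspanD => //; apply: lspanZ.
by move=> x B C; rewrite lieDr lieZr.
Qed.

Hypothesis natU : forall k, (k.+1%:R : R) \is a GRing.unit.

Lemma lspan_iter_lie S A Y k : (forall Z, S Z -> lspan S (lie A Z)) ->
  lspan S Y -> lspan S (iter k (lie A) Y).
Proof. by move=> h hY; elim: k => //= k ih; apply: lspan_lie ih. Qed.

Lemma mexp_conj_span S A Y : A ^+ n = 0 -> (forall Z, S Z -> lspan S (lie A Z)) ->
  lspan S Y -> lspan S (mexp A *m Y *m mexp (- A)).
Proof.
move=> nil h hY; rewrite (mexp_conj natU _ nil (leqnn _)).
by apply: lspan_sum => k _; apply: lspanZ; apply: lspan_iter_lie.
Qed.

(** For [Y] outside the span, such as a Cartan element, only the difference is controlled: it drops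
    the leading term of $\exp(\mathrm{ad}\,A)Y$. *)
Lemma mexp_conj_sub S A Y : A ^+ n = 0 -> (forall Z, S Z -> lspan S (lie A Z)) ->
  lspan S (lie A Y) -> lspan S (mexp A *m Y *m mexp (- A) - Y).
Proof.
move=> nil h hY; rewrite (mexp_conj natU _ nil (leqnSn _)) big_nat_recl // fact0 invr1 scale1r.
rewrite addrC addKr; apply: lspan_sum => k _; apply: lspanZ.
by rewrite iterSr; apply: lspan_iter_lie.
Qed.

End Span.

Lemma map_lie (R S : comUnitRingType) (phi : {rmorphism R -> S}) n (A B : 'M[R]_n) :
  map_mx phi (lie A B) = lie (map_mx phi A) (map_mx phi B).
Proof. by rewrite /lie map_mxB !map_mxM. Qed.

Lemma map_lspan (R S : comUnitRingType) (phi : {rmorphism R -> S}) n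
  (P : 'M[R]_n -> Prop) (Q : 'M[S]_n -> Prop) Y :
  (forall Z, P Z -> Q (map_mx phi Z)) -> lspan P Y -> lspan Q (map_mx phi Y).
Proof.
move=> h; elim=> [|x A B hA _ ih]; first by rewrite map_mx0; apply: lspan0.
by rewrite map_mxD map_mxZ; apply: lspan_addZ => //; apply: h.
Qed.

Lemma map_mexpZ (R S : comUnitRingType) (phi : {rmorphism R -> S}) n x (A : 'M[R]_n) :
  (forall k, (k.+1%:R : R) \is a GRing.unit) ->
  map_mx phi (mexp (x *: A)) = mexp (phi x *: map_mx phi A).
Proof. by move=> natU; rewrite map_mexp // map_mxZ. Qed.

(** * Products of root elements in a prescribed order *)

Section Ordering.
Variables (K : fieldType) (n : nat) (T : eqType) (X : T -> 'M[K]_n).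
Hypothesis natK : forall k, k.+1%:R != 0 :> K.
Implicit Types (L : seq T) (a b : T) (ws : seq (T * K)).

Let natU k : (k.+1%:R : K) \is a GRing.unit. Proof. by rewrite unitfE. Qed.

Definition gens L (Y : 'M[K]_n) := exists2 a, a \in L & Y = X a.

(** The span of each tail is an ideal in the span with the preceding letter added. These spans form
    the filtration along which products are reordered. *)
Fixpoint chain L : Prop :=
  if L is a :: L' then (forall b, b \in L' -> lspan (gens L') (lie (X a) (X b))) /\ chain L'
  else True.

Lemma gens_cons a L Y : gens L Y -> gens (a :: L) Y.
Proof. by case=> b bL ->; exists b; rewrite // inE bL orbT. Qed.

Lemma chain_lie L a b : chain L -> a \in L -> b \in L ->
  lspan (gens L) (lie (X a) (X b)).
Proof.
elim: L a b => //= c L ih a b [hc hL].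
rewrite !inE => /predU1P [->|aL] /predU1P [->|bL].
- by rewrite liexx; apply: lspan0.
- by apply: lspan_sub (hc _ bL) => Y; apply: gens_cons.
- rewrite lieC; apply: lspanN; apply: lspan_sub (hc _ aL) => Y; exact: gens_cons.
- by apply: lspan_sub (ih _ _ hL aL bL) => Y; apply: gens_cons.
Qed.

Definition word ws : 'M[K]_n := \prod_(w <- ws) mexp (w.2 *: X w.1).

Lemma word_nil : word [::] = 1%:M. Proof. by rewrite /word big_nil. Qed.
Lemma word_cons a x ws : word ((a, x) :: ws) = mexp (x *: X a) *m word ws.
Proof. by rewrite /word big_cons. Qed.
Lemma word_cat ws1 ws2 : word (ws1 ++ ws2) = word ws1 *m word ws2.
Proof. by rewrite /word big_cat. Qed.

Definition letters_in L ws := all (fun w => w.1 \in L) ws.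

Definition word_inv ws : seq (T * K) := rev [seq (w.1, - w.2) | w <- ws].

Lemma letters_word_inv L ws : letters_in L (word_inv ws) = letters_in L ws.
Proof. by rewrite /letters_in all_rev all_map. Qed.

Lemma word_invK ws : word_inv (word_inv ws) = ws.
Proof.
rewrite /word_inv map_rev revK -map_comp -[RHS]map_id; apply: eq_map => -[a x] /=.
by rewrite opprK.
Qed.

Variable L0 : seq T.
Hypothesis nilX : forall a, a \in L0 -> X a ^+ n = 0.

Lemma wordV ws : letters_in L0 ws -> word ws *m word (word_inv ws) = 1%:M.
Proof.
elim: ws => [|[a x] ws ih] /=; first by rewrite word_nil mulmx1.
move=> /andP [aL wL]; rewrite word_cons /word_inv /= rev_cons -cats1 word_cat.
rewrite mulmxA -(mulmxA (mexp _)) ih // mulmx1 word_cons word_nil mulmx1.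
by rewrite mexpNK // nilX.
Qed.

Lemma word_conj_sub L Y ws : {subset L <= L0} -> letters_in L ws -> chain L ->
  (forall a, a \in L -> lspan (gens L) (lie (X a) Y)) ->
  lspan (gens L) (word ws *m Y *m word (word_inv ws) - Y).
Proof.
move=> LL + hL hY; elim: ws => [|[a x] ws ih] /=.
  by rewrite word_nil mul1mx mulmx1 subrr => _; apply: lspan0.
move=> /andP [aL wL]; rewrite word_cons /word_inv /= rev_cons -cats1 word_cat word_cons word_nil mulmx1.
have nil : (x *: X a) ^+ n = 0 by rewrite expmx_scale0 // nilX ?LL.
have cl Z : gens L Z -> lspan (gens L) (lie (x *: X a) Z).
  by case=> b bL ->; rewrite lieZl; apply: lspanZ; apply: chain_lie.
set P := word ws; set Q := word _.
have -> : mexp (x *: X a) *m P *m Y *m (Q *m mexp (- x *: X a)) - Y =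
  mexp (x *: X a) *m (P *m Y *m Q - Y) *m mexp (- (x *: X a)) +
  (mexp (x *: X a) *m Y *m mexp (- (x *: X a)) - Y).
  by rewrite mulmxBr mulmxBl !mulmxA scaleNr addrA subrK.
apply: lspanD; first by apply: mexp_conj_span => //; apply: ih.
by apply: mexp_conj_sub => //; rewrite lieZl; apply: lspanZ; apply: hY.
Qed.

(* The word is [u' u^-1] with [u = prod_(rev L) exp (x a X a)] and [u'] likewise.
   If [a] heads [L], the [X a]-coordinate of [Ad (u' u^-1) (H i)] is
   [- wt i a * (x' a - x a)], since the other factors only contribute to the span
   of the tail; then [x' a = x a] and both factors at [a] cancel. *)
Lemma word_quotient_inj (I : Type) (H : I -> 'M[K]_n) (wt : I -> T -> K)
    (co : T -> 'M[K]_n -> K) L (x x' : T -> K) :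
  (forall a y A B, co a (y *: A + B) = y * co a A + co a B) ->
  {subset L <= L0} -> uniq L -> chain L ->
  (forall i a, a \in L -> lie (H i) (X a) = wt i a *: X a) ->
  (forall a, a \in L -> exists i, wt i a != 0) ->
  (forall a b, a \in L -> b \in L -> (co a (X b) != 0) = (a == b)) ->
  (forall i a, a \in L -> co a (H i) = 0) ->
  let ws := [seq (a, x' a) | a <- rev L] ++ [seq (a, - x a) | a <- L] in
  (forall i a, a \in L ->
     co a (word ws *m H i *m word (word_inv ws)) = 0) ->
  forall a, a \in L -> x' a = x a.
Proof.
move=> col; have co0 a : co a 0 = 0.
  by have := col a (- 1) 0 0; rewrite scaler0 add0r mulN1r addNr.
have coZ a y A : co a (y *: A) = y * co a A by rewrite -[_ *: _]addr0 col co0 addr0.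
have coB a A B : co a (A - B) = co a A - co a B.
  by rewrite addrC -scaleN1r col mulN1r addrC.
elim: L => //= a L ih LL /andP [aL uL] [ha hL] Hwt Hnz Hpos HH.
have LL' : {subset L <= L0} by move=> b bL; apply: LL; rewrite inE bL orbT.
set ws := (X in word X); move=> hw.
pose W1 := [seq (b, x' b) | b <- rev L]; pose W2 := [seq (b, - x b) | b <- L].
have lW1 : letters_in L W1.
  by apply/allP=> w /mapP [b]; rewrite mem_rev => bL ->.
have lW2 : letters_in L W2 by apply/allP=> w /mapP [b bL ->].
have sub W : letters_in L W -> letters_in L0 W.
  by move/allP=> h; apply/allP=> w /h; apply: LL'.
have nila : X a ^+ n = 0 by apply: nilX; apply: LL; rewrite inE eqxx.
pose d := x' a - x a.
(* The two factors at [a] are adjacent in the middle of the word and merge into one with the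
   difference [d]. *)
have ews : word ws = word W1 *m mexp (d *: X a) *m word W2.
  rewrite /ws rev_cons map_rcons -cats1 -catA !word_cat /= !word_cons word_nil mulmx1.
  by rewrite mexpD // !mulmxA.
have ews' : word (word_inv ws) = word (word_inv W2) *m mexp (- (d *: X a)) *m word (word_inv W1).
  rewrite /ws rev_cons map_rcons -cats1 -catA /word_inv !map_cat !rev_cat !word_cat /=.
  rewrite rev_cons -cats1 !word_cat !word_cons word_nil !mulmx1 opprK.
  rewrite -scaleNr opprB mexpD // !mulmxA; congr (_ *m _).
have d0 : d = 0.
  have [i wi] := Hnz a (mem_head _ _).
  have ain : a \in a :: L by rewrite inE eqxx.
  have Hin b : b \in L -> b \in a :: L by rewrite inE orbC => ->.
  have e : word ws *m H i *m word (word_inv ws) - (H i - (d * wt i a) *: X a) =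
    word W1 *m (mexp (d *: X a) *m (word W2 *m H i *m word (word_inv W2) - H i) *m mexp (- (d *: X a)))
      *m word (word_inv W1) +
    (word W1 *m (H i - (d * wt i a) *: X a) *m word (word_inv W1) - (H i - (d * wt i a) *: X a)).
    rewrite addrA ews ews'; congr (_ - _).
    have -> : H i - (d * wt i a) *: X a = mexp (d *: X a) *m H i *m mexp (- (d *: X a)).
      rewrite mexp_conj_lie2 ?expmx_scale0 //; last first.
        by rewrite !lieZl [lie (X a) (H i)]lieC Hwt // !(lieZr, lieNr) liexx !(scaler0, oppr0).
      by rewrite lieZl lieC Hwt // scalerN scalerA.
    rewrite mulmxBr mulmxBl mulmxBr mulmxBl !mulmxA subrK.
    by rewrite -!mulmxA.
  have : lspan (gens L) (word ws *m H i *m word (word_inv ws) - (H i - (d * wt i a) *: X a)).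
    have liH b : b \in L -> lspan (gens L) (lie (X b) (H i)).
      move=> bL; rewrite lieC Hwt ?Hin //; apply: lspanN; apply: lspanZ; apply: lspan_in.
      by exists b.
    rewrite e; apply: lspanD.
      apply: (@lspan_conj _ _ (gens L)) => [Z hZ|].
        have h := word_conj_sub (Y := Z) LL' lW1 hL.
        rewrite -[X in lspan _ X](subrK Z); apply: lspanD; last exact: lspan_in.
        by apply: h => b bL; case: hZ => c cL ->; apply: chain_lie.
      apply: mexp_conj_span => //; first exact: expmx_scale0.
        by move=> Z [b bL ->]; rewrite lieZl; apply: lspanZ; apply: ha.
      by apply: word_conj_sub.
    apply: word_conj_sub => // b bL; rewrite lieDr; apply: lspanD; first exact: liH.
    rewrite lieNr lieZr; apply: lspanN; apply: lspanZ; rewrite lieC; apply: lspanN; exact: ha.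
  move=> h; have z Y : lspan (gens L) Y -> co a Y = 0.
    elim=> [|y A B [b bL ->] _ ihB]; first exact: co0.
    rewrite col ihB addr0; have := Hpos a b ain (Hin _ bL).
    have -> : (a == b) = false by apply: contraNF aL => /eqP ->.
    by move/negbFE/eqP ->; rewrite mulr0.
  have := z _ h; rewrite !coB hw // HH // !sub0r opprK coZ => /eqP.
  rewrite !mulf_eq0 (negPf wi) orbF.
  have := Hpos a a ain ain; rewrite eqxx; case: eqP => //= _ _; rewrite orbF => /eqP //.
have e1 : word ws = word (W1 ++ W2).
  by rewrite ews d0 scale0r mexp0 mulmx1 word_cat.
have e2 : word (word_inv ws) = word (word_inv (W1 ++ W2)).
  by rewrite ews' d0 scale0r oppr0 mexp0 mulmx1 /word_inv map_cat rev_cat word_cat.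
move=> b; rewrite inE => /predU1P [->|bL]; first by apply/eqP; rewrite -subr_eq0 -/d d0.
apply: ih => // [i c cL|c cL|c c' cL c'L|i c cL|i c cL].
- by apply: Hwt; rewrite inE cL orbT.
- by apply: Hnz; rewrite inE cL orbT.
- by apply: Hpos; rewrite inE ?cL ?c'L orbT.
- by apply: HH; rewrite inE cL orbT.
by rewrite -e1 -e2; apply: hw; rewrite inE cL orbT.
Qed.

Lemma poly_primitive (y : {poly K}) : exists2 q : {poly K}, q^`() = y & q.[0] = 0.
Proof.
exists (\poly_(i < (size y).+1) (y`_i.-1 / i%:R)); last first.
  by rewrite horner_coef0 coef_poly /= invr0 mulr0.
apply/polyP=> i; rewrite coef_deriv coef_poly ltnS /=.
case: ltnP => h; last by rewrite mul0rn nth_default.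
by rewrite -[LHS]mulr_natr divfK.
Qed.

Lemma deriv_eq0_const (q : {poly K}) : q^`() = 0 -> q = (q.[0])%:P.
Proof.
move=> h; apply/polyP=> -[|i]; rewrite coefC /=; first by rewrite horner_coef0.
move/polyP/(_ i)/eqP: h; rewrite coef_deriv coef0 -[q`_i.+1 *+ _]mulr_natr mulf_eq0 (negPf (natK i)) orbF.
by move/eqP.
Qed.

Let natP k : (k.+1%:R : {poly K}) \is a GRing.unit.
Proof. by rewrite -(rmorph_nat (@polyC K)) rmorph_unit. Qed.

Let XP a : 'M[{poly K}]_n := map_mx polyC (X a).

Let gensP L (Y : 'M[{poly K}]_n) := exists2 a, a \in L & Y = XP a.

Let dXP a : map_mx deriv (XP a) = 0.
Proof. by apply/matrixP=> i j; rewrite !mxE derivC. Qed.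

Let nilXP a : a \in L0 -> XP a ^+ n = 0.
Proof.
move=> aL; have mX k : XP a ^+ k = map_mx polyC (X a ^+ k).
  elim: k => [|k ih]; first by rewrite !expr0 [RHS]map_mx1.
  by rewrite !expmxS ih map_mxM.
by rewrite mX nilX // map_mx0.
Qed.

Let derivDM (x y : {poly K}) : (x * y)^`() = x^`() * y + x * y^`().
Proof. exact: derivM. Qed.

(* If [g' = Z g] with [Z] in the span of [L], the coefficient of the first
   root of [L] in [Z] is integrated and split off; the rest stays in the span
   of the tail because the first root normalises it. *)
Lemma ordered_factorization L (g Z : 'M[{poly K}]_n) :
  {subset L <= L0} -> uniq L -> chain L ->
  map_mx (horner_eval 0) g = 1%:M -> lspan (gensP L) Z ->
  map_mx deriv g = Z *m g ->
  exists x : T -> {poly K}, g = \prod_(a <- L) mexp (x a *: XP a).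
Proof.
elim: L g Z => [|a L ih] g Z LL.
  move=> _ _ g0 hZ dg; exists (fun _ => 0); rewrite big_nil.
  have Z0 : Z = 0 by case: hZ => // x Y W [b].
  apply/matrixP=> i j; move/matrixP/(_ i j): dg; rewrite Z0 mul0mx !mxE => /deriv_eq0_const ->.
  move/matrixP/(_ i j): g0; rewrite !mxE /horner_eval => ->.
  by case: eqP => _; rewrite ?mulr1n ?mulr0n.
move=> /andP [aL uL] [ha hL] g0 hZ dg.
have LL' : {subset L <= L0} by move=> b bL; apply: LL; rewrite inE bL orbT.
have nila : XP a ^+ n = 0 by apply: nilXP; apply: LL; rewrite inE eqxx.
have [y [Z' eZ hZ']] : exists y, exists2 Z', Z = y *: XP a + Z' & lspan (gensP L) Z'.
  elim: hZ => [|x Y W [b +] -> _ [y [W' -> hW']]].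
    by exists 0, 0; rewrite ?scale0r ?addr0 //; apply: lspan0.
  rewrite inE => /predU1P [->|bL].
    by exists (x + y), W'; rewrite // scalerDl addrA.
  exists y, (x *: XP b + W'); first by rewrite addrCA.
  by apply: lspan_addZ => //; exists b.
have [q dq q0] := poly_primitive y.
pose E := mexp (q *: XP a); pose E' := mexp (- q *: XP a).
have EE' : E *m E' = 1%:M by rewrite /E /E' mexpNK.
have E'E : E' *m E = 1%:M by rewrite /E /E' mexpKN.
pose h := E' *m g.
have [|||x ex] := ih h (E' *m Z' *m E) LL' uL hL.
- rewrite /h map_mxM g0 mulmx1 /E' map_mexpZ //= /horner_eval hornerN q0 oppr0 scale0r.
  exact: mexp0.
- rewrite /E /E'; have -> : mexp (q *: XP a) = mexp (- (- q *: XP a)) by rewrite scaleNr opprK.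
  apply: mexp_conj_span => //; first exact: expmx_scale0.
  move=> W [b bL ->]; rewrite lieZl; apply: lspanZ; rewrite /XP -map_lie.
  by apply: map_lspan (ha b bL) => Y [c cL ->]; exists c.
- rewrite /h (derMmx (D := deriv)) //; last exact: derivD.
  rewrite dg eZ /E' der_mexp //; last exact: derivD.
  have c : E' *m (y *: XP a) = (y *: XP a) *m E'.
    rewrite -[LHS]mulmx1 -EE' !mulmxA.
    suff -> : E' *m (y *: XP a) *m E = y *: XP a by [].
    have := mexp_conj_lie1 natP (A := - q *: XP a) (Y := y *: XP a).
    rewrite -scaleNr opprK; apply; first exact: expmx_scale0.
    by rewrite lieZl lieZr liexx !scaler0.
  rewrite -/E' derivN dq; clearbody E E'.
  rewrite scaleNr !mulNmx mulmxDl mulmxDr !mulmxA c addKr.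
  by rewrite -(mulmxA _ E E') EE' mulmx1.
exists (fun b => if b == a then q else x b); rewrite big_cons eqxx.
rewrite -[g]mul1mx -EE' -mulmxA -/h ex; congr (_ *m _).
apply: eq_big_seq => b bL; case: eqP => // e; move: aL; rewrite -e bL.
by [].
Qed.

(** Scaling every parameter by an indeterminate gives a curve that is the identity at 0 and the
    given word at 1. Its logarithmic derivative lies in the span of [L], so the factorisation along
    the chain applies and is evaluated at 1. *)
Lemma word_ordered L ws : {subset L <= L0} -> uniq L -> chain L -> letters_in L ws ->
  exists x : T -> K, word ws = word [seq (a, x a) | a <- L].
Proof.
move=> LL uL hL wL.
pose G := \prod_(w <- ws) mexp ((w.2%:P * 'X) *: XP w.1).
suff [x ex] : exists x : T -> {poly K}, G = \prod_(a <- L) mexp (x a *: XP a).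
  exists (fun a => (x a).[1]).
  have ev (I : Type) (r : seq I) (F : I -> {poly K}) (f : I -> T) :
    map_mx (horner_eval 1) (\prod_(i <- r) mexp (F i *: XP (f i))) =
    \prod_(i <- r) mexp ((F i).[1] *: X (f i)).
    elim: r => [|i r ih]; first by rewrite !big_nil [LHS]map_mx1.
    rewrite !big_cons [LHS]map_mxM ih; congr (_ *m _).
    rewrite map_mexpZ //; congr (mexp (_ *: _)).
    by apply/matrixP=> p q; rewrite !mxE /= /horner_eval hornerC.
  move/(congr1 (map_mx (horner_eval 1))): ex; rewrite !ev /word big_map.
  by move=> <-; apply: eq_bigr => w _; rewrite hornerM hornerC hornerX mulr1.
suff [Z [hZ dG G0]] : exists Z, [/\ lspan (gensP L) Z, map_mx deriv G = Z *m G
    & map_mx (horner_eval 0) G = 1%:M].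
  exact: (ordered_factorization LL uL hL G0 hZ dG).
rewrite {}/G; elim: ws wL => [|[a x] ws ih] /=.
  exists 0; rewrite big_nil mul0mx; split; first exact: lspan0.
    by apply: der1mx; [exact: derivD|exact: derivDM].
  exact: map_mx1.
move=> /andP [aL /ih [Z [hZ dG G0]]]; rewrite big_cons /=.
have nila : XP a ^+ n = 0 by apply: nilXP; apply: LL.
set q := x%:P * 'X; set P := \prod_(w <- ws) _ in dG G0 *.
exists (x%:P *: XP a + mexp (q *: XP a) *m Z *m mexp (- (q *: XP a))); split.
- apply: lspanD; first by apply: lspanZ; apply: lspan_in; exists a.
  apply: mexp_conj_span => //; first exact: expmx_scale0.
  move=> W [b bL ->]; rewrite lieZl; apply: lspanZ; rewrite /XP -map_lie.
  by apply: map_lspan (chain_lie hL aL bL) => Y [c cL ->]; exists c.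
- rewrite [LHS](derMmx (D := deriv)) //; last exact: derivD.
  rewrite dG der_mexp //; last exact: derivD.
  have -> : q^`() = x%:P by rewrite /q derivM derivC derivX mul0r add0r mulr1.
  rewrite -[mexp _ * P]/(mexp _ *m P) mulmxDl; congr (_ + _); first by rewrite mulmxA.
  by rewrite -!mulmxA -scaleNr (mulmxA (mexp (- q *: _))) mexpKN // mul1mx.
- rewrite [LHS]map_mxM G0 map_mexpZ //= /horner_eval /q hornerM hornerX mulr0 scale0r mexp0.
  exact: mulmx1.
Qed.

End Ordering.

(** * Conjugation *)

Section Conjugation.
Variables (K : comUnitRingType) (n : nat).
Implicit Types (g h A B Y Z : 'M[K]_n).

Definition Ad g Y := g *m Y *m invmx g.

Lemma unit_invmx_eq g h : g *m h = 1%:M -> g \in unitmx /\ invmx g = h.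
Proof.
move=> e; have gu : g \in unitmx by case/mulmx1_unit: e.
by split=> //; rewrite -[h](mulKmx gu) e mulmx1.
Qed.

Lemma invmxM g h : g \in unitmx -> h \in unitmx -> invmx (g *m h) = invmx h *m invmx g.
Proof.
move=> gu hu; have [] // := @unit_invmx_eq (g *m h) (invmx h *m invmx g) _.
by rewrite mulmxA -(mulmxA g) mulmxV // mulmx1 mulmxV.
Qed.

Lemma AdM g h Y : g \in unitmx -> h \in unitmx -> Ad (g *m h) Y = Ad g (Ad h Y).
Proof. by move=> gu hu; rewrite /Ad invmxM // !mulmxA. Qed.

Lemma Ad1 Y : Ad 1%:M Y = Y.
Proof. by rewrite /Ad invmx1 mul1mx mulmx1. Qed.

Lemma AdK g Y : g \in unitmx -> Ad (invmx g) (Ad g Y) = Y.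
Proof. by move=> gu; rewrite -AdM ?unitmx_inv // mulVmx // Ad1. Qed.

Lemma AdVK g Y : g \in unitmx -> Ad g (Ad (invmx g) Y) = Y.
Proof. by move=> gu; rewrite -AdM ?unitmx_inv // mulmxV // Ad1. Qed.

Lemma AdD g Y Z : Ad g (Y + Z) = Ad g Y + Ad g Z.
Proof. by rewrite /Ad mulmxDr mulmxDl. Qed.

Lemma AdZ g x Y : Ad g (x *: Y) = x *: Ad g Y.
Proof. by rewrite /Ad -scalemxAr -scalemxAl. Qed.

Lemma AdN g Y : Ad g (- Y) = - Ad g Y.
Proof. by rewrite -scaleN1r AdZ scaleN1r. Qed.

Lemma AdB g Y Z : Ad g (Y - Z) = Ad g Y - Ad g Z.
Proof. by rewrite AdD AdN. Qed.

Lemma Ad_mul g Y Z : g \in unitmx -> Ad g (Y *m Z) = Ad g Y *m Ad g Z.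
Proof. by move=> gu; rewrite /Ad !mulmxA mulmxKV. Qed.

Lemma Ad_lie g Y Z : g \in unitmx -> Ad g (lie Y Z) = lie (Ad g Y) (Ad g Z).
Proof. by move=> gu; rewrite /lie AdB !Ad_mul. Qed.

Lemma Ad_conj A B Z : A \in unitmx -> B \in unitmx ->
  Ad B Z = Ad A (Ad (Ad (invmx A) B) (Ad (invmx A) Z)).
Proof.
move=> Au Bu; have -> : Ad (invmx A) B = invmx A *m B *m A by rewrite /Ad invmxK.
by rewrite !AdM ?unitmx_mul ?unitmx_inv ?Au // !AdVK.
Qed.

Lemma Ad_mexp g A : g \in unitmx -> Ad g (mexp A) = mexp (Ad g A).
Proof.
move=> gu; have AdX k : Ad g (A ^+ k) = Ad g A ^+ k.
  elim: k => [|k ih]; first by rewrite !expr0 /Ad mulmx1 mulmxV.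
  by rewrite !expmxS Ad_mul // ih.
rewrite /mexp /Ad mulmx_sumr mulmx_suml; apply: eq_bigr => k _.
by rewrite -AdX -AdZ.
Qed.

Lemma mulmx_Ad g Y : g \in unitmx -> g *m Y = Ad g Y *m g.
Proof. by move=> gu; rewrite /Ad mulmxKV. Qed.

Lemma lspan_Ad (S T : 'M[K]_n -> Prop) g Y :
  (forall Z, S Z -> lspan T (Ad g Z)) -> lspan S Y -> lspan T (Ad g Y).
Proof. exact: lspan_conj. Qed.

End Conjugation.

Lemma map_Ad (K L : fieldType) (phi : {rmorphism K -> L}) n (g Y : 'M[K]_n) :
  map_mx phi (Ad g Y) = Ad (map_mx phi g) (map_mx phi Y).
Proof. by rewrite /Ad !map_mxM map_invmx. Qed.

(** * Chevalley bases over a field of characteristic zero *)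

(** The consequences of [chevalley_basis] that are used over both $C$ and $\mathcal E$, stated so
    that a field embedding carries them over entry by entry. Linear independence enters through
    nonzero root vectors of distinct weights. *)
Record chevalley (K : fieldType) (l n : nat) (R : root_system l)
    (H : 'I_l -> 'M[K]_n) (X : 'cV[int]_l -> 'M[K]_n) : Prop := Chevalley {
  chev_diag : forall i, is_diag_mx (H i);
  chev_H : forall i a, a \in roots R ->
    lie (H i) (X a) = (pairing a (coroot R (simple i)))%:~R *: X a;
  chev_opp : forall a, a \in roots R -> exists2 c : 'I_l -> int,
    coroot R a = \sum_i c i *: coroot R (simple i)
    & lie (X a) (X (- a)) = \sum_i (c i)%:~R *: H i;
  chev_sum : forall a b, a \in roots R -> b \in roots R -> a + b \in roots R ->
    exists N, lie (X a) (X b) = N *: X (a + b);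
  chev_zero : forall a b, a \in roots R -> b \in roots R ->
    a + b != 0 -> a + b \notin roots R -> lie (X a) (X b) = 0;
  chev_neq0 : forall a, a \in roots R -> X a != 0 }.

Section Chevalley.
Variables (K : fieldType) (l n : nat) (R : root_system l).
Variables (H : 'I_l -> 'M[K]_n) (X : 'cV[int]_l -> 'M[K]_n).
Hypotheses (chX : chevalley R H X) (natK : forall k, k.+1%:R != 0 :> K).
Implicit Types (a b : 'cV[int]_l) (S : pred 'cV[int]_l) (Y Z g : 'M[K]_n) (x : K).

Let natU k : (k.+1%:R : K) \is a GRing.unit. Proof. by rewrite unitfE. Qed.

Lemma intr_eq0_char0 (m : int) : (m%:~R == 0 :> K) = (m == 0).
Proof.
case: m => [[|m]|m]; first by rewrite eqxx.
  by rewrite -pmulrn (negPf (natK m)).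
by rewrite NegzE rmorphN /= oppr_eq0 -pmulrn (negPf (natK m)).
Qed.

Lemma intr_inj_char0 : injective (intr : int -> K).
Proof.
move=> p q e; apply/eqP; rewrite -subr_eq0 -intr_eq0_char0 rmorphB /=.
by rewrite e subrr.
Qed.

Definition wt k a : K := (pairing a (coroot R (simple k)))%:~R.

Lemma wt_eq a b : (forall k, wt k a = wt k b) -> a = b.
Proof. by move=> h; apply: (eq_root_pairing (R := R)) => k; apply: intr_inj_char0; apply: h. Qed.

Lemma wt_neq a b : a != b -> exists k, wt k a != wt k b.
Proof.
move=> ab; apply/existsP; apply: contraNT ab => /existsPn h.
by apply/eqP/wt_eq => k; apply/eqP; move: (h k); rewrite negbK.
Qed.

Lemma wtN k a : wt k (- a) = - wt k a.
Proof. by rewrite /wt pairingN rmorphN. Qed.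

Lemma wt_neq0 a : a \in roots R -> exists k, wt k a != 0.
Proof.
move=> ra; have [k] := @wt_neq a 0 (root_neq0 ra); exists k; move: p => //=.
by rewrite [wt k 0]/wt -[0 : 'cV_l](scale0r 0) pairingZ mul0r.
Qed.

Lemma diag_entry Y p q : is_diag_mx Y -> p != q -> Y p q = 0.
Proof. by move=> /is_diag_mxP h pq; apply: h. Qed.

Lemma lie_diag Y Z p q : is_diag_mx Y -> lie Y Z p q = (Y p p - Y q q) * Z p q.
Proof.
move=> /is_diag_mxP dY.
transitivity ((Y *m Z) p q - (Z *m Y) p q); first by rewrite !mxE.
have -> : (Y *m Z) p q = Y p p * Z p q.
  by rewrite mxE (bigD1 p) //= big1 ?addr0 // => k kp; rewrite dY ?mul0r // eq_sym.
have -> : (Z *m Y) p q = Y q q * Z p q.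
  by rewrite mxE (bigD1 q) //= big1 ?addr0 1?mulrC // => k kq; rewrite dY ?mulr0.
by rewrite mulrBl.
Qed.

(** Bracketing with the diagonal $H_k$ multiplies an entry by a number depending only on its
    position, so a nonzero entry of $X_a$ reveals the weight of $a$. *)
Lemma X_entry k a p q : a \in roots R -> X a p q != 0 -> H k p p - H k q q = wt k a.
Proof.
move=> ra nz; apply: (mulIf nz); rewrite -lie_diag ?(chev_diag chX) //.
by rewrite (chev_H chX) // mxE.
Qed.

(** The coordinate along $X_a$ up to a nonzero scalar, read at a position where $X_a$ does not
    vanish. Diagonal matrices and the other root vectors vanish there, and the functional is defined
    on all matrices. The default 0 belongs to the case $X_a=0$. *)
Definition rcoord a Y : K :=
  if [pick p : 'I_n * 'I_n | X a p.1 p.2 != 0] is Some p then Y p.1 p.2 else 0.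

Lemma rcoord_linear a x Y Z : rcoord a (x *: Y + Z) = x * rcoord a Y + rcoord a Z.
Proof. by rewrite /rcoord; case: pickP => [p _|_]; rewrite ?mulr0 ?addr0 // !mxE. Qed.

Lemma rcoord0 a : rcoord a 0 = 0.
Proof. by rewrite /rcoord; case: pickP => [p _|_] //; rewrite mxE. Qed.

Lemma rcoordZ a x Y : rcoord a (x *: Y) = x * rcoord a Y.
Proof. by rewrite -[_ *: _]addr0 rcoord_linear rcoord0 addr0. Qed.

Lemma rcoordD a Y Z : rcoord a (Y + Z) = rcoord a Y + rcoord a Z.
Proof. by rewrite -{1}[Y]scale1r rcoord_linear mul1r. Qed.

Lemma rcoord_X a b : a \in roots R -> b \in roots R -> (rcoord a (X b) != 0) = (a == b).
Proof.
move=> ra rb; rewrite /rcoord; case: pickP => [p pa|h]; last first.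
  case/eqP: (chev_neq0 chX ra); apply/matrixP=> p q; rewrite mxE.
  by apply/eqP; move: (h (p, q)) => /= /negbFE.
case: (eqVneq a b) => [<-//|ab]; apply: contraNF ab => pb.
by apply/eqP/wt_eq => k; rewrite -(X_entry k ra pa) -(X_entry k rb pb).
Qed.

Lemma rcoord_XX a : a \in roots R -> rcoord a (X a) != 0.
Proof. by move=> ra; rewrite rcoord_X. Qed.

Lemma rcoord_X0 a b : a \in roots R -> b \in roots R -> a != b -> rcoord a (X b) = 0.
Proof. by move=> ra rb ab; apply/eqP/negPn; rewrite rcoord_X // (negPf ab). Qed.

Lemma rcoord_diag a Y : a \in roots R -> is_diag_mx Y -> rcoord a Y = 0.
Proof.
move=> ra dY; rewrite /rcoord; case: pickP => // p pa; apply: diag_entry => //.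
have [k] := wt_neq0 ra; rewrite -(X_entry k ra pa); apply: contraNneq => ->.
by rewrite subrr.
Qed.

Lemma rcoord_H a i : a \in roots R -> rcoord a (H i) = 0.
Proof. by move=> ra; rewrite rcoord_diag // (chev_diag chX). Qed.

Definition cartan_gen Y := exists i, Y = H i.
Definition root_gen S Y := exists2 a, (a \in roots R) && S a & Y = X a.
Definition full_gen S Y := cartan_gen Y \/ root_gen S Y.

Lemma cartan_diag Y : lspan cartan_gen Y -> is_diag_mx Y.
Proof.
elim=> [|x A B [i ->] _ ih]; first exact: mx0_is_diag.
apply/is_diag_mxP=> p q pq; rewrite 2!mxE diag_entry ?(chev_diag chX) // mulr0 add0r.
exact: diag_entry.
Qed.

Lemma rcoord_sum (y : 'cV[int]_l -> K) a : a \in roots R ->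
  rcoord a (\sum_(b <- roots R) y b *: X b) = y a * rcoord a (X a).
Proof.
move=> ra; rewrite (bigD1_seq a) ?roots_uniq //= rcoordD rcoordZ big_seq_cond.
set T := \sum_(i <- _ | _) _; suff -> : rcoord a T = 0 by rewrite addr0.
rewrite /T; elim/big_rec: _ => [|b Z /andP [rb ab] ih]; first exact: rcoord0.
by rewrite rcoord_linear ih addr0 rcoord_X0 ?mulr0 // eq_sym.
Qed.

Lemma sum_addD1 x a (y : 'cV[int]_l -> K) : a \in roots R ->
  \sum_(b <- roots R) ((if b == a then x else 0) + y b) *: X b =
  x *: X a + \sum_(b <- roots R) y b *: X b.
Proof.
move=> ra; under eq_bigr do rewrite scalerDl.
rewrite big_split /=; congr (_ + _).
rewrite (bigD1_seq a) ?roots_uniq //= eqxx big1 ?addr0 // => b /negPf ->.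
by rewrite scale0r.
Qed.

Lemma full_span_decomp S Y : lspan (full_gen S) Y -> exists Y0 y,
  [/\ lspan cartan_gen Y0, Y = Y0 + \sum_(a <- roots R) y a *: X a
    & forall a, a \in roots R -> rcoord a Y = y a * rcoord a (X a)].
Proof.
suff ex : lspan (full_gen S) Y -> exists Y0 y,
  lspan cartan_gen Y0 /\ Y = Y0 + \sum_(a <- roots R) y a *: X a.
  move/ex=> [Y0 [y [h e]]]; exists Y0, y; split=> // a ra.
  by rewrite e rcoordD rcoord_sum // rcoord_diag ?add0r //; exact: cartan_diag.
elim=> [|x A B hA _ [Y0 [y [hY0 ->]]]].
  exists 0, (fun _ => 0); split; first exact: lspan0.
  by rewrite big1 ?addr0 // => a _; rewrite scale0r.
case: hA => [hA|[a /andP [ra Sa] ->]].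
  by exists (x *: A + Y0), y; rewrite addrA; split=> //; apply: lspan_addZ.
exists Y0, (fun b => (if b == a then x else 0) + y b); split=> //.
by rewrite sum_addD1 // addrCA.
Qed.

Lemma root_span_full S Y : lspan (root_gen S) Y -> lspan (full_gen S) Y.
Proof. by apply: lspan_sub => Z hZ; right. Qed.

Lemma cartan_span_full S Y : lspan cartan_gen Y -> lspan (full_gen S) Y.
Proof. by apply: lspan_sub => Z hZ; left. Qed.

Lemma rcoord_full_span S Y a : lspan (full_gen S) Y -> a \in roots R -> ~~ S a -> rcoord a Y = 0.
Proof.
move=> + ra Sa; elim=> [|x A B hA _ ih]; first exact: rcoord0.
rewrite rcoord_linear ih addr0; case: hA => [[i ->]|[b /andP [rb Sb] ->]].
  by rewrite rcoord_H ?mulr0.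
by rewrite rcoord_X0 ?mulr0 //; apply: contraNneq Sa => ->.
Qed.

Lemma root_span_eq0 S Y : lspan (root_gen S) Y ->
  (forall a, a \in roots R -> S a -> rcoord a Y = 0) -> Y = 0.
Proof.
move=> hY h; have [y e] : exists y, Y = \sum_(a <- roots R) y a *: X a.
  elim: (hY) => [|x A B [a /andP [ra Sa] ->] _ [y ->]].
    by exists (fun _ => 0); rewrite big1 // => a _; rewrite scale0r.
  by exists (fun b => (if b == a then x else 0) + y b); rewrite sum_addD1.
rewrite e big_seq big1 // => a ra.
suff -> : y a = 0 by rewrite scale0r.
have : rcoord a Y = 0.
  case: (boolP (S a)) => Sa; first exact: h.
  exact: (rcoord_full_span (root_span_full hY) ra Sa).
rewrite e rcoord_sum // => /eqP; rewrite mulf_eq0 (negPf (rcoord_XX ra)) orbF.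
by move/eqP.
Qed.

Lemma eigen_coord S (f : 'M[K]_n -> 'M[K]_n) (e0 : K) (e : 'cV[int]_l -> K) (mu : K) Z a :
  (forall x A B, f (x *: A + B) = x *: f A + f B) ->
  (forall i, f (H i) = e0 *: H i) ->
  (forall b, b \in roots R -> f (X b) = e b *: X b) ->
  lspan (full_gen S) Z -> f Z = mu *: Z -> a \in roots R -> e a != mu -> rcoord a Z = 0.
Proof.
move=> fl fH fX hZ fZ ra ea; have f0 : f 0 = 0.
  by have := fl (- 1) 0 0; rewrite scaler0 addr0 scaleN1r addNr.
have : rcoord a (f Z) = e a * rcoord a Z.
  elim: hZ {fZ} => [|x A B hA _ ih]; first by rewrite f0 rcoord0 mulr0.
  rewrite fl !rcoord_linear ih mulrDr; congr (_ + _).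
  case: hA => [[i ->]|[b /andP [rb _] ->]]; first by rewrite fH rcoordZ rcoord_H // !mulr0.
  rewrite fX // rcoordZ; case: (eqVneq a b) => [->|ab]; first by rewrite mulrCA.
  by rewrite rcoord_X0 // !mulr0.
rewrite fZ rcoordZ => /eqP; rewrite -subr_eq0 -mulrBl mulf_eq0 subr_eq0 eq_sym (negPf ea) /=.
by move/eqP.
Qed.

(** Simultaneous eigenvectors, for brackets with the $H_k$ as well as for conjugation by torus
    elements: eigenvalues that separate [b] from the other roots and from the Cartan part leave only
    a multiple of $X_b$. *)
Lemma eigen_root (I : Type) S (f : I -> 'M[K]_n -> 'M[K]_n) (e0 : I -> K)
    (e : I -> 'cV[int]_l -> K) Z b :
  (forall i x A B, f i (x *: A + B) = x *: f i A + f i B) ->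
  (forall i j, f i (H j) = e0 i *: H j) ->
  (forall i a, a \in roots R -> f i (X a) = e i a *: X a) ->
  b \in roots R ->
  (forall a, a \in roots R -> a != b -> exists i, e i a != e i b) ->
  (exists i, e0 i != e i b) ->
  lspan (full_gen S) Z -> (forall i, f i Z = e i b *: Z) ->
  exists y, Z = y *: X b.
Proof.
move=> fl fH fX rb sep [i0 hi0] hZ fZ.
have z a : a \in roots R -> a != b -> rcoord a Z = 0.
  by move=> ra /(sep _ ra) [i ei]; apply: (eigen_coord (fl i) (fH i) (fX i) hZ (fZ i)).
have [Y0 [y [hY0 eZ cZ]]] := full_span_decomp hZ.
have eZ' : Z = Y0 + y b *: X b.
  rewrite eZ (bigD1_seq b) ?roots_uniq //= addrA big_seq_cond big1 ?addr0 //.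
  move=> a /andP [ra ab]; suff -> : y a = 0 by rewrite scale0r.
  have := cZ a ra; rewrite z // => /esym/eqP; rewrite mulf_eq0.
  by rewrite (negPf (rcoord_XX ra)) orbF => /eqP.
have fY0 : f i0 Y0 = e0 i0 *: Y0.
  elim: hY0 => [|x A B [j ->] _ ih]; last by rewrite fl fH ih scalerDr !scalerA mulrC.
  by have := fl i0 (- 1) 0 0; rewrite !scaler0 addr0 scaleN1r addNr.
exists (y b); rewrite eZ'; suff -> : Y0 = 0 by rewrite add0r.
have := fZ i0; rewrite eZ' addrC fl fY0 fX // scalerDr !scalerA [y b * _]mulrC.
move/addrI/eqP; rewrite -subr_eq0 -scalerBl scaler_eq0 subr_eq0 (negPf hi0) /=.
by move/eqP.
Qed.

Lemma eigen_cartan (I : Type) S (f : I -> 'M[K]_n -> 'M[K]_n)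
    (e : I -> 'cV[int]_l -> K) Z :
  (forall i x A B, f i (x *: A + B) = x *: f i A + f i B) ->
  (forall i j, f i (H j) = H j) ->
  (forall i a, a \in roots R -> f i (X a) = e i a *: X a) ->
  (forall a, a \in roots R -> exists i, e i a != 1) ->
  lspan (full_gen S) Z -> (forall i, f i Z = Z) -> lspan cartan_gen Z.
Proof.
move=> fl fH fX sep hZ fZ.
have [Y0 [y [hY0 eZ cZ]]] := full_span_decomp hZ.
rewrite eZ big_seq big1 ?addr0 // => a ra.
suff -> : y a = 0 by rewrite scale0r.
have [i ei] := sep a ra; have := cZ a ra.
rewrite (eigen_coord (f := f i) (e0 := 1) (mu := 1) (fl i) _ (fX i) hZ) //.
- by move/esym/eqP; rewrite mulf_eq0 (negPf (rcoord_XX ra)) orbF => /eqP.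
- by move=> j; rewrite fH scale1r.
- by rewrite fZ scale1r.
Qed.

Definition hx a := lie (X a) (X (- a)).

Lemma hx_cartan a : a \in roots R -> lspan cartan_gen (hx a).
Proof.
move=> ra; have [c _] := chev_opp chX ra; rewrite -/(hx a) => ->.
by apply: lspan_sum => i _; apply: lspanZ; apply: lspan_in; exists i.
Qed.

Lemma lie_hx a b : a \in roots R -> b \in roots R ->
  lie (hx a) (X b) = (pairing b (coroot R a))%:~R *: X b.
Proof.
move=> ra rb; have [c e1] := chev_opp chX ra; rewrite -/(hx a) => ->.
rewrite lie_suml e1 -[pairing _ _]/((_ *m _) 0 0) mulmx_suml summxE rmorph_sum /= scaler_suml.
apply: eq_bigr => i _; rewrite lieZl (chev_H chX) // scalerA -rmorphM /=.
by rewrite -scalemxAl [in RHS]mxE.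
Qed.

Lemma hxN a : hx (- a) = - hx a.
Proof. by rewrite /hx opprK lieC. Qed.

Lemma lie_hxx a : a \in roots R -> lie (hx a) (X a) = 2%:R *: X a.
Proof. by move=> ra; rewrite lie_hx // pairing_coroot. Qed.

Lemma lie_cartan Y Z : lspan cartan_gen Y -> lspan cartan_gen Z -> lie Y Z = 0.
Proof.
move=> /cartan_diag dY /cartan_diag dZ; apply/matrixP=> p q; rewrite lie_diag // [RHS]mxE.
case: (eqVneq p q) => [->|pq]; first by rewrite subrr mul0r.
by rewrite (diag_entry dZ pq) mulr0.
Qed.

(* The weights along a path of nonzero entries of [X a] decrease by 2. *)
Lemma X_nilpotent a : a \in roots R -> X a ^+ n = 0.
Proof.
move=> ra; pose mu p := hx a p p.
have dh : is_diag_mx (hx a) by apply/cartan_diag/hx_cartan.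
have step p q : X a p q != 0 -> mu q = mu p - 2%:R.
  move=> nz; have := lie_diag (X a) p q dh; rewrite lie_hxx // mxE => /(mulIf nz).
  by rewrite -/(mu p) -/(mu q) => ->; rewrite opprB addrC subrK.
have path k p q : (X a ^+ k) p q != 0 ->
  exists2 s : seq 'I_n, size s = k.+1 & map mu s = [seq mu p - (2 * j)%:R | j <- iota 0 k.+1].
  elim: k p => [|k ih] p nz; first by exists [:: p]; rewrite //= muln0 subr0.
  have [r /andP [pr rq]] : exists r, (X a p r != 0) && ((X a ^+ k) r q != 0).
    apply/existsP; apply: contraNT nz => /existsPn h; rewrite expmxS mxE big1 // => r _.
    by apply/eqP; rewrite mulf_eq0; move: (h r); rewrite negb_and !negbK.
  have [s sz es] := ih r rq; exists (p :: s); first by rewrite /= sz.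
  have -> : iota 0 k.+2 = 0%N :: [seq (1 + j)%N | j <- iota 0 k.+1] by rewrite -(iotaDl 1 0).
  rewrite map_cons es map_cons muln0 subr0; congr (_ :: _).
  rewrite -map_comp; apply: eq_map => j /=.
  rewrite (step _ _ pr) -addrA -opprD -natrD; congr (_ - _%:R); lia.
apply/matrixP=> p q; rewrite mxE; apply/eqP/negPn/negP => /path [s sz es].
have : uniq s.
  apply: (@map_uniq _ _ mu); rewrite es map_inj_in_uniq ?iota_uniq // => i j _ _.
  move/addrI/oppr_inj/eqP; rewrite -[_%:R]/((2 * i)%:Z%:~R) -[X in _ == X]/((2 * j)%:Z%:~R).
  by move/eqP/intr_inj_char0 => [] /eqP; rewrite eqn_pmul2l // => /eqP.
move/card_uniqP; rewrite sz => e; have := max_card (mem s).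
by rewrite e card_ord ltnn.
Qed.

Lemma urootE a x : uroot X a x = mexp (x *: X a).
Proof. by []. Qed.

Lemma urootD a x y : a \in roots R -> uroot X a (x + y) = uroot X a x *m uroot X a y.
Proof. by move=> ra; rewrite !urootE mexpD // X_nilpotent. Qed.

Lemma uroot0 a : uroot X a 0 = 1%:M.
Proof. by rewrite urootE scale0r mexp0. Qed.

Lemma uroot_unit_inv a x : a \in roots R ->
  uroot X a x \in unitmx /\ invmx (uroot X a x) = uroot X a (- x).
Proof. by move=> ra; apply: unit_invmx_eq; rewrite -urootD // subrr uroot0. Qed.

Lemma uroot_unit a x : a \in roots R -> uroot X a x \in unitmx.
Proof. by move=> ra; case: (uroot_unit_inv x ra). Qed.

Lemma invmx_uroot a x : a \in roots R -> invmx (uroot X a x) = uroot X a (- x).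
Proof. by move=> ra; case: (uroot_unit_inv x ra). Qed.

Lemma Ad_urootE a x Y : a \in roots R ->
  Ad (uroot X a x) Y = mexp (x *: X a) *m Y *m mexp (- (x *: X a)).
Proof. by move=> ra; rewrite /Ad invmx_uroot // !urootE scaleNr. Qed.

Lemma nilZ a x : a \in roots R -> (x *: X a) ^+ n = 0.
Proof. by move=> ra; rewrite expmx_scale0 // X_nilpotent. Qed.

Lemma Ad_uroot_X a x : a \in roots R -> Ad (uroot X a x) (X a) = X a.
Proof.
move=> ra; rewrite Ad_urootE // mexp_conj_lie1 ?nilZ //.
by rewrite lieZl liexx scaler0.
Qed.

Lemma Ad_uroot_H a x k : a \in roots R ->
  Ad (uroot X a x) (H k) = H k - (x * wt k a) *: X a.
Proof.
move=> ra; have e : lie (x *: X a) (H k) = - (x * wt k a) *: X a.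
  by rewrite lieZl lieC (chev_H chX) // scalerN scalerA scaleNr.
rewrite Ad_urootE // mexp_conj_lie2 ?nilZ // e ?scaleNr //.
by rewrite lieZl lieNr lieZr liexx !(scaler0, oppr0).
Qed.

Lemma lie_X_hx a : a \in roots R -> lie (X a) (hx a) = - (2%:R *: X a).
Proof. by move=> ra; rewrite lieC lie_hxx. Qed.

Lemma Ad_uroot_hx a x : a \in roots R ->
  Ad (uroot X a x) (hx a) = hx a - (x * 2%:R) *: X a.
Proof.
move=> ra; rewrite Ad_urootE // mexp_conj_lie2 ?nilZ //.
  by rewrite lieZl lie_X_hx // scalerN scalerA.
by rewrite !lieZl lie_X_hx // !lieZr lieNr lieZr liexx !(scaler0, oppr0).
Qed.

Lemma Ad_uroot_opp a x : a \in roots R ->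
  Ad (uroot X a x) (X (- a)) = X (- a) + x *: hx a - x ^+ 2 *: X a.
Proof.
move=> ra; rewrite Ad_urootE // mexp_conj_lie3 ?nilZ //.
  rewrite !lieZl -/(hx a) !lieZr lie_X_hx // !scalerN !scalerA; congr (_ - _ *: _).
  field; exact: (natK 1).
by rewrite !lieZl -/(hx a) !lieZr lie_X_hx // lieNr !lieZr liexx !(scaler0, oppr0).
Qed.

Lemma Ad_uroot_oppN a x : a \in roots R ->
  Ad (uroot X (- a) x) (X a) = X a - x *: hx a - x ^+ 2 *: X (- a).
Proof.
move=> ra; have := Ad_uroot_opp x (roots_opp ra); rewrite opprK => ->.
by rewrite hxN scalerN.
Qed.

Lemma wroot_unit a x : a \in roots R -> wroot X a x \in unitmx.
Proof. by move=> ra; rewrite /wroot !unitmx_mul !uroot_unit ?roots_oppE. Qed.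

Lemma Ad_wroot a x Y : a \in roots R ->
  Ad (wroot X a x) Y = Ad (uroot X a x) (Ad (uroot X (- a) (- x^-1)) (Ad (uroot X a x) Y)).
Proof.
move=> ra; have rN := roots_opp ra; rewrite /wroot AdM ?unitmx_mul ?uroot_unit //.
by rewrite AdM ?uroot_unit.
Qed.

Lemma Ad_wroot_X a x : a \in roots R -> x != 0 ->
  Ad (wroot X a x) (X a) = - (x ^- 2 *: X (- a)).
Proof.
move=> ra x0; rewrite Ad_wroot // Ad_uroot_X //.
have := (Ad_uroot_hx x ra, Ad_uroot_opp x ra, Ad_uroot_oppN (- x^-1) ra).
move: (hx a) => h [[E1 E2] E3]; rewrite E3 !(AdB, AdZ) Ad_uroot_X // E1 E2.
apply/matrixP=> p q; rewrite !mxE; field.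
exact: x0.
Qed.

Lemma Ad_wroot_H a x k : a \in roots R -> x != 0 ->
  Ad (wroot X a x) (H k) = H k - wt k a *: hx a.
Proof.
move=> ra x0; have rN := roots_opp ra; rewrite Ad_wroot // Ad_uroot_H //.
have := (Ad_uroot_hx x ra, Ad_uroot_opp x ra, Ad_uroot_oppN (- x^-1) ra).
move: (hx a) => h [[E1 E2] E3]; rewrite !(AdB, AdZ) Ad_uroot_H // E3 wtN.
rewrite !(AdB, AdZ) Ad_uroot_H // Ad_uroot_X // E1 E2.
apply/matrixP=> p q; rewrite !mxE; field.
exact: x0.
Qed.

End Chevalley.

(** * Adjoint action of root elements and of Weyl group representatives *)

Section ChevalleyAd.
Variables (K : fieldType) (l n : nat) (R : root_system l).
Variables (H : 'I_l -> 'M[K]_n) (X : 'cV[int]_l -> 'M[K]_n).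
Hypotheses (chX : chevalley R H X) (natK : forall k, k.+1%:R != 0 :> K).
Implicit Types (a b : 'cV[int]_l) (S : pred 'cV[int]_l) (Y Z g : 'M[K]_n) (x : K).

Let natU k : (k.+1%:R : K) \is a GRing.unit. Proof. by rewrite unitfE. Qed.

Definition closed_roots S := forall a b, a \in roots R -> b \in roots R ->
  a + b \in roots R -> S a -> S b -> S (a + b).

Lemma hx0_full S a : a \in roots R -> lspan (full_gen R H X S) (hx X a).
Proof. by move=> ra; apply: cartan_span_full; exact: (hx_cartan chX). Qed.

Lemma lie_X_full S a Z : closed_roots S -> a \in roots R -> S a ->
  full_gen R H X S Z -> lspan (full_gen R H X S) (lie (X a) Z).
Proof.
move=> cl ra Sa [[i ->]|[b /andP [rb Sb] ->]].
  rewrite lieC (chev_H chX) //; apply: lspanN; apply: lspanZ; apply: lspan_in.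
  by right; exists a; rewrite // ra.
case: (eqVneq (a + b) 0) => [/eqP|ab].
  by rewrite addr_eq0 -eqr_oppLR => /eqP <-; exact: hx0_full.
case: (boolP (a + b \in roots R)) => rab; last by rewrite (chev_zero chX) //; apply: lspan0.
have [N ->] := chev_sum chX ra rb rab; apply: lspanZ; apply: lspan_in; right.
by exists (a + b); rewrite // rab cl.
Qed.

Lemma Ad_uroot_full S a x Y : closed_roots S -> a \in roots R -> S a ->
  lspan (full_gen R H X S) Y -> lspan (full_gen R H X S) (Ad (uroot X a x) Y).
Proof.
move=> cl ra Sa hY; rewrite (Ad_urootE chX natK) //; apply: mexp_conj_span => //.
  exact: (nilZ chX natK).
by move=> Z hZ; rewrite lieZl; apply: lspanZ; apply: lie_X_full.
Qed.

Lemma Ad_uroot_all a x Y : a \in roots R ->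
  lspan (full_gen R H X predT) Y -> lspan (full_gen R H X predT) (Ad (uroot X a x) Y).
Proof. by move=> ra; apply: Ad_uroot_full. Qed.

Lemma Ad_wroot_all a x Y : a \in roots R ->
  lspan (full_gen R H X predT) Y -> lspan (full_gen R H X predT) (Ad (wroot X a x) Y).
Proof.
move=> ra hY; rewrite (Ad_wroot chX natK) //.
by do 3!(apply: Ad_uroot_all; rewrite ?roots_oppE //).
Qed.

Lemma Ad_wroot_hx a x : a \in roots R -> x != 0 ->
  Ad (wroot X a x) (hx X a) = - hx X a.
Proof.
move=> ra x0; rewrite (Ad_wroot chX natK) //; have rN := roots_opp ra.
have := Ad_uroot_hx chX natK (- x^-1) rN; rewrite hxN AdN => /eqP.
rewrite eqr_oppLR => /eqP E4.
have := (Ad_uroot_hx chX natK x ra, Ad_uroot_opp chX natK x ra, Ad_uroot_oppN chX natK (- x^-1) ra).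
move: E4; move: (hx X a) => h E4 [[E1 E2] E3]; rewrite E1 !(AdB, AdZ) E4 E3.
rewrite !(AdN, AdB, AdZ) E1 E2 (Ad_uroot_X chX natK) //.
apply/matrixP=> p q; rewrite !mxE; field.
exact: x0.
Qed.

(** Only the weight of the image is computed, by moving $H_k$ back through the conjugation. The
    scalar stays undetermined, so no structure constants enter. *)
Lemma Ad_wroot_root a b x : a \in roots R -> b \in roots R -> x != 0 ->
  exists y, Ad (wroot X a x) (X b) = y *: X (reflection a (coroot R a) *m b).
Proof.
move=> ra rb x0; have wu := wroot_unit chX natK x ra.
have rc := reflection_root ra rb.
apply: (@eigen_root _ _ _ _ _ _ chX natK 'I_l predT (fun k => lie (H k)) (fun=> 0) (@wt K l R)).
- by move=> k y A B; rewrite lieDr lieZr.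
- by move=> k j; rewrite scale0r (lie_cartan chX) //; apply: lspan_in; [exists k|exists j].
- by move=> k c hc; rewrite (chev_H chX).
- exact: rc.
- by move=> c _ /(wt_neq R natK).
- by have [k hk] := wt_neq0 natK rc; exists k; rewrite eq_sym.
- by apply: Ad_wroot_all => //; apply: lspan_in; right; exists b; rewrite ?rb.
move=> k; have -> : H k = Ad (wroot X a x) (H k - wt K R k a *: hx X a).
  by rewrite AdB AdZ (Ad_wroot_H chX natK) // Ad_wroot_hx // scalerN opprK subrK.
rewrite -Ad_lie // -AdZ; congr (Ad _ _).
rewrite lieDl lieNl lieZl (chev_H chX) // (lie_hx chX) // scalerA -scalerBl.
congr (_ *: _); rewrite /wt reflectionE -rmorphM -rmorphB /=; congr (_%:~R).
by rewrite pairingB pairingZ mulrC.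
Qed.

Lemma hroot1 a : a \in roots R -> hroot X a 1 = 1%:M.
Proof.
move=> ra; have rN := roots_opp ra; rewrite /hroot /wroot !invrN invr1 opprK.
rewrite -!mulmxA (mulmxA (uroot X a 1) (uroot X a (-1))) -(urootD chX natK) // subrr.
rewrite (uroot0 X) mul1mx (mulmxA (uroot X (- a) _) (uroot X (- a) _)) -(urootD chX natK) // addNr.
by rewrite (uroot0 X) mul1mx -(urootD chX natK) // subrr (uroot0 X).
Qed.

(** * Logarithmic derivatives *)

Variable D : K -> K.
Hypothesis DD : forall x y, D (x + y) = D x + D y.
Hypothesis DM : forall x y, D (x * y) = D x * y + x * D y.
Hypothesis DX : forall a, map_mx D (X a) = 0.

Lemma derN x : D (- x) = - D x.
Proof. by apply: (addIr (D x)); rewrite -DD !addNr (der0 DD). Qed.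

Lemma derV x : x != 0 -> D x^-1 = - (D x / x ^+ 2).
Proof.
move=> x0; apply: (mulfI x0); apply: (addrI (D x * x^-1)).
rewrite -DM divff // (der1 DM); field.
exact: x0.
Qed.

Lemma D_uroot a x : a \in roots R -> map_mx D (uroot X a x) = D x *: X a *m uroot X a x.
Proof. by move=> ra; rewrite urootE der_mexp // (X_nilpotent chX). Qed.

(** The derivatives of the three factors, moved to the left by conjugation, combine in the span of
    $X_a$, $h_a$, $X_{-a}$, and only the term at $h_a$ remains. *)
Lemma D_wroot a x : a \in roots R -> x != 0 ->
  map_mx D (wroot X a x) = (D x / x) *: hx X a *m wroot X a x.
Proof.
move=> ra x0; have rN := roots_opp ra.
have wu := wroot_unit chX natK x ra; have uu := uroot_unit chX natK x ra.
rewrite {1}/wroot !(derMmx DD DM) !D_uroot // derN derV // opprK.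
set e := uroot X a x; set f := uroot X (- a) (- x^-1).
have T2 : e *m ((D x / x ^+ 2) *: X (- a) *m f) *m e =
  (D x / x ^+ 2) *: Ad e (X (- a)) *m wroot X a x.
  rewrite /Ad /wroot -/e -/f -!scalemxAl -scalemxAr -scalemxAl; congr (_ *: _).
  by rewrite !mulmxA mulmxKV.
have T3 : e *m f *m (D x *: X a *m e) = D x *: Ad (wroot X a x) (X a) *m wroot X a x.
  rewrite -[in RHS]scalemxAl -mulmx_Ad // -[in LHS]scalemxAl -scalemxAr; congr (_ *: _).
  rewrite /wroot -/e -/f -(mulmxA (e *m f) e); congr (_ *m _).
  by rewrite (mulmx_Ad (X a) uu) (Ad_uroot_X chX natK).
have T1 : D x *: X a *m e *m f *m e = D x *: X a *m wroot X a x by rewrite /wroot !mulmxA.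
rewrite mulmxDl T2 T3 T1 -!mulmxDl; congr (_ *m _).
rewrite (Ad_uroot_opp chX natK) // (Ad_wroot_X chX natK) //.
apply/matrixP=> p q; rewrite !mxE; field.
exact: x0.
Qed.

Lemma D_hroot a x : a \in roots R -> x != 0 ->
  map_mx D (hroot X a x) = (D x / x) *: hx X a *m hroot X a x.
Proof.
move=> ra x0; rewrite /hroot (derMmx DD DM) !D_wroot ?oppr_eq0 ?oner_eq0 //.
by rewrite derN (der1 DM) oppr0 mul0r scale0r mul0mx mulmx0 addr0 mulmxA.
Qed.

(** Differentiation yields identities in $x$ multiplied by $Dx$. This provides enough points with
    $Dx\ne 0$ to cancel that factor and to read them as polynomial identities. *)
Hypothesis Dinf : forall p : {poly K}, (forall x, x != 0 -> D x != 0 -> p.[x] = 0) -> p = 0.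

Definition const_poly (p : {poly K}) := forall k, D p`_k = 0.

Lemma const_polyD p q : const_poly p -> const_poly q -> const_poly (p + q).
Proof. by move=> hp hq k; rewrite coefD DD hp hq addr0. Qed.

Lemma const_polyM p q : const_poly p -> const_poly q -> const_poly (p * q).
Proof.
move=> hp hq k; rewrite coefM (der_sum DD) big1 // => i _.
by rewrite DM hp hq mul0r mulr0 addr0.
Qed.

Lemma const_polyCX c k : D c = 0 -> const_poly (c *: 'X^k).
Proof.
move=> hc i; rewrite coefZ coefXn; case: (_ == _); rewrite ?mulr1n ?mulr0n ?mulr1 ?mulr0 //.
exact: (der0 DD).
Qed.

Lemma der_horner p x : const_poly p -> D p.[x] = p^`().[x] * D x.
Proof.
move=> hp; rewrite horner_coef (der_sum DD).
rewrite (horner_coef_wide x (size_poly _ _ : size p^`() <= (size p).-1)%N) mulr_suml.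
rewrite (eq_bigr (fun i : 'I_(size p) => p`_i * (D (x ^+ i)))); last first.
  by move=> i _; rewrite DM hp mul0r add0r.
transitivity (\sum_(0 <= i < size p) p`_i * D (x ^+ i)); first by rewrite big_mkord.
case: (size p) => [|m] /=; first by rewrite big_nil big_ord0.
rewrite big_nat_recl // expr0 (der1 DM) mulr0 add0r big_mkord; apply: eq_bigr => i _.
by rewrite coef_deriv (derX DM) -[p`_i.+1 *+ _]mulr_natr !mulrA.
Qed.

(** The coefficients are constants of the derivation, so differentiating a value at $x$ amounts to
    the formal derivative times $Dx$. *)
Definition laurent N (F : K -> 'M[K]_n) := exists P : 'M[{poly K}]_n,
  (forall p q, const_poly (P p q)) /\
  (forall x, x != 0 -> x ^+ N *: F x = map_mx (horner_eval x) P).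

Lemma laurentM N1 N2 F G : laurent N1 F -> laurent N2 G ->
  laurent (N1 + N2) (fun x => F x *m G x).
Proof.
move=> [P [cP hP]] [Q [cQ hQ]]; exists (P *m Q); split=> [p q|x x0].
  rewrite mxE; elim/big_ind: _ => [k|p1 p2|i _]; first by rewrite coef0 (der0 DD).
    exact: const_polyD.
  exact: const_polyM.
by rewrite map_mxM -hP // -hQ // -scalemxAl -scalemxAr scalerA exprD.
Qed.

Lemma laurent_sum N (F : K -> 'M[K]_n) sz (e : nat -> nat) (M : nat -> 'M[K]_n) :
  (forall k, map_mx D (M k) = 0) ->
  (forall x, x != 0 -> x ^+ N *: F x = \sum_(k < sz) x ^+ e k *: M k) -> laurent N F.
Proof.
move=> hM hF; exists (\matrix_(p, q) \sum_(k < sz) M k p q *: 'X^(e k)); split=> [p q|x x0].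
  rewrite mxE; elim/big_ind: _ => [k|p1 p2|i _]; first by rewrite coef0 (der0 DD).
    exact: const_polyD.
  by apply: const_polyCX; move/matrixP/(_ p q): (hM i); rewrite !mxE.
rewrite hF //; apply/matrixP=> p q; rewrite summxE !mxE /horner_eval horner_sum.
by apply: eq_bigr => k _; rewrite mxE hornerZ hornerXn mulrC.
Qed.

Lemma D_expmx (A : 'M[K]_n) k : map_mx D A = 0 -> map_mx D (A ^+ k) = 0.
Proof.
move=> hA; elim: k => [|k ih]; first by rewrite expr0 (der1mx DD DM).
by rewrite expmxS (derMmx DD DM) hA ih mul0mx mulmx0 addr0.
Qed.

Lemma D_mexp_coef a k : map_mx D ((k`!%:R)^-1 *: X a ^+ k) = 0.
Proof.
by rewrite (derZmx DM) D_expmx // scaler0 addr0 (der_factV natU DD DM) scale0r.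
Qed.

Lemma laurent_uroot a : laurent 0 (uroot X a).
Proof.
apply: (@laurent_sum _ _ n id (fun k => (k`!%:R)^-1 *: X a ^+ k)); first exact: D_mexp_coef.
move=> x x0; rewrite expr0 scale1r urootE /mexp; apply: eq_bigr => k _.
by rewrite expZmx !scalerA mulrC.
Qed.

Lemma laurent_uroot_inv a : laurent n (fun x => uroot X a (- x^-1)).
Proof.
apply: (@laurent_sum _ _ n (fun k => n - k)%N (fun k => (- 1) ^+ k *: ((k`!%:R)^-1 *: X a ^+ k))).
  move=> k; rewrite (derZmx DM) D_mexp_coef scaler0 addr0.
  have -> : D ((-1) ^+ k) = 0; last by rewrite scale0r.
  elim: k => [|k ih]; first by rewrite expr0 (der1 DM).
  by rewrite exprS DM ih derN (der1 DM) oppr0 mul0r mulr0 addr0.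
move=> x x0; rewrite urootE /mexp scaler_sumr; apply: eq_bigr => k _.
rewrite expZmx !scalerA; congr (_ *: _).
have -> : x ^+ n = x ^+ (n - k) * x ^+ k by rewrite -exprD subnK // ltnW.
have -> : (- x^-1) ^+ k = (- 1) ^+ k * (x ^+ k)^-1 by rewrite -exprVn -exprNn.
have xk : x ^+ k != 0 by rewrite expf_neq0.
by field; rewrite xk andbT -unitfE (fact_unit natU).
Qed.

Lemma laurent_hroot a : laurent n (hroot X a).
Proof.
have lw : laurent n (wroot X a).
  have := laurentM (laurentM (laurent_uroot a) (laurent_uroot_inv (- a))) (laurent_uroot a).
  by rewrite add0n addn0.
suff lc : laurent 0 (fun _ => wroot X a (-1)).
  by have := laurentM lw lc; rewrite addn0.
apply: (@laurent_sum _ _ 1 (fun _ => 0%N) (fun _ => wroot X a (-1))).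
  have c y (hy : D y = 0) b : map_mx D (uroot X b y) = 0.
    rewrite urootE (der_sum_mx DD) big1 // => k _.
    rewrite expZmx scalerA mulrC -scalerA (derZmx DM) D_mexp_coef scaler0 addr0.
    suff -> : D (y ^+ k) = 0 by rewrite scale0r.
    by case: (nat_of_ord k) => [|m]; rewrite ?(der1 DM) // (derX DM) hy mulr0.
  move=> _; rewrite /wroot !(derMmx DD DM) !c ?mul0mx ?mulmx0 ?addr0 //.
  - by rewrite mul0mx.
  - by rewrite invrN invr1 opprK (der1 DM).
  - by rewrite derN (der1 DM) oppr0.
move=> x x0; by rewrite big_ord1 !expr0.
Qed.

(* Both sides of [x h'(x) = H_a h(x)] are polynomial after multiplication by
   [x^n], so each entry of [h] is a single power of [x]. *)
Lemma hroot_diag a : a \in roots R -> exists k : 'I_n -> int,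
  (forall p, hx X a p p = (k p)%:~R) /\
  (forall x, x != 0 -> hroot X a x = diag_mx (\row_p x ^ k p)).
Proof.
move=> ra; have [P [cP hP]] := laurent_hroot a.
have dh : is_diag_mx (hx X a) by exact/(cartan_diag chX)/(hx_cartan chX).
have hE p q x : x != 0 -> x ^+ n * hroot X a x p q = (P p q).[x].
  by move=> x0; move/matrixP/(_ p q): (hP x x0); rewrite !mxE.
have ode p q k : (P p q)`_k != 0 -> k%:R = n%:R + hx X a p p.
  suff e : 'X * (P p q)^`() = (n%:R + hx X a p p) *: P p q.
    move=> nz; apply: (mulIf nz); move/polyP/(_ k): e; rewrite coefZ coefXM coef_deriv => <-.
    case: k nz => [|k] nz; first by rewrite mul0r.
    by rewrite mulr_natl.
  apply/eqP; rewrite -subr_eq0; apply/eqP/Dinf => x x0 Dx.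
  rewrite hornerD hornerN hornerM hornerX hornerZ; apply: (mulIf Dx); rewrite mul0r.
  rewrite mulrBl -mulrA -(der_horner _ (cP p q)) -hE // DM.
  have : map_mx D (hroot X a x) p q = D x / x * (hx X a p p * hroot X a x p q).
    rewrite (D_hroot ra x0) -scalemxAl mxE; congr (_ * _).
    rewrite mxE (bigD1 p) //= big1 ?addr0 // => r rp.
    by rewrite (diag_entry dh) ?mul0r // eq_sym.
  rewrite mxE => ->; set h := hroot X a x p q; set m := hx X a p p.
  case: (n) => [|N]; first by rewrite !expr0 (der1 DM); field.
  by rewrite (derX DM) exprS; field.
(* The value at $x=1$ is the identity matrix: it makes the diagonal monomials monic and kills the
   others. *)
have P1 p q : (P p q).[1] = (p == q)%:R.
  by rewrite -hE ?oner_eq0 // expr1n mul1r (hroot1 ra) mxE.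
have mono p q k : (P p q)`_k != 0 -> P p q = (P p q)`_k *: 'X^k.
  move=> nz; apply/polyP=> i; rewrite coefZ coefXn; case: (eqVneq i k) => [->|ik].
    by rewrite mulr1.
  rewrite mulr0; apply/eqP; apply: contraNT ik => /ode; rewrite -(ode _ _ _ nz) => /eqP.
  by rewrite !pmulrn => /eqP/(intr_inj_char0 natK) [] ->.
have : forall p, exists k : int, hx X a p p = k%:~R /\
    forall x q, x != 0 -> hroot X a x p q = if p == q then x ^ k else 0.
  move=> p; have [k nz] : exists k, (P p p)`_k != 0.
    have : P p p != 0 by apply: contra_eq_neq (P1 p p) => ->; rewrite horner0 eqxx eq_sym oner_eq0.
    by rewrite -lead_coef_eq0 => nz; exists (size (P p p)).-1.
  exists (k%:Z - n%:Z); split.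
    by rewrite rmorphB /= -!pmulrn (ode _ _ _ nz) addrC addKr.
  move=> x q x0; apply: (mulfI (expf_neq0 n x0)); rewrite hE //.
  case: (eqVneq p q) => [<-|pq].
    rewrite [P p p](mono _ _ _ nz) hornerZ hornerXn.
    have := P1 p p; rewrite {1}[P p p](mono _ _ _ nz) hornerZ hornerXn expr1n mulr1 eqxx => ->.
    by rewrite mul1r expfzDr // -exprnN -exprnP mulrCA mulfV ?mulr1 ?expf_neq0.
  rewrite mulr0; suff -> : P p q = 0 by rewrite horner0.
  apply/polyP=> i; rewrite coef0; apply/eqP/negPn/negP => nzi.
  have := P1 p q; rewrite {1}[P p q](mono _ _ _ nzi) hornerZ hornerXn expr1n mulr1 (negPf pq).
  by move/eqP: nzi.
move=> /fin_all_exists [k hk]; exists k; split=> [p|x x0]; first by case: (hk p).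
by apply/matrixP=> p q; case: (hk p) => _ ->; rewrite // !mxE; case: eqP.
Qed.

End ChevalleyAd.

Section TorusWords.
Variables (K : fieldType) (l n : nat) (R : root_system l).
Variables (H : 'I_l -> 'M[K]_n) (X : 'cV[int]_l -> 'M[K]_n).
Hypotheses (chX : chevalley R H X) (natK : forall k, k.+1%:R != 0 :> K).
Implicit Types (a b : 'cV[int]_l) (S : pred 'cV[int]_l) (Y Z g : 'M[K]_n) (x y : K).
Implicit Types (ws : seq ('cV[int]_l * K)) (L : seq 'cV[int]_l).

(** * Torus elements *)

Section Torus.
(** The exponents of the cocharacter $\alpha_i^\vee$ in the diagonal torus. They are a parameter
    because the same integers serve over $C$ and over $\mathcal E$. *)
Variable kk : 'I_l -> 'I_n -> int.
Hypothesis hkk : forall i p, hx X (simple i) p p = (kk i p)%:~R.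
Hypothesis hdiag : forall i x, x != 0 -> hroot X (simple i) x = diag_mx (\row_p x ^ kk i p).
Implicit Types (u v : 'I_l -> K).

Lemma torus_diag u : (forall i, u i != 0) ->
  torus_elt X u = diag_mx (\row_p \prod_i u i ^ kk i p).
Proof.
move=> u0; rewrite /torus_elt.
suff h (r : seq 'I_l) : \prod_(i <- r) hroot X (simple i) (u i) =
    diag_mx (\row_p \prod_(i <- r) u i ^ kk i p) by exact: h.
elim: r => [|i r ih].
  rewrite big_nil -[LHS]/(1%:M) -diag_const_mx; congr diag_mx.
  by apply/rowP=> p; rewrite !mxE big_nil.
rewrite big_cons ih hdiag // -[LHS]/(_ *m _) mulmx_diag; congr diag_mx.
by apply/rowP=> p; rewrite !mxE big_cons.
Qed.

Lemma torus_mul u v : (forall i, u i != 0) -> (forall i, v i != 0) ->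
  torus_elt X u *m torus_elt X v = torus_elt X (fun i => u i * v i).
Proof.
move=> u0 v0; rewrite !torus_diag // => [|i]; last by rewrite mulf_neq0.
rewrite mulmx_diag; congr diag_mx; apply/rowP=> p; rewrite !mxE -big_split /=.
by apply: eq_bigr => i _; rewrite exprzMl ?unitfE.
Qed.

Lemma torus_one : torus_elt X (fun _ => 1) = 1%:M.
Proof.
rewrite torus_diag => [|_]; last exact: oner_neq0.
rewrite -diag_const_mx; congr diag_mx; apply/rowP=> p; rewrite !mxE.
by rewrite big1 // => i _; rewrite exp1rz.
Qed.

Lemma torus_unit_inv u : (forall i, u i != 0) ->
  torus_elt X u \in unitmx /\ invmx (torus_elt X u) = torus_elt X (fun i => (u i)^-1).
Proof.
move=> u0; apply: unit_invmx_eq; rewrite torus_mul // => [|i]; last by rewrite invr_eq0.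
rewrite -torus_one [RHS]torus_diag => [|i]; last exact: oner_neq0.
rewrite torus_diag => [|i]; last by rewrite mulfV // oner_neq0.
by congr diag_mx; apply/rowP=> p; rewrite !mxE; apply: eq_bigr => i _; rewrite mulfV.
Qed.

Lemma torus_unit t : torus X t -> t \in unitmx.
Proof. by case=> u u0 ->; case: (torus_unit_inv u0). Qed.

Lemma torus_group_one : torus X 1%:M.
Proof. by exists (fun _ => 1); rewrite ?torus_one // => i; apply: oner_neq0. Qed.

Lemma torus_group_mul t t' : torus X t -> torus X t' -> torus X (t *m t').
Proof.
case=> u u0 -> [v v0 ->]; exists (fun i => u i * v i); last exact: torus_mul.
by move=> i; rewrite mulf_neq0.
Qed.

Lemma torus_group_inv t : torus X t -> torus X (invmx t).
Proof.
case=> u u0 ->; exists (fun i => (u i)^-1); last by case: (torus_unit_inv u0).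
by move=> i; rewrite invr_eq0.
Qed.

Lemma Ad_torus_diag t Y : torus X t -> is_diag_mx Y -> Ad t Y = Y.
Proof.
move=> ht dY; have tu := torus_unit ht; rewrite /Ad.
have -> : t *m Y = Y *m t; last by rewrite mulmxK.
case: ht => u u0 ->; rewrite torus_diag //.
have /diag_mxP [y ->] : is_diag_mx Y by [].
exact: diag_mxC.
Qed.

Definition chi u b : K := \prod_i u i ^ pairing b (coroot R (simple i)).

Lemma chi_neq0 u b : (forall i, u i != 0) -> chi u b != 0.
Proof. by move=> u0; apply/prodf_neq0 => i _; rewrite expfz_neq0. Qed.

Lemma X_weight b p q i : b \in roots R -> X b p q != 0 ->
  kk i p - kk i q = pairing b (coroot R (simple i)).
Proof.
move=> rb nz; apply: (intr_inj_char0 natK); rewrite rmorphB /= -!hkk.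
apply: (mulIf nz); rewrite -lie_diag.
  by rewrite (lie_hx chX) ?simple_root // mxE.
exact/(cartan_diag chX)/(hx_cartan chX)/simple_root.
Qed.

Lemma Ad_torus_X u b : (forall i, u i != 0) -> b \in roots R ->
  Ad (torus_elt X u) (X b) = chi u b *: X b.
Proof.
move=> u0 rb; have [_ e] := torus_unit_inv u0; rewrite /Ad e !torus_diag // => [|i]; last first.
  by rewrite invr_eq0.
rewrite mul_diag_mx mul_mx_diag; apply/matrixP=> p q; rewrite !mxE.
case: (eqVneq (X b p q) 0) => [->|nz]; first by rewrite !(mulr0, mul0r).
rewrite mulrAC; congr (_ * _); rewrite -big_split /chi; apply: eq_bigr => i _ /=.
by rewrite exprz_inv -expfzDr // (X_weight _ rb nz).
Qed.

Lemma Ad_torus t b : torus X t -> b \in roots R -> exists2 c, c != 0 & Ad t (X b) = c *: X b.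
Proof.
by case=> u u0 -> rb; exists (chi u b); [exact: chi_neq0|exact: Ad_torus_X].
Qed.

Definition hcoord i y : 'I_l -> K := fun k => if k == i then y else 1.

Lemma hcoord_neq0 i y k : y != 0 -> hcoord i y k != 0.
Proof. by rewrite /hcoord; case: (k =P i) => // _ _; apply: oner_neq0. Qed.

Lemma chi_hcoord i y b : chi (hcoord i y) b = y ^ pairing b (coroot R (simple i)).
Proof.
rewrite /chi (bigD1 i) //= /hcoord eqxx big1 ?mulr1 // => k /negPf ->.
by rewrite exp1rz.
Qed.

Lemma torus_hroot i y : y != 0 -> torus X (hroot X (simple i) y).
Proof.
move=> y0; exists (hcoord i y) => [k|]; first exact: hcoord_neq0.
rewrite torus_diag => [|k]; last exact: hcoord_neq0.
rewrite hdiag //; congr diag_mx; apply/rowP=> p; rewrite !mxE (bigD1 i) //= /hcoord eqxx.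
by rewrite big1 ?mulr1 // => k /negPf ->; rewrite exp1rz.
Qed.

Lemma exp2_inj : injective (fun m : int => (2%:R : K) ^ m).
Proof.
have n2 : 2%:R != 0 :> K := natK 1.
have key m : (2%:R : K) ^ m = 1 -> m = 0.
  wlog: m / 0 <= m => [wl h|].
    have [/wl|m0] := lerP 0 m; first exact.
    apply/eqP; rewrite -oppr_eq0; apply/eqP/wl; first by rewrite oppr_ge0 ltW.
    by rewrite -invr_expz h invr1.
  case: m => // m _; rewrite -exprnP -natrX -[1]/(1%:R) => /eqP.
  rewrite !pmulrn => /eqP/(intr_inj_char0 natK) [] e.
  by case: m e => // m; rewrite expnS; lia.
move=> p q /= e; apply/eqP; rewrite -subr_eq0; apply/eqP/key.
by rewrite expfzDr // -invr_expz e mulfV // expfz_neq0.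
Qed.

(** Since 2 has infinite order in characteristic zero, two characters that agree at all
    $\alpha_i^\vee(2)$ have equal pairings with all simple coroots. *)
Lemma chi_separates a b : a != b -> exists i, chi (hcoord i 2%:R) a != chi (hcoord i 2%:R) b.
Proof.
move=> ab; have [i hi] : exists i, pairing a (coroot R (simple i)) != pairing b (coroot R (simple i)).
  apply/existsP; apply: contraNT ab => /existsPn h.
  by apply/eqP/(eq_root_pairing (R := R)) => k; apply/eqP; move: (h k); rewrite negbK.
exists i; rewrite !chi_hcoord; apply: contra hi => /eqP e; apply/eqP.
exact: exp2_inj.
Qed.

Lemma chi_separates1 a : a \in roots R -> exists i, chi (hcoord i 2%:R) a != 1.
Proof.
move=> ra; have [i] := chi_separates (root_neq0 ra); exists i; move: p.
by rewrite [X in _ != X]chi_hcoord -[0 : 'cV_l](scale0r 0) pairingZ mul0r expr0z.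
Qed.

Lemma torus_elt_hcoord i : torus X (torus_elt X (hcoord i 2%:R)).
Proof. by exists (hcoord i 2%:R) => // k; apply: hcoord_neq0; exact: (natK 1). Qed.

Lemma torus_weight_root Z b : b \in roots R -> lspan (full_gen R H X predT) Z ->
  (forall u, (forall i, u i != 0) -> Ad (torus_elt X u) Z = chi u b *: Z) ->
  exists y, Z = y *: X b.
Proof.
move=> rb hZ wZ; have n2 : 2%:R != 0 :> K := natK 1.
apply: (@eigen_root _ _ _ _ _ _ chX natK 'I_l predT
  (fun i => Ad (torus_elt X (hcoord i 2%:R))) (fun=> 1) (fun i => chi (hcoord i 2%:R))) => //.
- by move=> i x A B; rewrite AdD AdZ.
- move=> i j; rewrite scale1r Ad_torus_diag ?(chev_diag chX) //; exact: torus_elt_hcoord.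
- by move=> i a ra; apply: Ad_torus_X => // k; exact: hcoord_neq0.
- by move=> a ra ab; have [i hi] := chi_separates ab; exists i.
- by have [i hi] := chi_separates1 rb; exists i; rewrite eq_sym.
- by move=> i; apply: wZ => k; exact: hcoord_neq0.
Qed.

Lemma torus_weight_cartan Z : lspan (full_gen R H X predT) Z ->
  (forall t, torus X t -> Ad t Z = Z) -> lspan (cartan_gen H) Z.
Proof.
move=> hZ wZ; have n2 : 2%:R != 0 :> K := natK 1.
apply: (@eigen_cartan _ _ _ _ _ _ chX natK 'I_l predT
  (fun i => Ad (torus_elt X (hcoord i 2%:R))) (fun i => chi (hcoord i 2%:R))) => //.
- by move=> i x A B; rewrite AdD AdZ.
- move=> i j; rewrite Ad_torus_diag ?(chev_diag chX) //; exact: torus_elt_hcoord.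
- by move=> i a ra; apply: Ad_torus_X => // k; exact: hcoord_neq0.
- by move=> a ra; exact: chi_separates1.
- by move=> i; apply: wZ; exact: torus_elt_hcoord.
Qed.

End Torus.

(** * Words in root elements *)

Notation wd := (word X).

Lemma word_uroot a x : wd [:: (a, x)] = uroot X a x.
Proof. by rewrite word_cons word_nil mulmx1. Qed.

Lemma word_unit ws : letters_in (roots R) ws ->
  wd ws \in unitmx /\ invmx (wd ws) = wd (word_inv ws).
Proof.
move=> h; apply: unit_invmx_eq; apply: (wordV natK _ h).
exact: (X_nilpotent chX natK).
Qed.

Lemma Ad_word g (c : 'cV[int]_l -> K) (pi : 'cV[int]_l -> 'cV[int]_l) ws :
  g \in unitmx -> (forall w, w \in ws -> Ad g (X w.1) = c w.1 *: X (pi w.1)) ->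
  Ad g (wd ws) = wd [seq (pi w.1, c w.1 * w.2) | w <- ws].
Proof.
move=> gu; elim: ws => [|[a x] ws ih] h.
  by rewrite word_nil /Ad mulmx1 mulmxV.
rewrite /= !word_cons Ad_mul // ih => [|w wws]; last by apply: h; rewrite inE wws orbT.
by rewrite Ad_mexp // AdZ (h (a, x)) ?mem_head // scalerA mulrC.
Qed.

Lemma Ad_word_ex g (pi : 'cV[int]_l -> 'cV[int]_l) ws :
  g \in unitmx -> (forall w, w \in ws -> exists c, Ad g (X w.1) = c *: X (pi w.1)) ->
  exists2 ws', Ad g (wd ws) = wd ws' & [seq w.1 | w <- ws'] = [seq pi w.1 | w <- ws].
Proof.
move=> gu; elim: ws => [|[a x] ws ih] h.
  by exists [::]; rewrite // word_nil /Ad mulmx1 mulmxV.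
have [|ws' e1 e2] := ih; first by move=> w wws; apply: h; rewrite inE wws orbT.
have [c ec] := h (a, x) (mem_head _ _).
exists ((pi a, x * c) :: ws'); last by rewrite /= e2.
by rewrite !word_cons Ad_mul // e1 Ad_mexp // AdZ ec scalerA.
Qed.

Lemma Ad_word_full S ws Y : closed_roots R S -> all (fun w => (w.1 \in roots R) && S w.1) ws ->
  lspan (full_gen R H X S) Y -> lspan (full_gen R H X S) (Ad (wd ws) Y).
Proof.
move=> cl; elim: ws => [|[a x] ws ih]; first by rewrite word_nil Ad1.
move=> /andP [/andP [/= ra Sa] hws] hY; rewrite word_cons AdM; last 2 first.
- exact: (uroot_unit chX natK x ra).
- by case: (word_unit (ws := ws)) => //; apply: sub_all hws => w /andP [].
by apply: (Ad_uroot_full chX natK) => //; apply: ih.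
Qed.

(* A chain is obtained from any enumeration by a rank such that the sum of two
   roots has larger rank than one of them. *)
Lemma rank_chain L (rank : 'cV[int]_l -> nat) : {subset L <= roots R} ->
  pairwise (fun a b => rank a <= rank b)%N L ->
  (forall a b, a \in L -> b \in L -> a + b != 0) ->
  (forall a b, a \in L -> b \in L -> a + b \in roots R ->
     a + b \in L /\ (minn (rank a) (rank b) < rank (a + b)%R)%N) ->
  chain X L.
Proof.
elim: L => //= a L ih LR /andP [/allP aL pL] nz cl.
have inL b : b \in L -> b \in a :: L by rewrite inE orbC => ->.
split=> [b bL|].
  case: (boolP (a + b \in roots R)) => rab.
    have [in_ab lt] := cl a b (mem_head _ _) (inL _ bL) rab.
    have [N ->] := chev_sum chX (LR _ (mem_head _ _)) (LR _ (inL _ bL)) rab.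
    apply: lspanZ; apply: lspan_in; exists (a + b) => //.
    move: in_ab; rewrite inE => /predU1P [e|//]; move: lt (aL _ bL); rewrite e /=; lia.
  rewrite (chev_zero chX (LR _ (mem_head _ _)) (LR _ (inL _ bL)) _ rab); first exact: lspan0.
  exact: (nz _ _ (mem_head _ _) (inL _ bL)).
apply: ih => // [b bL|b c bL cL|b c bL cL rbc].
- by apply: LR; apply: inL.
- by apply: nz; apply: inL.
have [in_bc lt] := cl b c (inL _ bL) (inL _ cL) rbc; split=> //.
move: in_bc; rewrite inE => /predU1P [e|//]; move: lt (aL _ bL) (aL _ cL); rewrite e; lia.
Qed.

End TorusWords.

(** * Heights of roots *)

Section HeightRank.
Variables (l : nat) (R : root_system l).
Implicit Types (a b : 'cV[int]_l).

Definition rank a : nat := absz (height a).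

Lemma heightD a b : height (a + b) = height a + height b.
Proof. by rewrite /height -big_split; apply: eq_bigr => i _; rewrite mxE. Qed.

Lemma heightN a : height (- a) = - height a.
Proof. by rewrite /height -sumrN; apply: eq_bigr => i _; rewrite mxE. Qed.

Lemma rankN a : rank (- a) = rank a.
Proof. by rewrite /rank heightN abszN. Qed.

Lemma height_pos a : a \in roots R -> nonneg_root a -> 0 < height a.
Proof.
move=> ra /forallP na; rewrite lt_def sumr_ge0 ?andbT //.
apply: contra (root_neq0 ra) => /eqP e; apply/eqP/colP=> i; rewrite mxE.
by apply/eqP; move: e; rewrite /height => /eqP; rewrite psumr_eq0 // => /allP /(_ i (mem_index_enum _)).
Qed.

Lemma rank_addN a b : a \in roots R -> b \in roots R -> nonpos_root a -> nonpos_root b ->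
  (rank a < rank (a + b)%R)%N.
Proof.
move=> ra rb na nb; have := height_pos (roots_opp ra); have := height_pos (roots_opp rb).
rewrite !nonneg_rootN => /(_ nb) + /(_ na); rewrite /rank !heightN heightD; lia.
Qed.

Lemma neg_add_neq0 a b : a \in roots R -> b \in roots R -> nonpos_root a -> nonpos_root b ->
  a + b != 0.
Proof.
move=> ra rb na nb; apply/eqP=> e; have := rank_addN ra rb na nb.
by rewrite e [X in (_ < X)%N]/rank /height big1 // => i _; rewrite mxE.
Qed.

Lemma nonpos_rootD a b : nonpos_root a -> nonpos_root b -> nonpos_root (a + b).
Proof.
move=> /forallP na /forallP nb; apply/forallP=> i; rewrite mxE -oppr_ge0 opprD.
by apply: addr_ge0; rewrite oppr_ge0.
Qed.

End HeightRank.

(** * Polynomial functions on matrices *)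

Lemma mpoly_ring_ind (K : comNzRingType) N (P : {mpoly K[N]} -> Prop) :
  (forall c, P c%:MP) -> (forall i, P 'X_i) ->
  (forall f g, P f -> P g -> P (f + g)) -> (forall f g, P f -> P g -> P (f * g)) ->
  forall f, P f.
Proof.
move=> PC PX PD PM f; elim/mpolyind: f => [|c m f _ _ Pf].
  by rewrite -mpolyC0; apply: PC.
apply: (PD) => //; rewrite -mul_mpolyC; apply: (PM) => //; rewrite mpolyXE_id.
elim/big_ind: _ => [|g1 g2|i _]; [by rewrite -mpolyC1; apply: (PC)|exact: (PM)|].
elim: (m i) => [|k ih]; first by rewrite expr0 -mpolyC1; apply: PC.
by rewrite exprS; apply: (PM).
Qed.

Lemma mderiv_mpolyX (K : comNzRingType) N (i q : 'I_N) :
  ('X_i : {mpoly K[N]})^`M(q) = (q == i)%:R.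
Proof.
rewrite mderivX mnm1E eq_sym; case: eqP => [->|_]; last by rewrite scale0r.
by rewrite scale1r -mpolyX0; congr 'X_[_]; apply/mnmP=> k; rewrite mnmBE mnm0E subnn.
Qed.

Section PolyFun.
Variables (K : fieldType) (n : nat).
Implicit Types (phi : 'M[K]_n -> K) (F : {mpoly K[n * n]}) (g A B : 'M[K]_n).

Definition polyfun phi := exists F, forall g, phi g = eval_mx F g.

Lemma polyfun_const c : polyfun (fun _ => c).
Proof. by exists c%:MP => g; rewrite /eval_mx mevalC. Qed.

Lemma polyfunD phi psi : polyfun phi -> polyfun psi -> polyfun (fun g => phi g + psi g).
Proof. by move=> [F hF] [G hG]; exists (F + G) => g; rewrite /eval_mx mevalD hF hG. Qed.

Lemma polyfunM phi psi : polyfun phi -> polyfun psi -> polyfun (fun g => phi g * psi g).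
Proof. by move=> [F hF] [G hG]; exists (F * G) => g; rewrite /eval_mx mevalM hF hG. Qed.

Lemma polyfun_ext phi psi : phi =1 psi -> polyfun phi -> polyfun psi.
Proof. by move=> e [F hF]; exists F => g; rewrite -e. Qed.

Lemma polyfun_sum (I : Type) (r : seq I) (phi : I -> 'M[K]_n -> K) :
  (forall i, polyfun (phi i)) -> polyfun (fun g => \sum_(i <- r) phi i g).
Proof.
move=> h; elim: r => [|i r ih].
  by apply: polyfun_ext (polyfun_const 0) => g; rewrite big_nil.
by apply: polyfun_ext (polyfunD (h i) ih) => g; rewrite big_cons.
Qed.

Lemma polyfun_entry i j : polyfun (fun g => g i j).
Proof. by exists 'X_(mxvec_index i j) => g; rewrite /eval_mx mevalXU mxvecE. Qed.

Lemma polyfun_linear_entry A B i j : polyfun (fun g => (A *m g *m B) i j).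
Proof.
apply: (@polyfun_ext (fun g => \sum_k \sum_m (A i m * g m k) * B k j)).
  by move=> g; rewrite mxE; apply: eq_bigr => k _; rewrite mxE mulr_suml.
apply: polyfun_sum => k; apply: polyfun_sum => m; apply: polyfunM; last exact: polyfun_const.
by apply: polyfunM; [exact: polyfun_const|exact: polyfun_entry].
Qed.

Lemma polyfun_comp F (e : 'I_(n * n) -> 'M[K]_n -> K) :
  (forall q, polyfun (e q)) -> polyfun (fun g => F.@[fun q => e q g]).
Proof.
move=> he; elim/mpoly_ring_ind: F => [c|i|f1 f2 h1 h2|f1 f2 h1 h2].
- by apply: polyfun_ext (polyfun_const c) => g; rewrite mevalC.
- by apply: polyfun_ext (he i) => g; rewrite mevalXU.
- by apply: polyfun_ext (polyfunD h1 h2) => g; rewrite mevalD.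
- by apply: polyfun_ext (polyfunM h1 h2) => g; rewrite mevalM.
Qed.

Lemma polyfun_mulmx F A B : polyfun (fun g => eval_mx F (A *m g *m B)).
Proof.
apply: polyfun_comp => q; case/mxvec_indexP: q => i j.
by apply: polyfun_ext (polyfun_linear_entry A B i j) => g; rewrite mxvecE.
Qed.

Lemma polyfun_mulmxl F A : polyfun (fun g => eval_mx F (A *m g)).
Proof. by apply: polyfun_ext (polyfun_mulmx F A 1%:M) => g; rewrite mulmx1. Qed.

Lemma mxvec_entry A q : exists i j, forall B, mxvec B 0 q = B i j.
Proof. by case/mxvec_indexP: q => i j; exists i, j => B; rewrite mxvecE. Qed.

(** Links the formal partial derivatives in [lie_points] with polynomials in one variable: the
    linear coefficient along a line is a directional derivative. *)
Lemma line_restriction F A B : exists2 p : {poly K},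
  forall t, eval_mx F (A + t *: B) = p.[t] &
  p^`().[0] = \sum_q eval_mx F^`M(q) A * mxvec B 0 q.
Proof.
elim/mpoly_ring_ind: F => [c|i|f1 f2 [p1 h1 d1] [p2 h2 d2]|f1 f2 [p1 h1 d1] [p2 h2 d2]].
- exists c%:P => [t|]; first by rewrite hornerC /eval_mx mevalC.
  by rewrite derivC horner0 big1 // => q _; rewrite mderivC /eval_mx meval0 mul0r.
- have [k [j hkj]] := mxvec_entry A i.
  exists ((A k j)%:P + (B k j)%:P * 'X) => [t|].
    by rewrite /eval_mx mevalXU hkj !hornerE !mxE mulrC.
  rewrite derivD derivC derivM derivC derivX mul0r add0r mulr1 add0r hornerC.
  rewrite (bigD1 i) //= big1 ?addr0 => [|q qi].
    by rewrite mderiv_mpolyX eqxx /eval_mx meval1 mul1r hkj.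
  by rewrite mderiv_mpolyX (negPf qi) /eval_mx meval0 mul0r.
- exists (p1 + p2) => [t|]; first by rewrite hornerD -h1 -h2 /eval_mx mevalD.
  rewrite derivD hornerD d1 d2 -big_split; apply: eq_bigr => q _.
  by rewrite mderivD /eval_mx mevalD mulrDl.
exists (p1 * p2) => [t|]; first by rewrite hornerM -h1 -h2 /eval_mx mevalM.
have e1 : p1.[0] = eval_mx f1 A by rewrite -h1 scale0r addr0.
have e2 : p2.[0] = eval_mx f2 A by rewrite -h2 scale0r addr0.
rewrite derivM hornerD !hornerM d1 d2 e1 e2 mulr_suml mulr_sumr -big_split.
apply: eq_bigr => q _; rewrite mderivM /eval_mx /= mevalD !mevalM; ring.
Qed.

End PolyFun.

Lemma map_mpoly_idfun (K : fieldType) N (f : {mpoly K[N]}) : map_mpoly idfun f = f.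
Proof. by apply/mpolyP=> m; rewrite mcoeff_map_mpoly. Qed.

(** * Polynomials determined by their values at infinitely many points *)

Section CharZeroPoly.
Variable K : fieldType.
Hypothesis natK : forall k, k.+1%:R != 0 :> K.

Lemma natr_inj_char0 (i j : nat) : i%:R = j%:R :> K -> i = j.
Proof.
wlog ij : i j / (i <= j)%N => [wl|] e.
  by case: (leqP i j) => h; [exact: wl|apply/esym/wl => //; exact: ltnW].
apply/eqP; rewrite eqn_leq ij leqNgt; apply/negP => lt.
have := natK (j - i).-1; rewrite prednK ?subn_gt0 // natrB // e subrr eqxx.
by [].
Qed.

Lemma poly_eq0_infinite (p : {poly K}) (x : nat -> K) : injective x ->
  (forall k, p.[x k] = 0) -> p = 0.
Proof.
move=> xi h; apply/eqP; apply: contraT => p0.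
have := max_poly_roots (rs := [seq x k | k <- iota 0 (size p)]) p0.
rewrite size_map size_iota ltnn map_inj_uniq // iota_uniq => /(_ _ isT) -> //.
by apply/allP=> y /mapP [k _ ->]; apply/rootP.
Qed.

Lemma poly_eq_infinite (p q : {poly K}) : (forall t, p.[t] = q.[t]) -> p = q.
Proof.
move=> h; apply/eqP; rewrite -subr_eq0; apply/eqP.
apply: (@poly_eq0_infinite _ (fun k => k%:R)); first exact: natr_inj_char0.
by move=> k; rewrite hornerD hornerN h subrr.
Qed.

End CharZeroPoly.

(** The pullback of [f] under conjugation by [g] again vanishes on the group, and its restriction to
    $1+tY$ is the restriction of [f] to $1+t\,\mathrm{Ad}_gY$. The linear coefficients therefore
    agree. *)
Lemma lie_points_conj (C : fieldType) n (G : 'M[C]_n -> Prop) g Y :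
  (forall k, k.+1%:R != 0 :> C) -> is_subgroup G -> G g ->
  lie_points idfun G Y -> lie_points idfun G (Ad g Y).
Proof.
move=> natC [Gu G1 Gm Gi] hg hY f hf.
have [f' hf'] := polyfun_mulmx f g (invmx g).
have vf' : vanishes_on G f'.
  by move=> h hh; rewrite -hf' hf //; apply: (Gm) (Gi _ hg); apply: Gm.
have [p hp dp] := line_restriction f' 1%:M Y.
have [q hq dq] := line_restriction f 1%:M (Ad g Y).
have pq : p = q.
  apply: (poly_eq_infinite natC) => t; rewrite -hp -hq -hf'; congr (eval_mx _ _).
  by rewrite mulmxDr mulmxDl mulmx1 mulmxV ?Gu // /Ad -scalemxAr -scalemxAl.
have := hY f' vf'.
under eq_bigr do rewrite map_mpoly_idfun.
by under [in X in _ -> X]eq_bigr do rewrite map_mpoly_idfun; rewrite -dp -dq pq.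
Qed.

(** * Laurent functions of one variable *)

Section LaurentFun.
Variables (K : fieldType) (n : nat).
Hypothesis natK : forall k, k.+1%:R != 0 :> K.
Implicit Types (phi psi : K -> K).

Definition laurent_fun phi := exists N (p : {poly K}),
  forall x, x != 0 -> x ^+ N * phi x = p.[x].

Lemma laurent_fun_const c : laurent_fun (fun _ => c).
Proof. by exists 0%N, c%:P => x _; rewrite hornerC expr0 mul1r. Qed.

Lemma laurent_funD phi psi : laurent_fun phi -> laurent_fun psi ->
  laurent_fun (fun x => phi x + psi x).
Proof.
move=> [N [p hp]] [M [q hq]]; exists (N + M)%N, ('X^M * p + 'X^N * q) => x x0.
by rewrite hornerD !hornerM !hornerXn -hp // -hq // exprD; ring.
Qed.

Lemma laurent_funM phi psi : laurent_fun phi -> laurent_fun psi ->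
  laurent_fun (fun x => phi x * psi x).
Proof.
move=> [N [p hp]] [M [q hq]]; exists (N + M)%N, (p * q) => x x0.
by rewrite hornerM -hp // -hq // exprD; ring.
Qed.

Lemma laurent_fun_ext phi psi : phi =1 psi -> laurent_fun phi -> laurent_fun psi.
Proof. by move=> e [N [p h]]; exists N, p => x x0; rewrite -e h. Qed.

Lemma laurent_fun_sum (I : Type) (r : seq I) (phi : I -> K -> K) :
  (forall i, laurent_fun (phi i)) -> laurent_fun (fun x => \sum_(i <- r) phi i x).
Proof.
move=> h; elim: r => [|i r ih].
  by apply: laurent_fun_ext (laurent_fun_const 0) => x; rewrite big_nil.
by apply: laurent_fun_ext (laurent_funD (h i) ih) => x; rewrite big_cons.
Qed.

Lemma laurent_fun_eval F (M : K -> 'M[K]_n) (g : 'M[K]_n) :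
  (forall i j, laurent_fun (fun x => M x i j)) -> laurent_fun (fun x => eval_mx F (M x *m g)).
Proof.
move=> hM; elim/mpoly_ring_ind: F => [c|q|f1 f2 h1 h2|f1 f2 h1 h2].
- by apply: laurent_fun_ext (laurent_fun_const c) => x; rewrite /eval_mx mevalC.
- have [i [j hq]] := mxvec_entry g q.
  apply: (@laurent_fun_ext (fun x => \sum_k M x i k * g k j)).
    by move=> x; rewrite /eval_mx mevalXU hq mxE.
  by apply: laurent_fun_sum => k; apply: laurent_funM => //; exact: laurent_fun_const.
- by apply: laurent_fun_ext (laurent_funD h1 h2) => x; rewrite /eval_mx mevalD.
- by apply: laurent_fun_ext (laurent_funM h1 h2) => x; rewrite /eval_mx mevalM.
Qed.

(** The positive integers are dense in the punctured line. This carries information at integral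
    parameters over to parameters in $\mathcal E$. *)
Lemma laurent_fun_eq0 phi x : laurent_fun phi -> (forall k, phi k.+1%:R = 0) -> x != 0 -> phi x = 0.
Proof.
move=> [N [p hp]] h x0; apply: (mulfI (expf_neq0 N x0)); rewrite hp // mulr0.
suff -> : p = 0 by rewrite horner0.
apply: (@poly_eq0_infinite _ _ (fun k => k.+1%:R)).
  by move=> i j /(natr_inj_char0 natK) [].
by move=> k; rewrite -hp // h mulr0.
Qed.

End LaurentFun.

(** The coefficients of [f] are constants, so the chain rule only differentiates the entries of
    [g]. *)
Lemma der_eval_mx (C E : fieldType) (iota : {rmorphism C -> E}) (d : E -> E) n
    (f : {mpoly C[n * n]}) (g : 'M[E]_n) :
  derivation d -> (forall a, d (iota a) = 0) ->
  d (eval_mx (map_mpoly iota f) g) =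
  \sum_q eval_mx (map_mpoly iota f^`M(q)) g * mxvec (map_mx d g) 0 q.
Proof.
move=> [dD dM] dC; elim/mpoly_ring_ind: f => [c|i|f1 f2 h1 h2|f1 f2 h1 h2].
- rewrite map_mpolyC /eval_mx mevalC dC big1 // => q _.
  by rewrite mderivC raddf0 meval0 mul0r.
- have [k [j hkj]] := mxvec_entry g i.
  rewrite map_mpolyX /eval_mx mevalXU hkj (bigD1 i) //= big1 ?addr0 => [|q qi].
    by rewrite mderiv_mpolyX eqxx rmorph1 meval1 mul1r hkj mxE.
  by rewrite mderiv_mpolyX (negPf qi) raddf0 meval0 mul0r.
- rewrite raddfD /eval_mx /= mevalD dD h1 h2 -big_split; apply: eq_bigr => q _.
  by rewrite mderivD raddfD /eval_mx /= mevalD mulrDl.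
rewrite rmorphM /eval_mx /= mevalM dM h1 h2 mulr_suml mulr_sumr -big_split.
apply: eq_bigr => q _; rewrite mderivM raddfD /= !rmorphM /eval_mx /= mevalD !mevalM mulrDl.
by rewrite mulrA [X in X + _]mulrAC.
Qed.

(** * The parabolic subset P_J *)

Section NegativeWords.
Variables (K : fieldType) (l n : nat) (R : root_system l).
Variables (H : 'I_l -> 'M[K]_n) (X : 'cV[int]_l -> 'M[K]_n).
Hypotheses (chX : chevalley R H X) (natK : forall k, k.+1%:R != 0 :> K).
Notation wd := (word X).
Implicit Types (ws : seq ('cV[int]_l * K)) (g : 'M[K]_n).

Definition neg_word ws := all (fun w => neg_root R w.1) ws.

Lemma neg_word_cat ws1 ws2 : neg_word (ws1 ++ ws2) = neg_word ws1 && neg_word ws2.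
Proof. exact: all_cat. Qed.

Lemma neg_word_roots ws : neg_word ws -> letters_in (roots R) ws.
Proof. by apply: sub_all => w /andP []. Qed.

Lemma neg_unipotentP g : neg_unipotent R X g <-> exists2 ws, neg_word ws & g = wd ws.
Proof.
split=> [|[ws]].
  elim=> [|h [a [x [na ->]]]|h1 h2 _ [ws1 n1 ->] _ [ws2 n2 ->]|h _ [ws nws ->]].
  - by exists [::]; rewrite // word_nil.
  - by exists [:: (a, x)]; rewrite ?word_uroot //= /neg_word /= na.
  - by exists (ws1 ++ ws2); rewrite ?word_cat // neg_word_cat n1.
  exists (word_inv ws); first by rewrite /neg_word all_rev all_map.
  by case: (word_unit chX natK (neg_word_roots nws)).
elim: ws g => [|[a x] ws ih] g; first by move=> _ ->; rewrite word_nil; apply: gen_one.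
move=> /= /andP [na nws] ->; rewrite word_cons; apply: gen_mul; last exact: ih.
by apply: gen_in; exists a, x.
Qed.

Lemma neg_word_inv ws : neg_word (word_inv ws) = neg_word ws.
Proof. by rewrite /neg_word all_rev all_map. Qed.

End NegativeWords.

Section Parabolic.
Variables (K : fieldType) (l n : nat) (R : root_system l).
Variables (H : 'I_l -> 'M[K]_n) (X : 'cV[int]_l -> 'M[K]_n).
Hypotheses (chX : chevalley R H X) (natK : forall k, k.+1%:R != 0 :> K).
Variable kk : 'I_l -> 'I_n -> int.
Hypothesis hkk : forall i p, hx X (simple i) p p = (kk i p)%:~R.
Hypothesis hdiag : forall i x, x != 0 -> hroot X (simple i) x = diag_mx (\row_p x ^ kk i p).
Variable G : 'M[K]_n -> Prop.
Hypothesis Gsub : is_subgroup G.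
Hypothesis GLie : forall g Y, G g -> lspan (full_gen R H X predT) Y ->
  lspan (full_gen R H X predT) (Ad g Y).
Hypothesis GU : forall a x, a \in roots R -> G (uroot X a x).
Hypothesis GT : forall g, G g ->
  (forall a, a \in roots R -> exists c, Ad g (X a) = c *: X a) -> torus X g.
Variable nw : 'M[int]_l -> 'M[K]_n.
Hypothesis hnw : weyl_representatives R X G nw.

Notation wd := (word X).
Implicit Types (a b : 'cV[int]_l) (g h m t : 'M[K]_n) (w : 'M[int]_l) (s : seq 'I_l).
Implicit Types (J : {set 'I_l}) (ws : seq ('cV[int]_l * K)).

Let Gu g : G g -> g \in unitmx. Proof. by case: Gsub => h _ _ _; apply: h. Qed.
Let G1 : G 1%:M. Proof. by case: Gsub. Qed.
Let GM g h : G g -> G h -> G (g *m h). Proof. by case: Gsub => _ _ + _; apply. Qed.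
Let GV g : G g -> G (invmx g). Proof. by case: Gsub => _ _ _; apply. Qed.

Let tunit := torus_unit hdiag.

Lemma weyl_weyl_word s : weyl R (weyl_word R s).
Proof. by exists s => //; apply/allP=> i _; apply: in_setT. Qed.

(** Membership in the coset $n(w)T$, phrased through the root spaces, which makes products and
    inverses easy to follow. *)
Definition monomial_for g w := G g /\
  forall a, a \in roots R -> exists2 c, c != 0 & Ad g (X a) = c *: X (w *m a).

Lemma X_coef_neq0 a b c g : a \in roots R -> g \in unitmx -> Ad g (X a) = c *: X b -> c != 0.
Proof.
move=> ra gu e; apply/eqP=> c0; case/eqP: (chev_neq0 chX ra).
by rewrite -(AdK (X a) gu) e c0 scale0r /Ad mulmx0 mul0mx.
Qed.

(** The character condition in [weyl_representatives] says that the conjugate of $X_a$ has torus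
    weight $wa$, and in the Lie algebra only the multiples of $X_{wa}$ have this weight. *)
Lemma nw_monomial s : monomial_for (nw (weyl_word R s)) (weyl_word R s).
Proof.
have [Gn nT nroot] := hnw (weyl_weyl_word s); have nu := Gu Gn.
split=> // a ra; have rb := weyl_word_root s ra; set w := weyl_word R s.
suff [c ec] : exists c, Ad (nw w) (X a) = c *: X (w *m a).
  by exists c => //; exact: X_coef_neq0 ec.
apply: (torus_weight_root chX natK hkk hdiag) => // [|u u0].
  by apply: GLie => //; apply: lspan_in; right; exists a; rewrite // ra.
have tt : torus X (torus_elt X u) by exists u.
have := nroot _ _ _ tt ra (Ad_torus_X chX natK hkk hdiag u0 rb).
rewrite /root_value -/w -/(Ad _ _) => e.
rewrite -AdZ -e -!AdM // ?unitmx_mul ?unitmx_inv ?nu ?tunit //.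
by rewrite !mulmxA mulmxV // mul1mx.
Qed.

Lemma monomialM g h w w' : monomial_for g w -> monomial_for h w' ->
  (forall a, a \in roots R -> w' *m a \in roots R) -> monomial_for (g *m h) (w *m w').
Proof.
move=> [Gg hg] [Gh hh] hw'; split=> [|a ra]; first exact: GM.
have [c c0 ec] := hh a ra; have [c' c'0 ec'] := hg _ (hw' _ ra).
exists (c * c'); first by rewrite mulf_neq0.
by rewrite AdM ?Gu // ec AdZ ec' scalerA mulmxA.
Qed.

Lemma monomialV g w w' : monomial_for g w -> w *m w' = 1%:M ->
  (forall a, a \in roots R -> w' *m a \in roots R) -> monomial_for (invmx g) w'.
Proof.
move=> [Gg hg] e hw'; split=> [|a ra]; first exact: GV.
have [c c0 ec] := hg _ (hw' _ ra); exists c^-1; first by rewrite invr_eq0.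
apply: (scalerI c0); rewrite scalerA mulfV // scale1r -AdZ.
by move: ec; rewrite mulmxA e mul1mx => <-; rewrite AdK ?Gu.
Qed.

Lemma torus_of_monomial g : monomial_for g 1%:M -> torus X g.
Proof.
by case=> Gg hg; apply: GT => // a /hg [c _ ->]; exists c; rewrite mul1mx.
Qed.

Lemma uroot_hroot_G a x : a \in roots R -> G (hroot X a x).
Proof.
move=> ra; have rN := roots_opp ra.
by do ?[apply: (GM)]; apply: GU.
Qed.

Lemma torus_monomial t : torus X t -> monomial_for t 1%:M.
Proof.
move=> ht; split=> [|a ra]; last first.
  by have [c c0 e] := Ad_torus chX natK hkk hdiag ht ra; exists c; rewrite // mul1mx.
case: ht => u u0 ->; rewrite /torus_elt; elim/big_ind: _ => [|g h|i _]; first exact: G1.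
  exact: GM.
by apply: uroot_hroot_G; apply: simple_root.
Qed.

(* Two elements with the same action on the root spaces differ by an element of
   T, because T is its own centraliser in G. *)
Lemma monomial_eq_torus g h s : monomial_for g (weyl_word R s) ->
  monomial_for h (weyl_word R s) -> exists2 t, torus X t & g = h *m t.
Proof.
move=> mg mh; exists (invmx h *m g); last first.
  by rewrite mulmxA mulmxV ?mul1mx //; case: mh => /Gu.
apply: torus_of_monomial; rewrite -(weyl_word_Krev R s); apply: monomialM => //.
  apply: monomialV mh _ _; first exact: weyl_word_revK.
  by move=> a; apply: weyl_word_root.
by move=> a; apply: weyl_word_root.
Qed.

Lemma monomial_conj_torus g s t : monomial_for g (weyl_word R s) -> torus X t ->
  torus X (Ad g t).
Proof.
move=> mg tt; apply: torus_of_monomial.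
rewrite -(weyl_word_revK R s); apply: monomialM => [||a]; last exact: weyl_word_root.
  rewrite -[weyl_word R s]mulmx1; apply: monomialM => // [|a]; first exact: torus_monomial.
  by rewrite mul1mx.
apply: monomialV mg _ _; first exact: weyl_word_revK.
by move=> a; apply: weyl_word_root.
Qed.

Lemma monomial_uroot g w a x : monomial_for g w -> a \in roots R ->
  exists2 y, Ad g (uroot X a x) = uroot X (w *m a) y & (x != 0 -> y != 0).
Proof.
move=> [Gg hg] ra; have [c c0 ec] := hg a ra; exists (x * c).
  by rewrite !urootE Ad_mexp ?Gu // AdZ ec scalerA.
by move=> x0; rewrite mulf_neq0.
Qed.

Lemma monomial_word g w ws : monomial_for g w -> letters_in (roots R) ws ->
  exists2 ws', Ad g (wd ws) = wd ws' & [seq u.1 | u <- ws'] = [seq w *m u.1 | u <- ws].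
Proof.
move=> [Gg hg] hws; apply: (Ad_word_ex (pi := mulmx w)); first exact: Gu.
by move=> u /(allP hws) /hg [c _ e]; exists c.
Qed.

Lemma wroot_monomial a x i : a \in roots R -> x != 0 ->
  reflection a (coroot R a) = simple_reflection R i -> monomial_for (wroot X a x) (simple_reflection R i).
Proof.
move=> ra x0 e; have rN := roots_opp ra; split=> [|b rb].
  by do ?[apply: (GM)]; apply: GU.
have [y ey] := Ad_wroot_root chX natK ra rb x0; exists y; last by rewrite -e.
apply: X_coef_neq0 ey => //; exact: (wroot_unit chX natK).
Qed.

(** The rank one identity below uses [wroot] at $-\alpha_i$, whose reflection has to be recognised
    as $s_i$. *)
Lemma reflection_simpleN i :
  reflection (- simple i) (coroot R (- simple i)) = simple_reflection R i.
Proof.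
have e := coroot_weyl_word (R := R) [:: i] (simple_root R i).
move: e; rewrite /rev /= !weyl_word1 simple_reflection_simple => ->.
rewrite /reflection mulNmx opprK /simple_reflection /reflection.
rewrite mulmxBr mulmx1 [coroot R (simple i) *m (_ *m _)]mulmxA.
rewrite [coroot R (simple i) *m simple i]mx11_scalar -/(pairing _ _) pairing_coroot ?simple_root //.
rewrite mul_scalar_mx scaler_nat mulr2n opprD addNKr mulmxN.
by [].
Qed.

Let negU := neg_unipotentP chX natK.

Lemma neg_borel_word t ws : torus X t -> neg_word R ws -> neg_borel R X (t *m wd ws).
Proof. by move=> ht hws; exists t, (wd ws); split=> //; apply/negU; exists ws. Qed.

Lemma neg_borelP (b : 'M[K]_n) : neg_borel R X b -> exists t ws, [/\ torus X t, neg_word R ws & b = t *m wd ws].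
Proof. by case=> t [u [ht /negU [ws hws ->] ->]]; exists t, ws. Qed.

Lemma neg_borel1 : neg_borel R X 1%:M.
Proof.
rewrite -[1%:M](mulmx1 1%:M) -{2}(word_nil X).
by apply: neg_borel_word => //; exact: (torus_group_one hdiag).
Qed.

Lemma torus_neg_word t ws : torus X t -> neg_word R ws ->
  exists2 ws', neg_word R ws' & t *m wd ws = wd ws' *m t.
Proof.
move=> ht hws; have [ws' e1 e2] := monomial_word (torus_monomial ht) (neg_word_roots hws).
exists ws'; last by rewrite -e1 -mulmx_Ad ?tunit.
rewrite /neg_word -(all_map fst (neg_root R)) e2 all_map; apply: sub_all hws => u /=.
by rewrite mul1mx.
Qed.

Lemma neg_word_torus t ws : torus X t -> neg_word R ws ->
  exists2 ws', neg_word R ws' & wd ws *m t = t *m wd ws'.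
Proof.
move=> ht hws; have [ws' h e] := torus_neg_word (torus_group_inv hdiag ht) hws.
exists ws' => //; have tu := tunit ht.
by rewrite -[wd ws](mulKVmx tu) e -!mulmxA mulVmx // mulmx1.
Qed.

Lemma neg_borelM (b1 b2 : 'M[K]_n) : neg_borel R X b1 -> neg_borel R X b2 -> neg_borel R X (b1 *m b2).
Proof.
move=> /neg_borelP [t1 [ws1 [ht1 h1 ->]]] /neg_borelP [t2 [ws2 [ht2 h2 ->]]].
have [ws' h' e] := neg_word_torus ht2 h1.
have -> : t1 *m wd ws1 *m (t2 *m wd ws2) = (t1 *m t2) *m wd (ws' ++ ws2).
  by rewrite word_cat !mulmxA -(mulmxA t1 _ t2) e !mulmxA.
apply: neg_borel_word; first exact: (torus_group_mul hdiag).
by rewrite neg_word_cat h' h2.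
Qed.

Lemma neg_borel_torus t : torus X t -> neg_borel R X t.
Proof. by move=> ht; rewrite -[t]mulmx1 -(word_nil X); apply: neg_borel_word. Qed.

Lemma neg_borel_neg_word ws : neg_word R ws -> neg_borel R X (wd ws).
Proof.
by move=> h; rewrite -[wd ws]mul1mx; apply: neg_borel_word => //; exact: (torus_group_one hdiag).
Qed.

Lemma neg_borel_uroot a x : neg_root R a -> neg_borel R X (uroot X a x).
Proof. by move=> na; rewrite -word_uroot; apply: neg_borel_neg_word; rewrite /neg_word /= na. Qed.

Variable J : {set 'I_l}.
Notation PJ := (parabolic R X nw J).

Lemma parabolic_mulr g (b : 'M[K]_n) : PJ g -> neg_borel R X b -> PJ (g *m b).
Proof.
move=> [w [b1 [b2 [hw h1 h2 ->]]]] hb; exists w, b1, (b2 *m b); split=> //.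
  exact: neg_borelM.
by rewrite mulmxA.
Qed.

Lemma parabolic_mull g (b : 'M[K]_n) : PJ g -> neg_borel R X b -> PJ (b *m g).
Proof.
move=> [w [b1 [b2 [hw h1 h2 ->]]]] hb; exists w, (b *m b1), b2; split=> //.
  exact: neg_borelM.
by rewrite !mulmxA.
Qed.

Lemma parabolic_monomial g s : all (mem J) s -> monomial_for g (weyl_word R s) -> PJ g.
Proof.
move=> sJ mg; have [t ht ->] := monomial_eq_torus mg (nw_monomial s).
exists (weyl_word R s), 1%:M, t; split; [by exists s|exact: neg_borel1|exact: neg_borel_torus|].
by rewrite mul1mx.
Qed.

Lemma parabolic1 : PJ 1%:M.
Proof.
apply: (@parabolic_monomial _ [::]) => //; rewrite weyl_word_nil.
by apply: torus_monomial; exact: (torus_group_one hdiag).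
Qed.

(** * Bruhat cells and multiplication by a simple reflection *)

Definition other_neg_roots j :=
  sort (fun a b : 'cV[int]_l => (rank a <= rank b)%N) [seq a <- roots R | nonpos_root a & a != - simple j].

Lemma mem_other_neg_roots j a :
  (a \in other_neg_roots j) = [&& nonpos_root a, a != - simple j & a \in roots R].
Proof. by rewrite mem_sort mem_filter andbA. Qed.

Lemma simpleN_neg j : (- simple j \in roots R) && nonpos_root (- simple j).
Proof. by rewrite roots_oppE simple_root nonpos_rootN simple_nonneg. Qed.

Lemma rank_simpleN j : rank (- simple j : 'cV[int]_l) = 1%N.
Proof.
rewrite rankN /rank /height (bigD1 j) //= simpleE eqxx big1 // => i ij.
by rewrite simpleE (negPf ij).
Qed.

Lemma rank_gt0 a : a \in roots R -> (0 < rank a)%N.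
Proof.
move=> ra; case/orP: (root_sign ra) => na.
  by have := height_pos ra na; rewrite /rank; lia.
have := height_pos (roots_opp ra); rewrite nonneg_rootN na => /(_ isT).
by rewrite -rankN /rank; lia.
Qed.

(** The artificial rank 0 puts $-\alpha_j$ first. A sum of two negative roots has rank at least 2,
    so it is never $-\alpha_j$, and the other negative roots span an ideal. *)
Lemma neg_roots_chain j : chain X (- simple j :: other_neg_roots j).
Proof.
have /andP [rj nj] := simpleN_neg j.
have inP a : a \in - simple j :: other_neg_roots j -> (a \in roots R) && nonpos_root a.
  rewrite inE => /predU1P [->|]; first by rewrite rj nj.
  by rewrite mem_other_neg_roots => /and3P [-> _ ->].
pose rk a := if a == - simple j then 0%N else rank a.
apply: (rank_chain chX (rank := rk)).
- by move=> a /inP /andP [].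
- rewrite /= {1}/rk eqxx all_predT /=.
  have : pairwise (fun a b : 'cV[int]_l => rank a <= rank b)%N (other_neg_roots j).
    rewrite -sorted_pairwise; last by move=> a b c; apply: leq_trans.
    by apply: sort_sorted => a b; apply: leq_total.
  apply: (sub_in_pairwise (P := [pred a | a != - simple j])); last first.
    by apply/allP=> a /=; rewrite mem_other_neg_roots => /and3P [].
  by move=> a b; rewrite !inE /rk => /negPf -> /negPf ->.
- by move=> a b /inP /andP [ra na] /inP /andP [rb nb]; exact: (neg_add_neq0 ra rb na nb).
move=> a b /inP /andP [ra na] /inP /andP [rb nb] rab.
have lt := rank_addN ra rb na nb.
have abj : a + b != - simple j.
  by apply: contraTneq lt => ->; rewrite rank_simpleN -leqNgt; exact: rank_gt0.
rewrite inE mem_other_neg_roots rab abj nonpos_rootD ?orbT //; split=> //.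
apply: leq_ltn_trans (geq_minl _ _) _; rewrite {2}/rk (negPf abj).
by rewrite /rk; case: ifP => // _; apply: leq_ltn_trans lt.
Qed.

(** The chain puts the factor at $-\alpha_j$ first. Ordering the inverse word instead moves this
    factor to the right end. *)
Lemma neg_word_split j ws : neg_word R ws -> exists x ws',
  letters_in (other_neg_roots j) ws' /\ wd ws = wd ws' *m uroot X (- simple j) x.
Proof.
move=> hws; pose L := - simple j :: other_neg_roots j.
have /andP [rj nj] := simpleN_neg j.
have LR : {subset L <= roots R}.
  move=> a; rewrite inE => /predU1P [->//|].
  by rewrite mem_other_neg_roots => /and3P [].
have uL : uniq L.
  rewrite /= sort_uniq filter_uniq ?roots_uniq // andbT mem_other_neg_roots eqxx.
  by rewrite andbF.
have lL : letters_in L (word_inv ws).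
  rewrite letters_word_inv; apply: sub_all hws => -[a x] /= /andP [ra na].
  by rewrite inE mem_other_neg_roots ra na andbT /= orbN.
have [y ey] := word_ordered natK (X_nilpotent chX natK) LR uL (neg_roots_chain j) lL.
pose v := [seq (a, y a) | a <- other_neg_roots j].
have lv : letters_in (other_neg_roots j) v by apply/allP=> u /mapP [a ha ->].
have hL ws' : letters_in (other_neg_roots j) ws' -> letters_in (roots R) ws'.
  by apply: sub_all => u; rewrite mem_other_neg_roots => /and3P [].
exists (- y (- simple j)), (word_inv v); split; first by rewrite letters_word_inv.
have hw := neg_word_roots hws.
have [_ e1] := word_unit chX natK (etrans (letters_word_inv (roots R) ws) hw).
rewrite word_invK in e1; rewrite -e1 ey /= word_cons -/v -urootE.
have [vu ev] := word_unit chX natK (hL _ lv).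
by rewrite invmxM ?(uroot_unit chX natK) // (invmx_uroot chX natK) // ev.
Qed.

Lemma simple_reflection_other_neg j a : a \in other_neg_roots j ->
  neg_root R (simple_reflection R j *m a).
Proof.
rewrite mem_other_neg_roots => /and3P [na aj ra].
rewrite /neg_root simple_reflection_root //= -nonneg_rootN -mulmxN.
apply: simple_reflection_nonneg; rewrite ?roots_oppE ?nonneg_rootN //.
by apply: contra aj => /eqP <-; rewrite opprK.
Qed.

(** The relation $s_jB^-w\subseteq B^-wB^-\cup B^-s_jwB^-$. The reflection permutes the negative
    roots other than $-\alpha_j$, so their factors move to the left. The remaining
    $u_{-\alpha_j}(x)$ passes to the right if $w^{-1}(-\alpha_j)$ is negative; otherwise a
    computation in rank one replaces it. *)
Lemma parabolic_monomial_simple j m g : j \in J ->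
  monomial_for m (simple_reflection R j) -> PJ g -> PJ (m *m g).
Proof.
move=> jJ mm [w [b1 [b2 [[s sJ ->] /neg_borelP [t [ws [ht hws ->]]] hb2 ->]]]].
rewrite mulmxA; apply: parabolic_mulr => //.
have [x [ws' [hws' ->]]] := neg_word_split j hws.
have mm' : monomial_for m (weyl_word R [:: j]) by rewrite weyl_word1.
have mu : m \in unitmx by case: mm => /Gu.
have /andP [rj nj] := simpleN_neg j.
have lws' : letters_in (roots R) ws'.
  by apply: sub_all hws' => u; rewrite mem_other_neg_roots => /and3P [].
have [v ev hv] := monomial_word mm lws'.
have nv : neg_word R v.
  rewrite /neg_word -(all_map fst (neg_root R)) hv all_map; apply: sub_all hws' => u /=.
  exact: simple_reflection_other_neg.
set n_ := nw (weyl_word R s).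
have mn := nw_monomial s; have nu : n_ \in unitmx by case: mn => /Gu.
have -> : m *m (t *m (wd ws' *m uroot X (- simple j) x) *m n_) =
    Ad m t *m wd v *m (m *m uroot X (- simple j) x *m n_).
  by rewrite -ev /Ad !mulmxA !mulmxKV.
have tB := neg_borel_word (monomial_conj_torus mm' ht) nv.
apply: parabolic_mull => //.
have srev a : a \in roots R -> weyl_word R (rev s) *m a \in roots R by exact: weyl_word_root.
have sJr : all (mem J) (j :: s) by rewrite /= jJ.
have mmn : monomial_for (m *m n_) (weyl_word R (j :: s)).
  by rewrite weyl_word_cons; apply: monomialM => // a; exact: weyl_word_root.
have Pmn := parabolic_monomial sJr mmn.
pose a := weyl_word R (rev s) *m - simple j.
have ra : a \in roots R by exact: weyl_word_root.
have [y ey y0] := monomial_uroot x (monomialV mn (weyl_word_revK R s) srev) rj.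
case: (boolP (nonpos_root a)) => na.
  have -> : m *m uroot X (- simple j) x *m n_ = m *m n_ *m uroot X a y.
    by rewrite -ey /Ad invmxK !mulmxA mulmxK.
  by apply: parabolic_mulr => //; apply: neg_borel_uroot; rewrite /neg_root ra.
case: (eqVneq x 0) => [->|x0]; first by rewrite (uroot0 X) mulmx1.
have [q eq q0] := monomial_uroot x mm rj.
have {q0} q0 : q != 0 by exact: q0.
have eq' : m *m uroot X (- simple j) x = uroot X (simple j) q *m m.
  by rewrite mulmx_Ad // eq mulmxN simple_reflection_simple opprK.
(* With $q=-z^{-1}$ the element $u_{\alpha_j}(q)$ is the middle factor of [wroot] at $-\alpha_j$;
   factors $u_{-\alpha_j}(-z)$ on both sides isolate it. *)
have [z zq z0] : exists2 z, - z^-1 = q & z != 0.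
  by exists (- q^-1); rewrite ?invrN ?invrK ?opprK // oppr_eq0 invr_eq0.
have rr := reflection_simpleN j.
have mw := wroot_monomial rj z0 rr.
have eu : uroot X (simple j) q = uroot X (- simple j) (- z) *m wroot X (- simple j) z *m uroot X (- simple j) (- z).
  rewrite /wroot opprK zq -!mulmxA -(urootD chX natK z) // subrr (uroot0 X) mulmx1.
  by rewrite !mulmxA -(urootD chX natK (- z)) // addNr (uroot0 X) mul1mx.
rewrite eq' eu -!mulmxA; apply: parabolic_mull; last by apply: neg_borel_uroot; rewrite /neg_root rj.
rewrite !mulmxA -[_ *m m *m n_]mulmxA.
have [y' ey' _] := monomial_uroot (- z) (monomialV mmn (weyl_word_revK R (j :: s))
  (fun a ra => weyl_word_root (rev (j :: s)) ra)) rj.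
have mnu : m *m n_ \in unitmx by rewrite unitmx_mul mu.
have -> : wroot X (- simple j) z *m uroot X (- simple j) (- z) *m (m *m n_) =
   wroot X (- simple j) z *m (m *m n_) *m uroot X (weyl_word R (rev (j :: s)) *m - simple j) y'.
  rewrite -ey' /Ad invmxK; move: mnu; generalize (m *m n_) => mx mxu.
  by rewrite !mulmxA mulmxK.
apply: parabolic_mulr.
  apply: (parabolic_monomial sJ).
  rewrite -[weyl_word R s]mul1mx -(simple_reflectionK R j) -mulmxA -weyl_word_cons.
  by apply: monomialM => // b; exact: weyl_word_root.
(* The root is $w^{-1}\alpha_j$, which is negative in the remaining case. *)
apply: neg_borel_uroot; rewrite /neg_root weyl_word_root //=.
rewrite rev_cons weyl_word_rcons -mulmxA mulmxN simple_reflection_simple opprK.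
rewrite -nonneg_rootN -mulmxN -/a; have := root_nonneg ra; by rewrite na.
Qed.

(** The letters are split off one at a time: the quotient of [m] by a representative of the first
    letter acts as the remaining word. *)
Lemma parabolic_monomial_mul s m g : all (mem J) s -> monomial_for m (weyl_word R s) ->
  PJ g -> PJ (m *m g).
Proof.
elim: s m g => [|j s ih] m g /=.
  rewrite weyl_word_nil => _ /torus_of_monomial ht hg.
  by apply: parabolic_mull => //; exact: neg_borel_torus.
move=> /andP [jJ sJ] mm hg; have mj := nw_monomial [:: j]; rewrite weyl_word1 in mj.
have nu : nw (simple_reflection R j) \in unitmx by case: mj => /Gu.
set nj := nw _ in mj nu; have -> : m *m g = nj *m ((invmx nj *m m) *m g).
  by rewrite !mulmxA mulmxV // mul1mx.
apply: (parabolic_monomial_simple jJ mj).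
apply: (ih _ _ sJ) => //.
rewrite -[weyl_word R s]mul1mx -(simple_reflectionK R j) -mulmxA -weyl_word_cons.
apply: monomialM => // [|a]; last exact: weyl_word_root.
by apply: monomialV mj _ _ => [|a]; [exact: simple_reflectionK|exact: simple_reflection_root].
Qed.

(** An element of $\mathcal W_J$ makes every positive root supported on $J$ negative. Conjugating by
    it moves the root factor into $B^-$, and both monomial factors are absorbed by
    [parabolic_monomial_mul]. *)
Lemma parabolic_uroot a x g : a \in roots R -> parabolic_root J a -> PJ g ->
  PJ (uroot X a x *m g).
Proof.
move=> ra; case: (boolP (nonpos_root a)) => na.
  move=> _ hg; apply: parabolic_mull => //; apply: neg_borel_uroot.
  by rewrite /neg_root ra.
rewrite /parabolic_root (negPf na) /= => sa hg.
have [s sJ fl] := weyl_word_flips R J.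
have mn := nw_monomial s; set n_ := nw _ in mn.
have nu : n_ \in unitmx by case: mn => /Gu.
have [y ey _] := monomial_uroot x mn ra.
have -> : uroot X a x *m g = invmx n_ *m (uroot X (weyl_word R s *m a) y *m (n_ *m g)).
  by rewrite -ey /Ad !mulmxA mulVmx // mul1mx mulmxKV.
apply: (@parabolic_monomial_mul (rev s)); first by rewrite all_rev.
  apply: monomialV mn _ _; first exact: weyl_word_revK.
  by move=> b; exact: weyl_word_root.
apply: parabolic_mull; first exact: (parabolic_monomial_mul sJ mn).
apply: neg_borel_uroot; rewrite /neg_root weyl_word_root //=.
by apply: (weyl_word_flips_supported fl); rewrite // (root_nonneg ra).
Qed.

Lemma parabolic_torus t g : torus X t -> PJ g -> PJ (t *m g).
Proof. by move=> ht hg; apply: parabolic_mull => //; exact: neg_borel_torus. Qed.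

Lemma parabolic_G g : PJ g -> G g.
Proof.
have bG (b : 'M[K]_n) : neg_borel R X b -> G b.
  move=> /neg_borelP [t [ws [ht hws ->]]]; apply: GM; first by case: (torus_monomial ht).
  elim: ws hws => [|[a x] ws ih] /=; first by rewrite word_nil.
  by move=> /andP [/andP [ra _] /ih h]; rewrite word_cons; apply: GM => //; exact: GU.
move=> [w [b1 [b2 [[s sJ ->] h1 h2 ->]]]]; apply: GM; last exact: bG.
by apply: GM; [exact: bG|case: (nw_monomial s)].
Qed.

Lemma parabolicM g h : PJ g -> PJ h -> PJ (g *m h).
Proof.
move=> [w [b1 [b2 [[s sJ ->] h1 h2 ->]]]] hh; rewrite -!mulmxA.
apply: parabolic_mull => //; apply: (parabolic_monomial_mul sJ (nw_monomial s)).
exact: parabolic_mull.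
Qed.

(** The Cartan subalgebra is the fixed space of $T$ in the Lie algebra, and [m] normalises $T$. *)
Lemma monomial_cartan m s Y : monomial_for m (weyl_word R s) ->
  lspan (cartan_gen H) Y -> lspan (cartan_gen H) (Ad m Y).
Proof.
move=> mm hY; have mu : m \in unitmx by case: mm => /Gu.
apply: (torus_weight_cartan chX natK hkk hdiag).
  by case: mm => Gm _; apply: GLie => //; apply: cartan_span_full.
move=> t ht; have mi : monomial_for (invmx m) (weyl_word R (rev s)).
  apply: monomialV mm _ _; first exact: weyl_word_revK.
  by move=> b; exact: weyl_word_root.
have ht' := monomial_conj_torus mi ht; have tu := tunit ht; have tu' := tunit ht'.
have -> : Ad t (Ad m Y) = Ad m (Ad (Ad (invmx m) t) Y).
  by rewrite -!AdM // /Ad invmxK !mulmxA mulmxV // mul1mx.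
by rewrite (Ad_torus_diag hdiag ht') //; exact: (cartan_diag chX hY).
Qed.

(** * Stabilisers of the parabolic subalgebra *)

Definition stabilises (S : pred 'cV[int]_l) g := forall Y,
  lspan (full_gen R H X S) Y -> lspan (full_gen R H X S) (Ad g Y).

Lemma stabilisesM S g h : g \in unitmx -> h \in unitmx ->
  stabilises S g -> stabilises S h -> stabilises S (g *m h).
Proof. by move=> gu hu hg hh Y hY; rewrite AdM //; apply/hg/hh. Qed.

Lemma stabilises_torus S t : torus X t -> stabilises S t.
Proof.
move=> ht Y; apply: lspan_Ad => Z [[i ->]|[a /andP [ra Sa] ->]].
  rewrite (Ad_torus_diag hdiag ht) ?(chev_diag chX) //.
  by apply: lspan_in; left; exists i.
have [c _ ->] := Ad_torus chX natK hkk hdiag ht ra; apply: lspanZ; apply: lspan_in.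
by right; exists a; rewrite // ra.
Qed.

Lemma stabilises_monomial (S : pred 'cV[int]_l) m s : monomial_for m (weyl_word R s) ->
  (forall a, a \in roots R -> S a -> S (weyl_word R s *m a)) -> stabilises S m.
Proof.
move=> mm hS Y; apply: lspan_Ad => Z [[i ->]|[a /andP [ra Sa] ->]].
  by apply: cartan_span_full; apply: (monomial_cartan mm); apply: lspan_in; exists i.
have [_ /(_ a ra) [c _ ->]] := mm; apply: lspanZ; apply: lspan_in; right.
by exists (weyl_word R s *m a); rewrite // weyl_word_root // hS.
Qed.

Lemma stabilises_word (S : pred 'cV[int]_l) ws : closed_roots R S ->
  all (fun u => (u.1 \in roots R) && S u.1) ws -> stabilises S (wd ws).
Proof. by move=> cl hws Y hY; exact: (Ad_word_full chX natK cl hws). Qed.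

Lemma parabolic_root_closed : closed_roots R (parabolic_root J).
Proof. by move=> a b ra rb rab; exact: (parabolic_rootD ra rb rab). Qed.

Lemma parabolic_letters ws : neg_word R ws ->
  all (fun u => (u.1 \in roots R) && parabolic_root J u.1) ws.
Proof. by apply: sub_all => -[a x] /= /andP [ra na]; rewrite /= ra /parabolic_root na. Qed.

(** The inverse appears because $\sigma(g_1)g_1^{-1}$ contains $g^{-1}$; the Bruhat factors are
    inverted one at a time. *)
Lemma parabolic_stabilises_inv g : PJ g -> stabilises (parabolic_root J) (invmx g).
Proof.
have bS (b : 'M[K]_n) : neg_borel R X b -> b \in unitmx /\ stabilises (parabolic_root J) (invmx b).
  move=> /neg_borelP [t [ws [ht hws ->]]]; have tu := tunit ht.
  have [wu wi] := word_unit chX natK (neg_word_roots hws).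
  split; first by rewrite unitmx_mul tu.
  rewrite invmxM // wi; apply: stabilisesM; rewrite ?unitmx_inv // -?wi ?unitmx_inv //.
    rewrite wi; apply: stabilises_word; first exact: parabolic_root_closed.
    by apply: parabolic_letters; rewrite neg_word_inv.
  by apply: stabilises_torus; exact: (torus_group_inv hdiag).
move=> [w [b1 [b2 [[s sJ ->] /bS [u1 h1] /bS [u2 h2] ->]]]].
have mn := nw_monomial s; have nu : nw (weyl_word R s) \in unitmx by case: mn => /Gu.
rewrite !invmxM ?unitmx_mul ?u1 //.
have mi : monomial_for (invmx (nw (weyl_word R s))) (weyl_word R (rev s)).
  apply: monomialV mn _ _; first exact: weyl_word_revK.
  by move=> b; exact: weyl_word_root.
apply: stabilisesM => //; rewrite ?unitmx_mul ?unitmx_inv ?nu ?u1 //.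
apply: stabilisesM => //; rewrite ?unitmx_inv //.
apply: (stabilises_monomial mi) => a ra; apply: parabolic_root_weyl => //.
by rewrite all_rev.
Qed.

End Parabolic.

(** * Chevalley bases and base change *)

Lemma chevalley_of_basis (C : fieldType) (l n : nat) (R : root_system l)
    (H : 'I_l -> 'M[C]_n) (X : 'cV[int]_l -> 'M[C]_n) :
  chevalley_basis R H X -> chevalley R H X.
Proof.
case=> fr dH HX opp [[N hN] h0]; split=> //.
- by move=> a b ra rb rab; exists (N a b); case: (hN a b ra rb rab).
- move=> a ra; apply: (free_not0 fr); rewrite mem_cat; apply/orP; right.
  by apply/mapP; exists a.
Qed.

Lemma span_chevalley (C : fieldType) (l n : nat) (R : root_system l)
    (H : 'I_l -> 'M[C]_n) (X : 'cV[int]_l -> 'M[C]_n) Y :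
  Y \in <<chevalley_seq R H X>>%VS <-> lspan (full_gen R H X predT) Y.
Proof.
have genP Z : Z \in chevalley_seq R H X <-> full_gen R H X predT Z.
  rewrite mem_cat; split=> [/orP [/mapP [i _ ->]|/mapP [a ra ->]]|[[i ->]|[a /andP [ra _] ->]]].
  - by left; exists i.
  - by right; exists a; rewrite // ra.
  - by apply/orP; left; apply: map_f; rewrite mem_enum.
  - by apply/orP; right; apply: map_f.
split=> [hY|].
  rewrite (coord_span (X := in_tuple (chevalley_seq R H X)) hY); apply: lspan_sum => i _; apply: lspanZ; apply: lspan_in.
  by apply/genP; apply: mem_nth; exact: ltn_ord.
elim=> [|x A B hA _ hB]; first exact: mem0v.
by rewrite memvD // memvZ // memv_span //; apply/genP.
Qed.

Section MapWords.
Variables (K L : fieldType) (phi : {rmorphism K -> L}) (l n : nat).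
Variables (X : 'cV[int]_l -> 'M[K]_n) (X' : 'cV[int]_l -> 'M[L]_n).
Hypothesis natK : forall k, k.+1%:R != 0 :> K.
Hypothesis phiX : forall a, map_mx phi (X a) = X' a.

Let natU k : (k.+1%:R : K) \is a GRing.unit. Proof. by rewrite unitfE. Qed.

Lemma map_uroot a x : map_mx phi (uroot X a x) = uroot X' a (phi x).
Proof. by rewrite !urootE map_mexpZ // phiX. Qed.

Lemma map_wroot a x : map_mx phi (wroot X a x) = wroot X' a (phi x).
Proof. by rewrite /wroot !map_mxM !map_uroot rmorphN fmorphV. Qed.

Lemma map_hroot a x : map_mx phi (hroot X a x) = hroot X' a (phi x).
Proof. by rewrite /hroot map_mxM !map_wroot rmorphN rmorph1. Qed.

Lemma map_torus_elt x : map_mx phi (torus_elt X x) = torus_elt X' (fun i => phi (x i)).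
Proof.
rewrite /torus_elt; elim: (index_enum _) => [|i r ih].
  by rewrite !big_nil [LHS]map_mx1.
by rewrite !big_cons [LHS]map_mxM ih map_hroot.
Qed.

Lemma map_word ws : map_mx phi (word X ws) = word X' [seq (w.1, phi w.2) | w <- ws].
Proof.
elim: ws => [|[a x] ws ih]; first by rewrite !word_nil map_mx1.
by rewrite /= !word_cons map_mxM ih; congr (_ *m _); exact: map_uroot.
Qed.

End MapWords.

Section BaseChange.
Variables (C E : fieldType) (iota : {rmorphism C -> E}) (l n : nat) (R : root_system l).
Variables (H : 'I_l -> 'M[C]_n) (X : 'cV[int]_l -> 'M[C]_n).
Hypotheses (chX : chevalley R H X) (natC : forall k, k.+1%:R != 0 :> C).

Lemma natr_neq0_map k : k.+1%:R != 0 :> E.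
Proof. by rewrite -(rmorph_nat iota) fmorph_eq0. Qed.

Lemma chevalley_map : chevalley R (fun i => map_mx iota (H i)) (ext_mx iota X).
Proof.
split=> [i|i a ra|a ra|a b ra rb rab|a b ra rb n0 nr|a ra].
- by apply/is_diag_mxP=> p q pq; rewrite mxE (diag_entry (chev_diag chX i)) ?rmorph0.
- by rewrite -map_lie (chev_H chX) // map_mxZ rmorph_int.
- have [c e1 e2] := chev_opp chX ra; exists c => //.
  rewrite -map_lie e2; apply/matrixP=> p q; rewrite mxE !summxE rmorph_sum.
  by apply: eq_bigr => i _; rewrite !mxE rmorphM rmorph_int.
- by have [N e] := chev_sum chX ra rb rab; exists (iota N); rewrite -map_lie e map_mxZ.
- by rewrite -map_lie (chev_zero chX) // map_mx0.
- by rewrite map_mx_eq0 (chev_neq0 chX).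
Qed.

Lemma map_full_span S Y : lspan (full_gen R H X S) Y ->
  lspan (full_gen R (fun i => map_mx iota (H i)) (ext_mx iota X) S) (map_mx iota Y).
Proof.
apply: map_lspan => Z [[i ->]|[a ha ->]]; first by left; exists i.
by right; exists a.
Qed.

End BaseChange.

(** * Unipotent subgroups attached to the positive or negative roots *)

Section SignedRoots.
Variables (K : fieldType) (l n : nat) (R : root_system l).
Variables (H : 'I_l -> 'M[K]_n) (X : 'cV[int]_l -> 'M[K]_n).
Hypotheses (chX : chevalley R H X) (natK : forall k, k.+1%:R != 0 :> K).
Variable S : pred 'cV[int]_l.
Hypothesis closedS : forall a b, a \in roots R -> b \in roots R -> S a -> S b ->
  [/\ a + b != 0, S (a + b) & (rank a < rank (a + b)%R)%N].
Notation wd := (word X).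
Implicit Types (ws : seq ('cV[int]_l * K)).

Let natU k : (k.+1%:R : K) \is a GRing.unit. Proof. by rewrite unitfE. Qed.

Definition S_word ws := all (fun w => (w.1 \in roots R) && S w.1) ws.

Lemma lie_signed a b : a \in roots R -> S a -> b \in roots R -> S b ->
  lspan (root_gen R X S) (lie (X a) (X b)).
Proof.
move=> ra Sa rb Sb; have [ab Sab _] := closedS ra rb Sa Sb.
case: (boolP (a + b \in roots R)) => rab; last by rewrite (chev_zero chX) //; apply: lspan0.
have [N ->] := chev_sum chX ra rb rab; apply: lspanZ; apply: lspan_in.
by exists (a + b); rewrite // rab.
Qed.

Lemma Ad_signed_word ws Y : S_word ws -> lspan (root_gen R X S) Y ->
  lspan (root_gen R X S) (Ad (wd ws) Y).
Proof.
elim: ws => [|[a x] ws ih]; first by rewrite word_nil Ad1.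
move=> /= /andP [/andP [/= ra Sa] hws] hY.
rewrite word_cons AdM; last 2 first.
- exact: (uroot_unit chX natK x ra).
- by case: (word_unit chX natK (ws := ws)) => //; apply: sub_all hws => w /andP [].
rewrite -urootE (Ad_urootE chX natK) //; apply: mexp_conj_span => //.
- exact: (nilZ chX natK).
- by move=> Z [b /andP [rb Sb] ->]; rewrite lieZl; apply: lspanZ; apply: lie_signed.
exact: ih.
Qed.

Lemma Ad_signed_cartan ws Y : S_word ws -> lspan (cartan_gen H) Y ->
  lspan (root_gen R X S) (Ad (wd ws) Y - Y).
Proof.
move=> + hY; have lY a : a \in roots R -> S a -> lspan (root_gen R X S) (lie (X a) Y).
  move=> ra Sa; move: hY; apply: lspan_lie => Z [i ->].
  rewrite lieC (chev_H chX) //; apply: lspanN; apply: lspanZ; apply: lspan_in.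
  by exists a; rewrite // ra.
elim: ws => [|[a x] ws ih]; first by rewrite word_nil Ad1 subrr => _; apply: lspan0.
move=> /= /andP [/andP [/= ra Sa] hws].
have uu := uroot_unit chX natK x ra.
rewrite word_cons AdM //; last first.
  by case: (word_unit chX natK (ws := ws)) => //; apply: sub_all hws => w /andP [].
rewrite -urootE; set u := uroot X a x; set P := wd ws.
have -> : Ad u (Ad P Y) - Y = Ad u (Ad P Y - Y) + (Ad u Y - Y) by rewrite AdB addrA subrK.
have nil := nilZ chX natK x ra.
have cl Z : root_gen R X S Z -> lspan (root_gen R X S) (lie (x *: X a) Z).
  by move=> [b /andP [rb Sb] ->]; rewrite lieZl; apply: lspanZ; apply: lie_signed.
apply: lspanD; rewrite (Ad_urootE chX natK) //.
  by apply: mexp_conj_span => //; apply: ih.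
by apply: mexp_conj_sub => //; rewrite lieZl; apply: lspanZ; apply: lY.
Qed.

Definition signed_roots := sort (fun a b : 'cV[int]_l => (rank a <= rank b)%N)
  [seq a <- roots R | S a].

Lemma mem_signed_roots a : (a \in signed_roots) = (a \in roots R) && S a.
Proof. by rewrite mem_sort mem_filter andbC. Qed.

Lemma signed_roots_chain : chain X signed_roots.
Proof.
apply: (rank_chain chX (rank := @rank l)).
- by move=> a; rewrite mem_signed_roots => /andP [].
- rewrite -sorted_pairwise; last by move=> a b c; apply: leq_trans.
  by apply: sort_sorted => a b; apply: leq_total.
- move=> a b; rewrite !mem_signed_roots => /andP [ra Sa] /andP [rb Sb].
  by case: (closedS ra rb Sa Sb).
move=> a b; rewrite !mem_signed_roots => /andP [ra Sa] /andP [rb Sb] rab.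
have [_ Sab lt] := closedS ra rb Sa Sb; rewrite rab Sab; split=> //.
exact: leq_ltn_trans (geq_minl _ _) lt.
Qed.

(** [HH] is any diagonal family with the weights of the simple coroots: the basis $H_i$ in one
    application, the brackets $[X_{\alpha_i},X_{-\alpha_i}]$ in the other. *)
Lemma word_quotient_coord (L : seq 'cV[int]_l) (x x' : 'cV[int]_l -> K)
    (HH : 'I_l -> 'M[K]_n) :
  {subset L <= roots R} -> uniq L -> chain X L ->
  (forall i, is_diag_mx (HH i)) ->
  (forall i a, a \in roots R -> lie (HH i) (X a) = wt K R i a *: X a) ->
  let ws := [seq (a, x' a) | a <- rev L] ++ [seq (a, - x a) | a <- L] in
  (forall i a, a \in L -> rcoord X a (Ad (wd ws) (HH i)) = 0) ->
  forall a, a \in L -> x' a = x a.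
Proof.
move=> LR uL cL dHH wHH ws hws.
have lws : letters_in (roots R) ws.
  rewrite /letters_in all_cat; apply/andP.
  by split; apply/allP=> w /mapP [a]; rewrite ?mem_rev => /LR ra ->.
have [_ wi] := word_unit chX natK lws.
apply: (word_quotient_inj natK (X_nilpotent chX natK) (H := HH) (wt := @wt K l R) (co := rcoord X)) => //.
- by move=> a y A B; exact: rcoord_linear.
- by move=> i a /LR; exact: wHH.
- by move=> a /LR; exact: wt_neq0.
- by move=> a b /LR ra /LR rb; exact: (rcoord_X chX natK).
- by move=> i a /LR ra; exact: (rcoord_diag chX natK).
- by move=> i a aL; rewrite -[X in rcoord _ _ (_ *m X)]wi; exact: hws.
Qed.

(** The inverse of the ordered word is compared with the trivial word. Both fix the Cartan elements,
    so all parameters vanish. *)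
Lemma signed_word_eq1 ws (HH : 'I_l -> 'M[K]_n) : S_word ws ->
  (forall i, is_diag_mx (HH i)) ->
  (forall i a, a \in roots R -> lie (HH i) (X a) = wt K R i a *: X a) ->
  (forall i, Ad (wd ws) (HH i) = HH i) -> wd ws = 1%:M.
Proof.
move=> hws dHH wHH fixH; pose L := signed_roots.
have LR : {subset L <= roots R} by move=> a; rewrite mem_signed_roots => /andP [].
have uL : uniq L by rewrite sort_uniq filter_uniq ?roots_uniq.
have lw : letters_in L ws by apply: sub_all hws => w; rewrite mem_signed_roots.
have [y ey] := word_ordered natK (X_nilpotent chX natK) LR uL signed_roots_chain lw.
have lr : letters_in (roots R) ws by apply: sub_all hws => w /andP [].
have [wu wi] := word_unit chX natK lr.
have y0 a : a \in L -> - y a = 0.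
  apply: (@word_quotient_coord L (fun=> 0) (fun a => - y a) HH LR uL signed_roots_chain dHH wHH).
  move=> i b bL; rewrite word_cat.
  have -> : wd [seq (a, - 0) | a <- L] = 1%:M.
    by elim: (L) => [|c r ih] /=; rewrite ?word_nil // word_cons ih oppr0 scale0r mexp0 mulmx1.
  have -> : [seq (a, - y a) | a <- rev L] = word_inv [seq (a, y a) | a <- L].
    by rewrite /word_inv -map_comp map_rev.
  have ly : letters_in (roots R) [seq (a, y a) | a <- L].
    by apply/allP=> w /mapP [c /LR rc ->].
  have [_ <-] := word_unit chX natK ly; rewrite -ey mulmx1 -(fixH i) AdK //.
  by rewrite (rcoord_diag chX natK) // LR.
rewrite ey -(mul1mx 1%:M); elim: (L) y0 => [|c r ih] y0 /=; first by rewrite word_nil mulmx1.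
rewrite word_cons ih => [|a ar]; last by apply: y0; rewrite inE ar orbT.
have /eqP := y0 c (mem_head _ _); rewrite oppr_eq0 => /eqP ->.
by rewrite scale0r mexp0 !mulmx1.
Qed.

End SignedRoots.

Lemma nonpos_closed l (R : root_system l) a b : a \in roots R -> b \in roots R ->
  nonpos_root a -> nonpos_root b ->
  [/\ a + b != 0, nonpos_root (a + b) & (rank a < rank (a + b)%R)%N].
Proof.
move=> ra rb na nb; split; [exact: (neg_add_neq0 ra rb)|exact: nonpos_rootD|].
exact: (rank_addN ra rb).
Qed.

Lemma nonneg_closed l (R : root_system l) a b : a \in roots R -> b \in roots R ->
  nonneg_root a -> nonneg_root b ->
  [/\ a + b != 0, nonneg_root (a + b) & (rank a < rank (a + b)%R)%N].
Proof.
rewrite -(roots_oppE R a) -(roots_oppE R b) -!nonpos_rootN => ra rb na nb.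
have [h1 h2 h3] := nonpos_closed ra rb na nb; split; last by rewrite -rankN -(rankN (a + b)) opprD.
  by rewrite -oppr_eq0 opprD.
by rewrite opprD.
Qed.

(** * Logarithmic derivative of the torus *)

Section TorusDerivative.
Variables (K : fieldType) (l n : nat) (R : root_system l).
Variables (H : 'I_l -> 'M[K]_n) (X : 'cV[int]_l -> 'M[K]_n).
Hypotheses (chX : chevalley R H X) (natK : forall k, k.+1%:R != 0 :> K).
Variable kk : 'I_l -> 'I_n -> int.
Hypothesis hdiag : forall i x, x != 0 -> hroot X (simple i) x = diag_mx (\row_p x ^ kk i p).
Variable D : K -> K.
Hypothesis DD : forall x y, D (x + y) = D x + D y.
Hypothesis DM : forall x y, D (x * y) = D x * y + x * D y.
Hypothesis DX : forall a, map_mx D (X a) = 0.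

Lemma D_torus u : (forall i, u i != 0) ->
  map_mx D (torus_elt X u) = (\sum_i (D (u i) / u i) *: hx X (simple i)) *m torus_elt X u.
Proof.
move=> u0; rewrite /torus_elt; elim: (index_enum _) => [|i r ih].
  by rewrite !big_nil [LHS](der1mx DD DM) mul0mx.
rewrite !big_cons [LHS](derMmx DD DM) ih (D_hroot chX natK DD DM DX (simple_root R i) (u0 i)).
set h := hroot _ _ _; set P := \prod_(_ <- r) _; set Z := \sum_(_ <- r) _.
rewrite mulmxDl -[_ *m h *m P]mulmxA; congr (_ + _).
have dZ : is_diag_mx Z.
  apply: (cartan_diag chX); apply: lspan_sum => j _; apply: lspanZ.
  exact: (hx_cartan chX (simple_root R j)).
have th : torus X h by apply: (torus_hroot hdiag).
rewrite [LHS]mulmxA [RHS]mulmxA; congr (_ *m _).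
by rewrite (mulmx_Ad Z (torus_unit hdiag th)) (Ad_torus_diag hdiag th dZ).
Qed.

(* [D(t) t^-1] is a combination of the coroots with coefficients [D(u i) / u i],
   and the Cartan matrix is nonsingular. *)
Lemma torus_const u : (forall i, u i != 0) -> map_mx D (torus_elt X u) = 0 ->
  forall i, D (u i) = 0.
Proof.
move=> u0 d0; have [tu _] := torus_unit_inv hdiag u0.
have Z0 : \sum_i (D (u i) / u i) *: hx X (simple i) = 0.
  by rewrite -[LHS](mulmxK tu) -D_torus // d0 mul0mx.
pose e : 'cV[K]_l := \col_i (D (u i) / u i).
have e0 : map_mx intr (cartan_matrix R) *m e = 0.
  apply/colP=> j; rewrite !mxE; have rj := simple_root R j.
  have := congr1 (fun Z => lie Z (X (simple j))) Z0.
  rewrite /= lie_suml [lie 0 _]/lie mul0mx mulmx0 subrr => h.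
  have {}h : (\sum_i (D (u i) / u i) * wt K R i (simple j)) *: X (simple j) = 0.
    rewrite scaler_suml -[RHS]h; apply: eq_bigr => i _.
    by rewrite lieZl (lie_hx chX) ?simple_root // scalerA.
  move/eqP: h; rewrite scaler_eq0 (negPf (chev_neq0 chX rj)) orbF => /eqP h.
  by rewrite -[RHS]h; apply: eq_bigr => i _; rewrite !mxE mulrC.
have cu : (map_mx intr (cartan_matrix R) : 'M[K]_l) \in unitmx.
  by rewrite unitmxE unitfE det_map_mx (intr_eq0_char0 natK) det_cartan.
have ee : e = 0 by rewrite -[e](mulKmx cu) e0 mulmx0.
move=> i; move/colP/(_ i)/eqP: ee; rewrite !mxE mulf_eq0 invr_eq0 (negPf (u0 i)) orbF.
by move/eqP.
Qed.

End TorusDerivative.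

(** * Points over an extension field *)

Section ExtensionPoints.
Variables (C E : fieldType) (iota : {rmorphism C -> E}) (n : nat).
Hypothesis natC : forall k, k.+1%:R != 0 :> C.
Variable P : 'M[C]_n -> Prop.
Hypothesis P1 : P 1%:M.
Implicit Types (g : 'M[E]_n) (F : {mpoly E[n * n]}).

Let natE k : k.+1%:R != 0 :> E. Proof. exact: natr_neq0_map iota natC k. Qed.

(* Zariski closure of [P] over [E]: unlike in [points], the equations may have
   coefficients in [E], so that they can be translated by elements of [GL_n(E)]. *)
Definition closure_points g := g \in unitmx /\
  forall F, (forall p, P p -> eval_mx F (map_mx iota p) = 0) -> eval_mx F g = 0.

Lemma closure_points1 : closure_points 1%:M.
Proof. by split=> [|F hF]; [exact: unitmx1|have := hF _ P1; rewrite map_mx1]. Qed.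

Lemma eval_map_iota (f : {mpoly C[n * n]}) p :
  eval_mx (map_mpoly iota f) (map_mx iota p) = iota (eval_mx f p).
Proof.
elim/mpoly_ring_ind: f => [c|i|f1 f2 h1 h2|f1 f2 h1 h2]; rewrite /eval_mx.
- by rewrite map_mpolyC !mevalC.
- by rewrite map_mpolyX !mevalXU -map_mxvec mxE.
- by rewrite raddfD /= !mevalD raddfD /= -h1 -h2.
- by rewrite rmorphM /= !mevalM rmorphM /= -h1 -h2.
Qed.

Lemma closure_points_points g : closure_points g -> points iota P g.
Proof.
case=> gu hg; split=> // f hf; apply: hg => p Pp.
by rewrite eval_map_iota hf // rmorph0.
Qed.

(** For an equation [F] over $\mathcal E$ and $p\in P$, the function $y\mapsto F(c(y)p)$ is Laurent
    and vanishes at the positive integers, where $c$ comes from [c0]. So it vanishes at [x], and the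
    translated equation $g\mapsto F(c(x)g)$ holds on [P], hence on its closure. *)
Lemma closure_points_curve (c : E -> 'M[E]_n) (c0 : C -> 'M[C]_n) x g : x != 0 ->
  (forall i j, laurent_fun (fun y => c y i j)) -> c x \in unitmx ->
  (forall y, map_mx iota (c0 y) = c (iota y)) ->
  (forall k p, P p -> P (c0 k.+1%:R *m p)) ->
  closure_points g -> closure_points (c x *m g).
Proof.
move=> x0 hc cu c0c hP [gu hg]; split=> [|F hF]; first by rewrite unitmx_mul cu.
have [F' hF'] := polyfun_mulmxl F (c x).
rewrite hF'; apply: hg => p Pp; rewrite -hF'.
apply: (laurent_fun_eq0 natE (laurent_fun_eval F (map_mx iota p) hc)) => // k.
by rewrite -(rmorph_nat iota) -c0c -map_mxM; apply: hF; exact: hP.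
Qed.

Section LieAlgebra.
Variable d : E -> E.
Hypotheses (hd : derivation d) (hdC : forall a, d (iota a) = 0).

Lemma closure_points_translate (f : {mpoly C[n * n]}) q p :
  (forall p1 p2, P p1 -> P p2 -> P (p1 *m p2)) -> closure_points q -> vanishes_on P f -> P p ->
  eval_mx (map_mpoly iota f) (q *m map_mx iota p) = 0.
Proof.
move=> PM [_ hq] hf Pp.
have [F hF] := polyfun_mulmx (map_mpoly iota f) 1%:M (map_mx iota p).
have e g : eval_mx (map_mpoly iota f) (g *m map_mx iota p) = eval_mx F g.
  by rewrite -hF mul1mx.
rewrite e; apply: hq => p' Pp'; rewrite -e -map_mxM eval_map_iota hf ?rmorph0 //.
exact: PM.
Qed.

(** Differentiating $f(qp)=0$ for constant $p\in P$ gives $\sum_r\partial_rf(qp)\,(dq\,p)_r=0$. The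
    left side is a polynomial in $p$ over $\mathcal E$, so it also vanishes at $p=q^{-1}$, where it
    is the differential of [f] at the identity applied to $dq\,q^{-1}$. *)
Lemma log_derivative_lie_points q : (forall p1 p2, P p1 -> P p2 -> P (p1 *m p2)) ->
  closure_points q -> closure_points (invmx q) ->
  lie_points iota P (map_mx d q *m invmx q).
Proof.
move=> PM hq [_ hqV] f hf; have [qu _] := hq.
have [F hF] : polyfun (fun g => \sum_r eval_mx (map_mpoly iota f^`M(r)) (q *m g) *
    mxvec (map_mx d q *m g) 0 r).
  apply: polyfun_sum => r; apply: polyfunM; first exact: polyfun_mulmxl.
  have [i [j hr]] := mxvec_entry q r.
  case/mxvec_indexP: r hr => i' j' _.
  apply: (@polyfun_ext _ _ (fun g => (map_mx d q *m g *m 1%:M) i' j')).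
    by move=> g; rewrite mxvecE mulmx1.
  exact: polyfun_linear_entry.
have {hF}hF g : \sum_r eval_mx (map_mpoly iota f^`M(r)) (q *m g) *
    mxvec (map_mx d q *m g) 0 r = eval_mx F g by [].
have := hF (invmx q); rewrite mulmxV // => ->; apply: hqV => p Pp; rewrite -hF.
have dp : map_mx d (map_mx iota p) = 0 by apply/matrixP=> i j; rewrite !mxE hdC.
have [dD dM] := hd.
have -> : map_mx d q *m map_mx iota p = map_mx d (q *m map_mx iota p).
  by rewrite (derMmx dD dM) dp mulmx0 addr0.
rewrite -(der_eval_mx _ _ hd hdC) closure_points_translate //.
exact: (der0 dD).
Qed.

End LieAlgebra.

Section RootSubgroups.
Variables (l : nat) (R : root_system l) (H : 'I_l -> 'M[C]_n) (X : 'cV[int]_l -> 'M[C]_n).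
Hypothesis chX : chevalley R H X.
Notation XE := (ext_mx iota X).
Variable S : pred 'cV[int]_l.
Hypothesis PU : forall a x p, a \in roots R -> S a -> P p -> P (uroot X a x *m p).
Hypothesis PT : forall t p, torus X t -> P p -> P (t *m p).
Variable kk : 'I_l -> 'I_n -> int.
Hypothesis hdiag : forall i x, x != 0 -> hroot X (simple i) x = diag_mx (\row_q x ^ kk i q).
Hypothesis hdiagE : forall i x, x != 0 -> hroot XE (simple i) x = diag_mx (\row_q x ^ kk i q).

Let chE : chevalley R (fun i => map_mx iota (H i)) XE. Proof. exact: chevalley_map. Qed.
Let iX a : map_mx iota (X a) = XE a. Proof. by []. Qed.

Lemma laurent_entries N (c : E -> 'M[E]_n) i j : laurent (fun _ => 0 : E) N c ->
  laurent_fun (fun y => c y i j).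
Proof.
case=> Q [_ hQ]; exists N, (Q i j) => y y0.
by have /matrixP/(_ i j) := hQ y y0; rewrite !mxE.
Qed.

(** For the zero derivation every coefficient is constant, so the curves treated with [laurent]
    become Laurent functions over $\mathcal E$. *)
Let D0D (x y : E) : (fun _ : E => 0 : E) (x + y) = 0 + 0. Proof. by rewrite addr0. Qed.
Let D0M (x y : E) : (fun _ : E => 0 : E) (x * y) = 0 * y + x * 0.
Proof. by rewrite mul0r mulr0 addr0. Qed.
Let D0X a : map_mx (fun _ => 0 : E) (XE a) = 0. Proof. by apply/matrixP=> i j; rewrite !mxE. Qed.

Lemma closure_points_uroot a x g : a \in roots R -> S a ->
  closure_points g -> closure_points (uroot XE a x *m g).
Proof.
move=> ra Sa; have [->|x0] := eqVneq x 0; first by rewrite uroot0 ?mul1mx.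
apply: (@closure_points_curve (uroot XE a) (uroot X a)) => //.
- move=> i j; apply: laurent_entries; exact: (laurent_uroot natE D0D D0M D0X).
- exact: (uroot_unit chE natE).
- by move=> y; exact: (map_uroot natC iX).
- by move=> k p Pp; exact: PU.
Qed.

Lemma closure_points_word ws g : all (fun w => (w.1 \in roots R) && S w.1) ws ->
  closure_points g -> closure_points (word XE ws *m g).
Proof.
elim: ws => [|[a x] ws ih] /=; first by rewrite word_nil mul1mx.
move=> /andP [/andP [ra Sa] hws] hg; rewrite word_cons -mulmxA -urootE.
by apply: closure_points_uroot => //; exact: ih.
Qed.

Lemma closure_points_torus t g : torus XE t -> closure_points g -> closure_points (t *m g).
Proof.
case=> x x0 ->; rewrite /torus_elt; elim: (index_enum _) => [|i r ih] hg.
  by rewrite big_nil mul1mx.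
rewrite big_cons -[_ * _]/(_ *m _) -mulmxA.
apply: (@closure_points_curve (hroot XE (simple i)) (hroot X (simple i))) => //.
- move=> k j; apply: laurent_entries; exact: (laurent_hroot natE D0D D0M D0X).
- by apply: (torus_unit hdiagE); exact: (torus_hroot hdiagE).
- by move=> y; exact: (map_hroot natC iX).
- by move=> k p Pp; apply: PT => //; exact: (torus_hroot hdiag).
- exact: ih.
Qed.

End RootSubgroups.
End ExtensionPoints.

(** * Factorisation of the unipotent radical *)

Lemma enum_index_enum (T : finType) : enum T = index_enum T.
Proof. by rewrite enumT [index_enum _]unlock. Qed.

Lemma pairwise_enum_ord m : pairwise (fun i j : 'I_m => (i <= j)%N) (enum 'I_m).
Proof.
have : pairwise leq (map val (enum 'I_m)).
  by rewrite val_enum_ord -sorted_pairwise ?iota_sorted //; exact: leq_trans.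
by rewrite pairwise_map.
Qed.

Lemma sub_pairwise_mem (T : eqType) (r r' : rel T) (s : seq T) :
  (forall a b, a \in s -> b \in s -> r a b -> r' a b) -> pairwise r s -> pairwise r' s.
Proof.
elim: s => //= a s ih h /andP [/allP ra ps]; apply/andP; split.
  by apply/allP=> b bs; apply: h (ra b bs); rewrite inE ?eqxx ?bs ?orbT.
by apply: ih ps => b c bs cs; apply: h; rewrite inE ?bs ?cs orbT.
Qed.

Section Factorization.
Variables (K : fieldType) (l p n : nat) (R : root_system l).
Variables (H : 'I_l -> 'M[K]_n) (X : 'cV[int]_l -> 'M[K]_n).
Hypotheses (chX : chevalley R H X) (natK : forall k, k.+1%:R != 0 :> K).
Variable beta : 'I_(l + p) -> 'cV[int]_l.
Hypothesis hbeta : neg_numbering R beta.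
Variable w0 : 'M[int]_l.
Hypothesis hw0 : longest R w0.
Variables (I' : {set 'I_l}) (D : {set {set 'I_l}}).
Hypothesis hD : irreducible_components R I' D.
Notation J := (opposite_set w0 I').
Notation ks := [seq k <- enum 'I_(l + p) | ~~ [exists B in D, supported B (beta k)]].
Implicit Types a b : 'cV[int]_l.

Lemma beta_neg j : neg_root R (beta j).
Proof. by case: hbeta => _ h _ _; apply/h; exists j. Qed.

Lemma beta_rank (i j : 'I_(l + p)) : (i <= j)%N -> (rank (beta i) <= rank (beta j))%N.
Proof. by case: hbeta => _ _ _ h /h; rewrite /rank; lia. Qed.

Lemma ks_supported j : (j \in ks) = ~~ supported I' (beta j).
Proof.
have /andP [rj _] := beta_neg j.
by rewrite mem_filter mem_enum andbT (supported_components hD rj).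
Qed.

Definition outer_roots := [seq beta k | k <- ks].
Definition inner_index := [seq j <- enum 'I_(l + p) | supported J (beta j)].
(** Listing these roots as images under $-\overline w$ makes conjugation by $n(\overline w)^{-1}$
    produce the factors in the order prescribed by [Psi_pos_unipotent]. *)
Definition inner_roots := [seq w0 *m - beta j | j <- inner_index].

Lemma mem_outer_roots a : (a \in outer_roots) = neg_root R a && ~~ supported I' a.
Proof.
apply/mapP/andP => [[k]|[na sa]].
  by rewrite ks_supported => sk ->; split=> //; exact: beta_neg.
case: hbeta => _ h _ _; have /h [j ea] := na; exists j => //.
by rewrite ks_supported -ea.
Qed.

Lemma mem_inner_roots a : (a \in inner_roots) = neg_root R a && supported I' a.
Proof.
have ww := longest_involution hw0.
apply/mapP/andP => [[j]|[na sa]].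
  rewrite mem_filter => /andP [sj _] ->; have /andP [rj nj] := beta_neg j.
  rewrite /neg_root (longest_root _ hw0) roots_opp // (longest_nonneg hw0) ?nonneg_rootN //.
  by split=> //; rewrite (supported_longest' _ _ hw0) supportedN.
have /andP [ra npa] := na; case: hbeta => _ h _ _.
have : neg_root R (- (w0 *m a)).
  by rewrite /neg_root roots_opp ?(longest_root _ hw0) //= nonpos_rootN (longest_nonpos hw0).
case/h=> j ej; exists j; last by rewrite -ej opprK mulmxA ww mul1mx.
rewrite mem_filter mem_enum andbT -ej supportedN.
by rewrite (supported_longest _ _ hw0).
Qed.

Lemma outer_pairwise : pairwise (fun a b => rank a <= rank b)%N outer_roots.
Proof.
rewrite pairwise_map; apply: sub_pairwise (pairwise_filter _ (pairwise_enum_ord _)) => i j.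
exact: beta_rank.
Qed.

Lemma inner_pairwise : pairwise (fun a b => rank a <= rank b)%N inner_roots.
Proof.
rewrite pairwise_map; apply: sub_pairwise (pairwise_filter _ (pairwise_enum_ord _)) => i j /=.
by rewrite /rank !(height_longest _ hw0) !heightN !opprK; exact: beta_rank.
Qed.

Lemma beta_inj : injective beta. Proof. by case: hbeta. Qed.

Lemma outer_uniq : uniq outer_roots.
Proof. by rewrite (map_inj_uniq beta_inj) filter_uniq // enum_uniq. Qed.

Lemma inner_uniq : uniq inner_roots.
Proof.
rewrite map_inj_uniq; first by rewrite filter_uniq // enum_uniq.
move=> i j e.
apply/beta_inj/oppr_inj; have := congr1 (mulmx w0) e.
by rewrite !mulmxA (longest_involution hw0) !mul1mx.
Qed.

Lemma outer_chain : chain X outer_roots.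
Proof.
apply: (rank_chain chX (rank := @rank l)) outer_pairwise _ _.
- by move=> a; rewrite mem_outer_roots => /andP [/andP []].
- move=> a b; rewrite !mem_outer_roots => /andP [/andP [ra na] _] /andP [/andP [rb nb] _].
  exact: (neg_add_neq0 ra rb).
move=> a b; rewrite !mem_outer_roots => /andP [/andP [ra na] sa] /andP [/andP [rb nb] sb] rab.
have lt := rank_addN ra rb na nb; split; last by apply: leq_ltn_trans lt; exact: geq_minl.
(* Nonpositive coordinates cannot cancel, so the sum of two outer roots keeps a nonzero coordinate
   outside $I'$. *)
rewrite /neg_root rab nonpos_rootD //=; apply: contra sa => /forallP sab.
apply/forallP=> i; case/orP: (sab i) => [->//|]; rewrite mxE.
have /forallP/(_ i) := na; have /forallP/(_ i) := nb; move: (a i 0) (b i 0) => u w w0' u0 /eqP e.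
by apply/orP; right; apply/eqP; lia.
Qed.

(** The outer roots form an ideal among the negative roots. Shifting the rank of the inner roots by
    [N], a bound for all ranks, places them after the outer ones. *)
Lemma neg_roots_factor_chain : chain X (outer_roots ++ inner_roots).
Proof.
pose N := (\sum_(a <- roots R) rank a)%N.
have le_N a : a \in roots R -> (rank a <= N)%N.
  by move=> ra; rewrite /N (big_rem a) //= leq_addr.
have mem a : (a \in outer_roots ++ inner_roots) = neg_root R a.
  by rewrite mem_cat mem_outer_roots mem_inner_roots; case: (neg_root R a); case: supported.
apply: (rank_chain chX (rank := fun a => (if supported I' a then N + rank a else rank a)%N)).
- by move=> a; rewrite mem => /andP [].
- rewrite pairwise_cat; apply/and3P; split.
  + apply/allrelP=> a b; rewrite mem_outer_roots mem_inner_roots.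
    move=> /andP [/andP [ra _] /negPf ->] /andP [_ ->].
    exact: leq_trans (le_N a ra) (leq_addr _ _).
  + apply: sub_pairwise_mem outer_pairwise => a b.
    by rewrite !mem_outer_roots => /andP [_ /negPf ->] /andP [_ /negPf ->].
  apply: sub_pairwise_mem inner_pairwise => a b.
  by rewrite !mem_inner_roots => /andP [_ ->] /andP [_ ->]; rewrite leq_add2l.
- move=> a b; rewrite !mem => /andP [ra na] /andP [rb nb]; exact: (neg_add_neq0 ra rb).
move=> a b; rewrite !mem => /andP [ra na] /andP [rb nb] rab.
have lt := rank_addN ra rb na nb; have := rank_addN rb ra nb na; rewrite addrC => lt'.
split; first by rewrite /neg_root rab nonpos_rootD.
have := @supportedD _ I' a b; move: lt lt' (le_N _ ra) (le_N _ rb).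
move: (rank a) (rank b) (rank (a + b)%R) {le_N} N => r1 r2 r3 m.
case: (supported I' a); case: (supported I' b); case: (supported I' (a + b)) => h1 h2 h3 h4 h5;
  by [move: (h5 isT isT)|clear h5; lia].
Qed.

Notation wd := (word X).

Lemma unip_word x : unip_elt X beta x = wd [seq (beta j, x j) | j <- index_enum 'I_(l + p)].
Proof. by rewrite /unip_elt /word big_map. Qed.

Lemma unip_factorization x : exists y : 'cV[int]_l -> K,
  unip_elt X beta x = wd [seq (a, y a) | a <- outer_roots] *m wd [seq (a, y a) | a <- inner_roots].
Proof.
rewrite unip_word; have nilX a : a \in roots R -> X a ^+ n = 0 by exact: (X_nilpotent chX natK).
have [|||y ->] := word_ordered natK nilX (L := outer_roots ++ inner_roots)
  (ws := [seq (beta j, x j) | j <- index_enum 'I_(l + p)]) _ _ neg_roots_factor_chain.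
- by move=> a; rewrite mem_cat mem_outer_roots mem_inner_roots => /orP [] /andP [/andP []].
- rewrite cat_uniq outer_uniq inner_uniq andbT; apply/hasPn=> a /=.
  by rewrite mem_inner_roots mem_outer_roots => /andP [_ ->]; rewrite andbF.
- apply/allP=> w /mapP [j _ ->] /=.
  by rewrite mem_cat mem_outer_roots mem_inner_roots beta_neg; case: supported.
by exists y; rewrite map_cat word_cat.
Qed.

End Factorization.

(** * The Galois group G and its Borel subgroup *)

Section GaloisSetting.
Variables (C : fieldType) (l p n : nat) (R : root_system l).
Variables (H : 'I_l -> 'M[C]_n) (X : 'cV[int]_l -> 'M[C]_n) (G : 'M[C]_n -> Prop).
Hypotheses (natC : forall k, k.+1%:R != 0 :> C) (chX : chevalley R H X) (Gsub : is_subgroup G).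
Hypothesis hGL : forall Y, lie_points idfun G Y <-> Y \in <<chevalley_seq R H X>>%VS.
Variable beta : 'I_(l + p) -> 'cV[int]_l.
Hypothesis hbeta : neg_numbering R beta.
Variable nw : 'M[int]_l -> 'M[C]_n.
Hypothesis hnw : weyl_representatives R X G nw.
Variable w0 : 'M[int]_l.
Hypothesis hw0 : longest R w0.
Variables (E : fieldType) (iota : {rmorphism C -> E}) (d : E -> E).
Hypotheses (hd : derivation d) (hdC : forall a, d (iota a) = 0).
Variable z : E.
Variables (v s : 'I_l -> E).
Hypothesis hsv : forall i, dring_gen d (adjoin (in_image iota) v) (s i).
Variable f : 'I_p -> E.
Hypothesis hf : forall k, dring_gen d (adjoin (in_image iota) v) (f k).
Variables (ex : 'I_l -> E) (int_ : 'I_(l + p) -> E).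
Hypothesis ex0 : forall i, ex i != 0.

Notation XE := (ext_mx iota X).
Notation HE := (fun i => map_mx iota (H i)).
Notation Fv := (dfield_gen d (adjoin (rational_field iota z) v)).
Notation Fs := (dfield_gen d (adjoin (rational_field iota z) s)).
Notation YLiou := (torus_elt XE ex *m unip_elt XE beta int_).
Notation n0 := (map_mx iota (nw w0)).
Notation uvf := (unip_elt XE beta (concat v f)).
Notation Y := (uvf *m n0 *m torus_elt XE ex *m unip_elt XE beta int_).
Notation wdE := (word XE).

Variable AGs : 'M[E]_n.
Hypothesis hLiouG : galois_group_is iota d Fv YLiou (neg_borel R X).
Hypothesis hPV : picard_vessiot iota d Fs AGs Y.
Hypothesis hGal : galois_group_is iota d Fs Y G.

Variable kk : 'I_l -> 'I_n -> int.
Hypothesis hkkE : forall i q, hx XE (simple i) q q = (kk i q)%:~R.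
Hypothesis hdiagE : forall i x, x != 0 -> hroot XE (simple i) x = diag_mx (\row_q x ^ kk i q).

Let natE k : k.+1%:R != 0 :> E. Proof. exact: natr_neq0_map iota natC k. Qed.
Let chE : chevalley R HE XE. Proof. exact: chevalley_map. Qed.
Let dD x y : d (x + y) = d x + d y. Proof. by case: hd. Qed.
Let dM x y : d (x * y) = d x * y + x * d y. Proof. by case: hd. Qed.
Let dX a : map_mx d (XE a) = 0.
Proof. by apply/matrixP=> i j; rewrite !mxE hdC. Qed.
Let iX a : map_mx iota (X a) = XE a. Proof. by []. Qed.

Lemma hkkC i q : hx X (simple i) q q = (kk i q)%:~R.
Proof.
apply: (fmorph_inj iota); rewrite rmorph_int -hkkE /hx /ext_mx -map_lie.
by rewrite [RHS]mxE.
Qed.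

Lemma map_mx_inj_iota (A B : 'M[C]_n) : map_mx iota A = map_mx iota B -> A = B.
Proof. by move/matrixP=> e; apply/matrixP=> i j; apply: (fmorph_inj iota); have := e i j; rewrite !mxE. Qed.

Lemma hdiagC i x : x != 0 -> hroot X (simple i) x = diag_mx (\row_q x ^ kk i q).
Proof.
move=> x0; apply: map_mx_inj_iota; rewrite (map_hroot natC iX) hdiagE ?fmorph_eq0 //.
rewrite map_diag_mx; congr diag_mx; apply/rowP=> q; rewrite !mxE.
by rewrite fmorphXz.
Qed.

Lemma Lie_full g Z : G g -> lspan (full_gen R H X predT) Z -> lspan (full_gen R H X predT) (Ad g Z).
Proof.
move=> Gg /span_chevalley/hGL hZ; apply/span_chevalley/hGL.
exact: lie_points_conj.
Qed.

Lemma Fs_iota c : Fs (iota c).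
Proof. by apply: df_in; left; apply: fg_in; left; exists c. Qed.

Lemma Fv_iota c : Fv (iota c).
Proof. by apply: df_in; left; apply: fg_in; left; exists c. Qed.

Lemma dring_Fv x : dring_gen d (adjoin (in_image iota) v) x -> Fv x.
Proof.
elim=> [y [[c ->]|[i ->]]||y1 y2 _ h1 _ h2|y1 y2 _ h1 _ h2|y _ h].
- exact: Fv_iota.
- by apply: df_in; right; exists i.
- exact: df_one.
- exact: df_sub.
- exact: df_mul.
- exact: df_der.
Qed.

Lemma Fs_Fv x : Fs x -> Fv x.
Proof.
elim=> [y [hy|[i ->]]||y1 y2 _ h1 _ h2|y1 y2 _ h1 _ h2|y _ h|y _ h].
- by apply: df_in; left.
- exact/dring_Fv/hsv.
- exact: df_one.
- exact: df_sub.
- exact: df_mul.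
- exact: df_inv.
- exact: df_der.
Qed.

Lemma Fv_concat j : Fv (concat v f j).
Proof.
rewrite /concat; case: (split j) => i; last exact/dring_Fv/hf.
by apply: df_in; right; exists i.
Qed.

Section Automorphism.
Variable sigma : {rmorphism E -> E}.
Hypothesis sigmaC : forall c, sigma (iota c) = iota c.

Lemma sigma_const m q (A : 'M[C]_(m, q)) : map_mx sigma (map_mx iota A) = map_mx iota A.
Proof. by apply/matrixP=> i j; rewrite !mxE sigmaC. Qed.

Lemma sigma_X a : map_mx sigma (XE a) = XE a.
Proof. exact: sigma_const. Qed.

End Automorphism.

Lemma Fs_auto_const sigma : diff_automorphism d Fs sigma -> forall c, sigma (iota c) = iota c.
Proof. by case=> _ _ fx c; apply/fx/Fs_iota. Qed.

Lemma unip_neg_word x : neg_word (K := E) R [seq (beta j, x j) | j <- index_enum 'I_(l + p)].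
Proof. by apply/allP=> u /mapP [j _ ->]; exact: (beta_neg hbeta). Qed.

Lemma map_unip (sigma : {rmorphism E -> E}) x : (forall c, sigma (iota c) = iota c) ->
  map_mx sigma (unip_elt XE beta x) = unip_elt XE beta (fun j => sigma (x j)).
Proof.
by move=> sc; rewrite !unip_word (map_word natE (sigma_X sc)) -map_comp.
Qed.

Lemma Y_unit : Y \in unitmx. Proof. by case: hPV. Qed.

(** An automorphism over $F\langle v\rangle$ also fixes $F\langle s(v)\rangle$ and the first two
    factors of $\mathcal Y$. So it multiplies $\mathcal Y$ by the same constant matrix as the
    Liouvillian fundamental matrix. *)
Lemma Borel_G b : neg_borel R X b -> G b.
Proof.
move=> hb; have [_ /(_ b hb) [sigma [bij com fx] act]] := hLiouG.
have fs : diff_automorphism d Fs sigma by split=> // x /Fs_Fv; exact: fx.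
have sc := Fs_auto_const fs.
have suvf : map_mx sigma uvf = uvf.
  rewrite map_unip //; apply: eq_bigr => j _; rewrite fx //; exact: Fv_concat.
have actY : map_mx sigma Y = Y *m map_mx iota b.
  move: act suvf; rewrite /acts_as -[Y]mulmxA.
  move: (uvf) (torus_elt XE ex *m _) => U T act suvf.
  by rewrite map_mxM act map_mxM (sigma_const sc) suvf mulmxA.
have [hG1 _] := hGal; have [g Gg actg] := hG1 _ fs.
suff -> : b = g by [].
apply: map_mx_inj_iota; move: actg; rewrite /acts_as actY.
exact: (can_inj (mulKmx Y_unit)).
Qed.

Lemma neg_uroot_G a x : neg_root R a -> G (uroot X a x).
Proof.
move=> na; apply: Borel_G; apply: (neg_borel_uroot chX natC hdiagC).
exact: na.
Qed.

Lemma nw0_monomial : exists2 s0, w0 = weyl_word R s0 & monomial_for R X G (nw w0) (weyl_word R s0).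
Proof.
have [s0 e] := longest_word hw0; exists s0 => //; rewrite e.
exact: (nw_monomial chX natC hkkC hdiagC Gsub Lie_full).
Qed.

(** Positive root groups are conjugate to negative ones by $n(\overline w)\in G$. *)
Lemma uroot_G a x : a \in roots R -> G (uroot X a x).
Proof.
move=> ra; case/orP: (root_sign ra) => na; last by apply: neg_uroot_G; rewrite /neg_root ra.
have [s0 e [Gn mono]] := nw0_monomial.
have rb : w0 *m a \in roots R by rewrite (longest_root _ hw0).
have [c c0 ec] := mono _ rb; have [Gu _ GM GV] := Gsub.
have nu : nw w0 \in unitmx by exact: Gu.
have -> : uroot X a x = nw w0 *m uroot X (w0 *m a) (x / c) *m invmx (nw w0).
  rewrite -/(Ad _ _) urootE Ad_mexp // AdZ ec scalerA -e mulfVK // mulmxA.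
  by rewrite (longest_involution hw0) mul1mx.
apply: (GM); last exact: GV.
by apply: GM => //; apply: neg_uroot_G; rewrite /neg_root rb (longest_nonneg hw0 na).
Qed.

(** The scalar relating $\mathrm{Ad}(n(\overline w)^{-1})X_a$ to $X_{\overline wa}$, as a quotient
    of coordinates so that it is a function of [a] usable along a whole word. *)
Definition w0_coef a : E := rcoord XE (w0 *m a) (Ad (invmx n0) (XE a)) / rcoord XE (w0 *m a) (XE (w0 *m a)).

Lemma Ad_n0V a : a \in roots R -> Ad (invmx n0) (XE a) = w0_coef a *: XE (w0 *m a).
Proof.
move=> ra; have [s0 e [Gn mono]] := nw0_monomial; have [Gu _ _ _] := Gsub.
have nu : nw w0 \in unitmx by exact: Gu.
have rb : w0 *m a \in roots R by rewrite (longest_root _ hw0).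
have [c c0 ec] := mono _ rb.
have ea : XE a = iota c^-1 *: Ad n0 (XE (w0 *m a)).
  rewrite -[XE (w0 *m a)]/(map_mx iota _) -map_Ad ec -e mulmxA (longest_involution hw0) mul1mx.
  by rewrite map_mxZ scalerA -rmorphM mulVf // rmorph1 scale1r.
have eA : Ad (invmx n0) (XE a) = iota c^-1 *: XE (w0 *m a).
  by rewrite ea AdZ AdK // map_unitmx.
by rewrite eA /w0_coef eA rcoordZ mulfK // (rcoord_XX chE natE rb).
Qed.

(** Brackets of root vectors, because an element that scales the root vectors also scales these. *)
Let hs i := hx XE (simple i).

Let hs_diag i : is_diag_mx (hs i).
Proof. exact/(cartan_diag chE)/(hx_cartan chE)/simple_root. Qed.

Let hs_wt i a : a \in roots R -> lie (hs i) (XE a) = wt E R i a *: XE a.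
Proof. by move=> ra; rewrite /hs (lie_hx chE) // simple_root. Qed.

Let hs_cartan i : lspan (cartan_gen HE) (hs i).
Proof. exact/(hx_cartan chE)/simple_root. Qed.

(* [T] is its own centraliser in [G]: an element [r] of [G] acts on [E] as an
   automorphism [sigma] with [sigma Y = Y r], and comparing the Bruhat
   decompositions of [Y] and [sigma Y] writes [r] as a product of elements of
   [B^-(E)], [U^+(E)] and [B^-(E)].  If [Ad r] is diagonal, the unipotent
   factors are trivial and [r] is an element of [T(E)] with constant entries. *)
Lemma G_centralizer r : G r ->
  (forall a, a \in roots R -> exists c, Ad r (X a) = c *: X a) -> torus X r.
Proof.
move=> Gr hr; have [_ /(_ r Gr) [sigma fs act]] := hGal; have sc := Fs_auto_const fs.
have [Gu _ _ _] := Gsub; have ru := Gu _ Gr.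
have rEu : map_mx iota r \in unitmx by rewrite map_unitmx.
have [s0 e0 [Gn _]] := nw0_monomial.
have nu : n0 \in unitmx by rewrite map_unitmx; exact: Gu.
have hrX a : a \in roots R -> exists2 c, c != 0 & Ad r (X a) = c *: X a.
  by move=> ra; have [c e] := hr a ra; exists c => //; exact: (X_coef_neq0 chX ra ru e).
have hrXE a : a \in roots R -> exists c, Ad (map_mx iota r) (XE a) = c *: XE a.
  by move=> /hr [c e]; exists (iota c); rewrite -map_Ad e map_mxZ.
(* Applying $\mathrm{Ad}_r$ to $[h,X_{\alpha_i}]=2X_{\alpha_i}$ shows that the scalars at $\alpha_i$
   and $-\alpha_i$ multiply to 1. *)
have hrhs i : Ad (map_mx iota r) (hs i) = hs i.
  have ra := simple_root R i; have rN := roots_opp ra.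
  have [c c0 e1] := hrX _ ra; have [c' c'0 e2] := hrX _ rN.
  have eh : Ad r (hx X (simple i)) = (c * c') *: hx X (simple i).
    by rewrite /hx Ad_lie // e1 e2 lieZl lieZr scalerA.
  have : (c * c' * 2%:R * c) *: X (simple i) = (2%:R * c) *: X (simple i).
    have := congr1 (Ad r) (lie_hxx chX ra); rewrite Ad_lie // eh AdZ e1 lieZl lieZr.
    by rewrite (lie_hxx chX ra) !scalerA => <-; congr (_ *: _); ring.
  move/eqP; rewrite -subr_eq0 -scalerBl scaler_eq0 (negPf (chev_neq0 chX ra)) orbF.
  rewrite -mulrA -[X in _ - X]mul1r -mulrBl mulf_eq0 mulf_eq0 (negPf c0) (negPf (natC 1)) !orbF.
  rewrite subr_eq0 => /eqP cc; rewrite /hs /hx -map_lie -map_Ad.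
  by rewrite -/(hx X (simple i)) eh cc scale1r.
pose u2 := [seq (beta j, int_ j) | j <- index_enum 'I_(l + p)].
pose u2' := [seq (beta j, sigma (int_ j)) | j <- index_enum 'I_(l + p)].
pose u1 := [seq (beta j, concat v f j) | j <- index_enum 'I_(l + p)].
pose u1' := [seq (beta j, sigma (concat v f j)) | j <- index_enum 'I_(l + p)].
have nu1 : neg_word R u1 := unip_neg_word _; have nu1' : neg_word R u1' := unip_neg_word _.
have nu2 : neg_word R u2 := unip_neg_word _; have nu2' : neg_word R u2' := unip_neg_word _.
pose t1 := torus_elt XE ex; pose t1' := torus_elt XE (fun i => sigma (ex i)).
have ht1 : torus XE t1 by exists ex.
have ht1' : torus XE t1' by exists (fun i => sigma (ex i)) => // i; rewrite fmorph_eq0.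
have t1u := torus_unit hdiagE ht1; have t1'u := torus_unit hdiagE ht1'.
have [w1u w1i] := word_unit chE natE (neg_word_roots nu1).
have [w2u w2i] := word_unit chE natE (neg_word_roots nu2).
have [w1'u w1'i] := word_unit chE natE (neg_word_roots nu1').
have [w2'u w2'i] := word_unit chE natE (neg_word_roots nu2').
have eY : wdE u1 *m n0 *m t1 *m wdE u2 *m map_mx iota r = wdE u1' *m n0 *m t1' *m wdE u2'.
  move: act; rewrite /acts_as !unip_word -/u1 -/u2 -/t1 => <-.
  rewrite !map_mxM (sigma_const sc) (map_torus_elt natE (sigma_X sc)) -/t1'.
  by rewrite !(map_word natE (sigma_X sc)) -!map_comp.
(* The quotient of the two leading unipotent factors. Conjugated by $n(\overline w)^{-1}$ it is a
   product over positive roots, while [eV] writes it through $r$ and elements of $B^-$. *)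
pose V := Ad (invmx n0) (wdE (word_inv u1 ++ u1')).
have eV : V = t1 *m wdE u2 *m map_mx iota r *m invmx (wdE u2') *m invmx t1'.
  have q1 : wdE u1' = wdE u1 *m n0 *m t1 *m wdE u2 *m map_mx iota r *m invmx (wdE u2') *m invmx t1' *m invmx n0.
    by rewrite eY !mulmxK.
  rewrite /V /Ad word_cat invmxK -w1i q1 -!mulmxA (mulKmx w1u) (mulKmx nu) mulVmx // !mulmxA.
  by rewrite mulmx1.
have nn : neg_word R (word_inv u1 ++ u1') by rewrite neg_word_cat neg_word_inv nu1.
pose V' := [seq (w0 *m w.1, w0_coef w.1 * w.2) | w <- word_inv u1 ++ u1'].
have eV' : V = wdE V'.
  rewrite /V; apply: Ad_word; first by rewrite unitmx_inv.
  by move=> w /(allP nn) /andP [rw _]; exact: Ad_n0V.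
have pV' : S_word R (@nonneg_root l) V'.
  apply/allP=> w /mapP [w' /(allP nn) /andP [rw nw'] ->] /=.
  by rewrite (longest_root _ hw0) rw (longest_nonpos hw0 nw').
have negS ws : neg_word R ws -> S_word (K := E) R (@nonpos_root l) ws by [].
have Adneg_r Z : lspan (root_gen R XE (@nonpos_root l)) Z ->
  lspan (root_gen R XE (@nonpos_root l)) (Ad (map_mx iota r) Z).
  apply: lspan_Ad => A [a ha ->]; have /andP [ra _] := ha.
  by have [c ->] := hrXE a ra; apply: lspanZ; apply: lspan_in; exists a.
have Adneg_t t Z : torus XE t -> lspan (root_gen R XE (@nonpos_root l)) Z ->
  lspan (root_gen R XE (@nonpos_root l)) (Ad t Z).
  move=> ht; apply: lspan_Ad => A [a ha ->]; have /andP [ra _] := ha.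
  have [c _ ->] := Ad_torus chE natE hkkE hdiagE ht ra.
  by apply: lspanZ; apply: lspan_in; exists a.
have nclosed := @nonpos_closed l R; have pclosed := @nonneg_closed l R.
(* The difference lies in the span of the positive root vectors by the first description of [V] and
   in the span of the negative ones by the second, so it is zero. *)
have fixV i : Ad (wdE V') (hs i) = hs i.
  apply/eqP; rewrite -subr_eq0; apply/eqP.
  apply: (root_span_eq0 chE natE (S := @nonneg_root l)).
    by apply: (Ad_signed_cartan chE natE pclosed).
  move=> a ra na; apply: (rcoord_full_span chE natE (S := @nonpos_root l)) => //; last first.
    by rewrite (root_nonpos ra) na.
  apply: root_span_full; rewrite -eV' eV.
  rewrite !AdM ?unitmx_mul ?unitmx_inv ?t1u ?w2u ?rEu ?w2'u //.
  rewrite (Ad_torus_diag hdiagE (torus_group_inv hdiagE ht1')) // w2'i.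
  set N1 := Ad (wdE (word_inv u2')) (hs i).
  have hN1 : lspan (root_gen R XE (@nonpos_root l)) (N1 - hs i).
    by apply: (Ad_signed_cartan chE natE nclosed) => //; apply: negS; rewrite neg_word_inv.
  have -> : N1 = hs i + (N1 - hs i) by rewrite addrC subrK.
  rewrite (AdD _ (hs i) (_ - _)) hrhs (AdD _ (hs i)) (AdD t1); set N2 := Ad (map_mx iota r) _.
  have hN2 : lspan (root_gen R XE (@nonpos_root l)) N2 by exact: Adneg_r.
  rewrite -[X in _ - X](Ad_torus_diag hdiagE ht1 (hs_diag i)) addrAC -AdB.
  apply: lspanD; apply: Adneg_t => //.
    by apply: (Ad_signed_cartan chE natE nclosed) => //; exact: negS.
  by apply: (Ad_signed_word chE natE nclosed) => //; exact: negS.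
have V1 : V = 1%:M.
  by rewrite eV'; apply: (signed_word_eq1 chE natE pclosed pV' hs_diag hs_wt fixV).
have er : map_mx iota r = invmx (wdE u2) *m (invmx t1 *m t1') *m wdE u2'.
  have : t1' *m wdE u2' = t1 *m wdE u2 *m map_mx iota r.
    by rewrite -[LHS]mul1mx -V1 eV !mulmxA mulmxKV // mulmxKV.
  move=> e; rewrite -!mulmxA e !mulmxA mulmxKV // mulVmx // mul1mx.
  by [].
have htt : torus XE (invmx t1 *m t1').
  by apply: (torus_group_mul hdiagE) => //; exact: (torus_group_inv hdiagE).
set t := invmx t1 *m t1' in er htt.
have tu := torus_unit hdiagE htt; have htV := torus_group_inv hdiagE htt.
have tVu : invmx t \in unitmx by rewrite unitmx_inv.
have [ws ews hws1] : exists2 ws, Ad (invmx t) (wdE (word_inv u2)) = wdE ws &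
    [seq w.1 | w <- ws] = [seq w.1 | w <- word_inv u2].
  apply: (Ad_word_ex (pi := id)) => // w hw.
  have /allP nu2V : neg_word R (word_inv u2) by rewrite neg_word_inv.
  have /andP [rw _] := nu2V _ hw.
  by have [c _ e] := Ad_torus chE natE hkkE hdiagE htV rw; exists c.
have nws : neg_word R (ws ++ u2').
  rewrite neg_word_cat nu2' andbT.
  have : neg_word R (word_inv u2) by rewrite neg_word_inv.
  by rewrite /neg_word -2!(all_map fst) hws1.
have erW : map_mx iota r = t *m wdE (ws ++ u2').
  by rewrite er word_cat -ews w2i (mulmxA t) (mulmx_Ad _ tu) AdVK.
(* Both $r$ and the torus factor fix the $h_i$, so the unipotent factor fixes them too and is
   trivial. *)
have W1 : wdE (ws ++ u2') = 1%:M.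
  apply: (signed_word_eq1 chE natE nclosed (negS _ nws) hs_diag hs_wt) => i.
  have Wu : wdE (ws ++ u2') \in unitmx by case: (word_unit chE natE (neg_word_roots nws)).
  have := hrhs i; rewrite erW AdM // => /(congr1 (Ad (invmx t))).
  by rewrite AdK // (Ad_torus_diag hdiagE htV (hs_diag i)).
move: erW; rewrite W1 mulmx1; have [y y0 ->] := htt => erW.
(* A torus element with constant entries has constant parameters, and the constants of a
   Picard-Vessiot extension lie in $C$. *)
have dy : forall i, d (y i) = 0.
  apply: (torus_const chE natE hdiagE dD dM dX y0); rewrite -erW.
  by apply/matrixP=> i j; rewrite !mxE hdC.
have [_ _ _ _ consts] := hPV.
have /fin_all_exists [c hc] i : exists c, y i = iota c by apply/consts.
exists c => [i|]; first by have := y0 i; rewrite hc fmorph_eq0.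
apply: map_mx_inj_iota; rewrite erW (map_torus_elt natC iX).
by apply: eq_bigr => i _; rewrite hc.
Qed.

(** * The parabolic subgroup and the element $g_1$ *)

Variables (I' : {set 'I_l}) (D : {set {set 'I_l}}).
Hypothesis hD : irreducible_components R I' D.
Notation J := (opposite_set w0 I').
Notation PJ := (parabolic R X nw J).
Notation EPJ := (fixed_field iota d Fs Y PJ).
Notation ks := [seq k <- enum 'I_(l + p) | ~~ [exists B in D, supported B (beta k)]].
Notation outer := (outer_roots beta D).
Notation inner := (inner_roots beta w0 I').
Notation PJE := (closure_points iota PJ).
Notation pJ := (parabolic_root J).

Let GUnip a x : a \in roots R -> G (uroot X a x). Proof. exact: uroot_G. Qed.
Let GDiag r : G r -> (forall a, a \in roots R -> exists c, Ad r (X a) = c *: X a) -> torus X r.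
Proof. exact: G_centralizer. Qed.

Let PJ1 : PJ 1%:M.
Proof. exact: (parabolic1 chX natC hkkC hdiagC Gsub Lie_full GUnip GDiag hnw). Qed.
Let PJ_U a x g : a \in roots R -> pJ a -> PJ g -> PJ (uroot X a x *m g).
Proof. exact: (parabolic_uroot chX natC hkkC hdiagC Gsub Lie_full GUnip GDiag hnw). Qed.
Let PJ_T t g : torus X t -> PJ g -> PJ (t *m g).
Proof. exact: (parabolic_torus chX natC hkkC hdiagC Gsub GUnip). Qed.
Let PJ_M g h : PJ g -> PJ h -> PJ (g *m h).
Proof. exact: (parabolicM chX natC hkkC hdiagC Gsub Lie_full GUnip GDiag hnw). Qed.
Let PJ_G g : PJ g -> G g.
Proof. exact: (parabolic_G chX natC hkkC hdiagC Gsub Lie_full GUnip hnw). Qed.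

Let PJE_word ws g : all (fun w => (w.1 \in roots R) && pJ w.1) ws -> PJE g -> PJE (wdE ws *m g).
Proof. exact: (closure_points_word natC chX PJ_U). Qed.
Let PJE_torus t g : torus XE t -> PJE g -> PJE (t *m g).
Proof. exact: (closure_points_torus natC PJ_T hdiagC hdiagE). Qed.

Lemma Psi_word h : Psi_pos_unipotent XE beta J h -> exists2 ws,
  all (fun w => (w.1 \in roots R) && pJ w.1) ws & h = wdE ws.
Proof.
case=> y ->; exists [seq (- beta j, y j) | j <- inner_index beta w0 I'].
  apply/allP=> w /mapP [j]; rewrite mem_filter => /andP [sj _] -> /=.
  have /andP [rj _] := beta_neg hbeta j.
  by rewrite roots_opp //= /parabolic_root supportedN sj orbT.
by rewrite /word /inner_index big_map big_filter enum_index_enum.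
Qed.

Let Gunit g : G g -> g \in unitmx. Proof. by case: Gsub => h _ _ _; exact: h. Qed.

Section Decomposition.
Variable y : 'cV[int]_l -> E.
Hypothesis uvf_factor : uvf = wdE [seq (a, y a) | a <- outer] *m wdE [seq (a, y a) | a <- inner].

Notation xk := (fun k => - y (beta k)).
Notation g1 := (invmx n0 *m \prod_(k <- rev ks) uroot XE (beta k) (- y (beta k))).
Notation outer_word := [seq (a, y a) | a <- outer].
Notation psi := [seq (w0 *m a, w0_coef a * y a) | a <- inner].
Notation u2 := [seq (beta j, int_ j) | j <- index_enum 'I_(l + p)].
Notation t1 := (torus_elt XE ex).

Let n0u : n0 \in unitmx.
Proof. by rewrite map_unitmx; apply: Gunit; have [s0 _ []] := nw0_monomial. Qed.

Lemma outer_neg_word : neg_word R outer_word.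
Proof.
apply/allP=> w /mapP [a aL ->] /=.
by move: aL; rewrite (mem_outer_roots hbeta hD) => /andP [].
Qed.

Lemma inner_neg a : a \in inner -> neg_root R a /\ supported I' a.
Proof. by rewrite (mem_inner_roots hbeta hw0) => /andP []. Qed.

Let ow_unit := word_unit chE natE (neg_word_roots outer_neg_word).

Lemma g1_word : \prod_(k <- rev ks) uroot XE (beta k) (- y (beta k)) = wdE (word_inv outer_word).
Proof. by rewrite /word /word_inv -!map_comp -map_rev big_map. Qed.

Lemma g1_unit : g1 \in unitmx.
Proof.
by rewrite g1_word -(proj2 ow_unit) unitmx_mul !unitmx_inv n0u; case: ow_unit.
Qed.

Lemma g1_uvf : g1 *m uvf *m n0 = wdE psi.
Proof.
have [owu owi] := ow_unit; rewrite g1_word -owi uvf_factor -!mulmxA (mulKmx owu).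
have -> : wdE psi = Ad (invmx n0) (wdE [seq (a, y a) | a <- inner]).
  have -> : psi = [seq (w0 *m w.1, w0_coef w.1 * w.2) | w <- [seq (a, y a) | a <- inner]].
    by rewrite -[RHS]map_comp.
  apply/esym/Ad_word; first by rewrite unitmx_inv.
  by move=> w /mapP [a /inner_neg [/andP [ra _] _] ->]; exact: Ad_n0V.
by rewrite /Ad invmxK mulmxA.
Qed.

Lemma psi_letters : all (fun w => (w.1 \in roots R) && pJ w.1) psi.
Proof.
apply/allP=> w /mapP [a /inner_neg [/andP [ra _] sa] ->] /=.
by rewrite (longest_root _ hw0) ra /parabolic_root (supported_longest _ _ hw0) sa orbT.
Qed.

Lemma Psi_psi : Psi_pos_unipotent XE beta J (wdE psi).
Proof.
exists (fun j => w0_coef (w0 *m - beta j) * y (w0 *m - beta j)).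
rewrite /word /inner_roots /inner_index -map_comp big_map big_filter enum_index_enum.
by apply: eq_bigr => j _ /=; rewrite mulmxA (longest_involution hw0) mul1mx.
Qed.

Let u2_neg : neg_word R u2. Proof. exact: unip_neg_word. Qed.
Let t1_torus : torus XE t1. Proof. by exists ex. Qed.

Lemma g1_Y : g1 *m Y = wdE psi *m t1 *m wdE u2.
Proof. by rewrite -g1_uvf (unip_word XE beta int_) !mulmxA. Qed.

(** The inverse is included because the logarithmic derivative is reached by evaluating equations at
    $q^{-1}$. *)
Lemma g1_Y_closure : PJE (g1 *m Y) /\ PJE (invmx (g1 *m Y)).
Proof.
have pE1 := closure_points1 iota PJ1; rewrite g1_Y.
have psiR : letters_in (roots R) psi by apply: sub_all psi_letters => w /andP [].
have [pu pi] := word_unit chE natE psiR.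
have [uu ui] := word_unit chE natE (neg_word_roots u2_neg).
have tu := torus_unit hdiagE t1_torus.
split; first rewrite -mulmxA.
  apply: PJE_word; first exact: psi_letters.
  apply: PJE_torus => //; rewrite -[wdE u2]mulmx1.
  by apply: PJE_word => //; exact: parabolic_letters.
rewrite !invmxM ?unitmx_mul ?pu // ui pi; apply: PJE_word.
  by apply: parabolic_letters; rewrite neg_word_inv.
apply: PJE_torus; first exact: (torus_group_inv hdiagE).
rewrite -[wdE (word_inv psi)]mulmx1; apply: PJE_word => //.
by rewrite /word_inv all_rev all_map; exact: psi_letters.
Qed.

Lemma gauge_log_derivative : map_mx d Y = AGs *m Y ->
  gauge d g1 AGs = map_mx d (g1 *m Y) *m invmx (g1 *m Y).
Proof.
move=> dY; have gu := g1_unit; have Yu := Y_unit; move: gu Yu dY.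
move: g1 Y => g A gu Au dA; rewrite (derMmx dD dM) dA invmxM // mulmxDl /gauge addrC.
by congr (_ + _); rewrite !mulmxA mulmxK.
Qed.

Lemma gauge_lie_points : lie_points iota PJ (gauge d g1 AGs).
Proof.
have [_ _ dY _ _] := hPV; rewrite gauge_log_derivative //.
have [h1 h2] := g1_Y_closure; exact: (log_derivative_lie_points hd hdC PJ_M h1 h2).
Qed.

Lemma stabilises_parabolic g : PJ g -> stabilises R HE XE pJ (invmx (map_mx iota g)).
Proof.
move=> hg; rewrite -map_invmx => Z; apply: lspan_Ad.
have st := parabolic_stabilises_inv chX natC hkkC hdiagC Gsub Lie_full GUnip GDiag hnw hg.
by move=> A [[i ->]|[a ha ->]]; rewrite -map_Ad; apply: map_full_span; apply: st;
  apply: lspan_in; [left; exists i|right; exists a].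
Qed.

Section FixedField.
Variables (sigma : {rmorphism E -> E}) (g : 'M[C]_n).
Hypotheses (fs : diff_automorphism d Fs sigma) (Pg : PJ g) (act : acts_as iota Y sigma g).

Let sigmaC := Fs_auto_const fs.
Notation sw := (map (fun w : 'cV[int]_l * E => (w.1, sigma w.2))).

Lemma map_sigma_word ws : map_mx sigma (wdE ws) = wdE (sw ws).
Proof. exact: (map_word natE (sigma_X sigmaC)). Qed.

Lemma all_sw (Q : pred 'cV[int]_l) ws :
  all (fun w => (w.1 \in roots R) && Q w.1) (sw ws) = all (fun w => (w.1 \in roots R) && Q w.1) ws.
Proof. by rewrite all_map. Qed.

(* Both [g1 Y] and [sigma (g1 Y)] lie in [P_J], hence so does
   [sigma(g1) g1^-1 = sigma (g1 Y) g^-1 (g1 Y)^-1]. *)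
Lemma stabilises_quotient :
  stabilises R HE XE pJ (Ad (invmx n0) (wdE (sw (word_inv outer_word) ++ outer_word))).
Proof.
have [owu owi] := ow_unit.
have psiR : letters_in (roots R) psi by apply: sub_all psi_letters => w /andP [].
have [pu pi] := word_unit chE natE psiR.
have [uu ui] := word_unit chE natE (neg_word_roots u2_neg).
have tu := torus_unit hdiagE t1_torus.
have qu : g1 *m Y \in unitmx by rewrite unitmx_mul g1_unit Y_unit.
have gu : map_mx iota g \in unitmx by rewrite map_unitmx; exact: Gunit (PJ_G Pg).
have cl := @parabolic_root_closed l R J.
have stq : stabilises R HE XE pJ (invmx (g1 *m Y)).
  rewrite g1_Y !invmxM ?unitmx_mul ?pu // ui pi.
  apply: stabilisesM; rewrite ?unitmx_mul ?unitmx_inv ?tu -?ui -?pi ?unitmx_inv //.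
    rewrite ui; apply: (stabilises_word chE natE cl).
    by apply: parabolic_letters; rewrite neg_word_inv.
  apply: stabilisesM; rewrite ?unitmx_inv ?tu //.
    apply: (stabilises_torus chE natE hkkE hdiagE); exact: (torus_group_inv hdiagE t1_torus).
  rewrite pi; apply: (stabilises_word chE natE cl).
  by rewrite /word_inv all_rev all_map; exact: psi_letters.
have sq : map_mx sigma (g1 *m Y) =
    wdE (sw psi) *m torus_elt XE (fun i => sigma (ex i)) *m wdE (sw u2).
  by rewrite g1_Y !map_mxM !map_sigma_word (map_torus_elt natE (sigma_X sigmaC)).
have tt : torus XE (torus_elt XE (fun i => sigma (ex i))).
  by exists (fun i => sigma (ex i)) => // i; rewrite fmorph_eq0.
have ttu := torus_unit hdiagE tt.
have spR : letters_in (roots R) (sw psi) by rewrite /letters_in all_map.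
have [spu _] := word_unit chE natE spR.
have su2 : neg_word R (sw u2) by rewrite /neg_word all_map; exact: u2_neg.
have [suu _] := word_unit chE natE (neg_word_roots su2).
have stsq : stabilises R HE XE pJ (map_mx sigma (g1 *m Y)).
  rewrite sq; apply: stabilisesM; rewrite ?unitmx_mul ?spu //.
    apply: stabilisesM => //.
      by apply: (stabilises_word chE natE cl); rewrite all_sw; exact: psi_letters.
    exact: (stabilises_torus chE natE hkkE hdiagE).
  by apply: (stabilises_word chE natE cl); exact: parabolic_letters.
have squ : map_mx sigma (g1 *m Y) \in unitmx by rewrite map_unitmx.
have -> : Ad (invmx n0) (wdE (sw (word_inv outer_word) ++ outer_word)) =
    map_mx sigma (g1 *m Y) *m (invmx (map_mx iota g) *m invmx (g1 *m Y)).
  have ge := g1_unit; move: act Y_unit; rewrite /acts_as; move: (Y) => A actA Au.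
  rewrite map_mxM actA invmxM //.
  have -> : map_mx sigma g1 = invmx n0 *m wdE (sw (word_inv outer_word)).
    by rewrite map_mxM map_invmx (sigma_const sigmaC) g1_word map_sigma_word.
  have -> : invmx g1 = wdE outer_word *m n0.
    by rewrite g1_word -owi invmxM ?unitmx_inv // !invmxK.
  move: gu; move: (map_mx iota g) => B Bu.
  rewrite !mulmxA (mulmxK Bu) (mulmxK Au).
  by rewrite /Ad invmxK word_cat !mulmxA.
apply: stabilisesM; rewrite ?unitmx_mul ?unitmx_inv ?gu ?qu //.
apply: stabilisesM; rewrite ?unitmx_inv //.
exact: stabilises_parabolic.
Qed.

Lemma n0_cartan Z : lspan (cartan_gen HE) Z ->
  lspan (cartan_gen HE) (Ad n0 Z) /\ lspan (cartan_gen HE) (Ad (invmx n0) Z).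
Proof.
have [s0 e0 mono] := nw0_monomial.
have cart m s1 : monomial_for R X G m (weyl_word R s1) -> forall A,
    lspan (cartan_gen HE) A -> lspan (cartan_gen HE) (Ad (map_mx iota m) A).
  move=> mm A; apply: lspan_Ad => B [i ->]; rewrite -map_Ad.
  have : lspan (cartan_gen H) (Ad m (H i)).
    apply: (monomial_cartan chX natC hkkC hdiagC Gsub Lie_full GUnip GDiag mm).
    by apply: lspan_in; exists i.
  by apply: map_lspan => _ [j ->]; exists j.
move=> hZ; split; first exact: cart mono _ hZ.
rewrite -map_invmx; apply: (cart (invmx (nw w0)) (rev s0)) => //.
apply: (monomialV Gsub mono); first exact: weyl_word_revK.
by move=> a; exact: weyl_word_root.
Qed.

Lemma n0_full Z : lspan (full_gen R HE XE pJ) Z ->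
  lspan (full_gen R HE XE (fun a => pJ (w0 *m a))) (Ad n0 Z).
Proof.
apply: lspan_Ad => A [[i ->]|[a /andP [ra pa] ->]].
  apply: cartan_span_full; apply: (proj1 (n0_cartan _)); by apply: lspan_in; exists i.
have [s0 e0 [_ /(_ a ra) [c _ ec]]] := nw0_monomial.
rewrite -[XE a]/(map_mx iota (X a)) -map_Ad ec map_mxZ -e0; apply: lspanZ; apply: lspan_in.
right; exists (w0 *m a) => //; rewrite (longest_root _ hw0) ra /=.
by rewrite mulmxA (longest_involution hw0) mul1mx.
Qed.

(** Conjugation by $n(\overline w)$ turns the stabilised algebra into the Cartan subalgebra plus the
    root spaces of all $a$ with $\overline wa$ a root of $P_J$. For an outer root, $\overline wa$ is
    positive and not supported on $J$, so these coordinates of the transformed Cartan elements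
    vanish. *)
Lemma sigma_fixes a : a \in outer -> sigma (- y a) = - y a.
Proof.
have LR : {subset outer <= roots R}.
  by move=> b; rewrite (mem_outer_roots hbeta hD) => /andP [/andP []].
apply: (word_quotient_coord chE natE (x' := fun b => sigma (- y b)) (x := fun b => - y b) LR
  (outer_uniq hbeta D) (outer_chain chE hbeta hD) (chev_diag chE) (chev_H chE)) => i b bL.
have -> : [seq (c, sigma (- y c)) | c <- rev outer] ++ [seq (c, - - y c) | c <- outer] =
    sw (word_inv outer_word) ++ outer_word.
  congr (_ ++ _); last by apply: eq_map => c; rewrite opprK.
  by rewrite /word_inv !map_rev; congr rev; elim: (outer_roots beta D) => //= c L ->.
set W := wdE _; have rb := LR _ bL.
have -> : Ad W (HE i) = Ad n0 (Ad (Ad (invmx n0) W) (Ad (invmx n0) (HE i))).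
  have Wu : W \in unitmx.
    have lW : neg_word R (sw (word_inv outer_word) ++ outer_word).
      rewrite neg_word_cat outer_neg_word andbT /neg_word all_map.
      by have := outer_neg_word; rewrite -neg_word_inv.
    by case: (word_unit chE natE (neg_word_roots lW)).
  exact: Ad_conj.
apply: (rcoord_full_span chE natE (S := fun a => pJ (w0 *m a))) => //.
  apply: n0_full; apply: stabilises_quotient; apply: cartan_span_full.
  by apply: (proj2 (n0_cartan _)); apply: lspan_in; exists i.
move: bL; rewrite (mem_outer_roots hbeta hD) => /andP [/andP [_ nb] sb].
rewrite /parabolic_root (supported_longest _ _ hw0) negb_or sb andbT.
by rewrite (root_nonpos (_ : w0 *m b \in roots R)) ?(longest_root _ hw0) // negbK (longest_nonpos hw0 nb).
Qed.

Lemma sigma_g1 : map_mx sigma g1 = g1.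
Proof.
rewrite map_mxM map_invmx (sigma_const sigmaC) g1_word map_sigma_word; congr (_ *m wdE _).
rewrite /word_inv map_rev; congr rev; move: sigma_fixes.
elim: (outer_roots beta D) => //= a L ih h; rewrite h ?mem_head // ih // => b bL.
by apply: h; rewrite inE bL orbT.
Qed.

Lemma sigma_gauge : map_mx sigma (gauge d g1 AGs) = gauge d g1 AGs.
Proof.
have [AF _ _ _ _] := hPV; have [_ com fx] := fs.
have sA : map_mx sigma AGs = AGs by apply/matrixP=> i j; rewrite mxE fx.
have sd A : map_mx sigma (map_mx d A) = map_mx d (map_mx sigma A).
  by apply/matrixP=> i j; rewrite !mxE com.
move: sigma_g1; move: (g1) => A eA.
by rewrite /gauge map_mxD !map_mxM map_invmx sd eA sA.
Qed.

End FixedField.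

Lemma EPJ_xk k : k \in ks -> EPJ (- y (beta k)).
Proof.
move=> kks sigma g fs Pg act; apply: (sigma_fixes fs Pg act).
by apply/mapP; exists k.
Qed.

Lemma EPJ_gauge i j : EPJ (gauge d g1 AGs i j).
Proof.
move=> sigma g fs Pg act; have /matrixP/(_ i j) := sigma_gauge fs Pg act.
by rewrite mxE.
Qed.

End Decomposition.

Lemma parabolic_gauge : exists2 x : 'I_(l + p) -> E,
  forall k, k \in ks -> EPJ (x k)
  & let g1 := invmx n0 *m \prod_(k <- rev ks) uroot XE (beta k) (x k) in
    [/\ points iota PJ (g1 *m Y),
        lie_points iota PJ (gauge d g1 AGs) /\ (forall i j, EPJ (gauge d g1 AGs i j)),
        Psi_pos_unipotent XE beta J (g1 *m uvf *m n0)
      & forall h, Psi_pos_unipotent XE beta J h -> points iota PJ h].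
Proof.
have [y hy] := unip_factorization chE natE hbeta hw0 hD (concat v f).
exists (fun k => - y (beta k)) => [k|g1]; first exact: EPJ_xk.
split.
- by apply: closure_points_points; case: (g1_Y_closure hy).
- by split; [exact: gauge_lie_points|exact: EPJ_gauge].
- by rewrite /g1 (g1_uvf hy); exact: Psi_psi.
move=> h /Psi_word [ws hws ->]; apply: closure_points_points.
by rewrite -[wdE ws]mulmx1; apply: PJE_word => //; exact: closure_points1.
Qed.

End GaloisSetting.

Theorem proposition7p2
  (C : closedFieldType) (charC : [pchar C] =i pred0)
  (l p n : nat) (ty : lie_type) (R : root_system l)
  (H : 'I_l -> 'M[C]_n) (X : 'cV[int]_l -> 'M[C]_n) (G : 'M[C]_n -> Prop)
  (hG : group_of_type ty R H X G)
  (beta : 'I_(l + p) -> 'cV[int]_l) (hbeta : neg_numbering R beta)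
  (nw : 'M[int]_l -> 'M[C]_n) (hnw : weyl_representatives R X G nw)
  (w0 : 'M[int]_l) (hw0 : longest R w0)
  (gamma : 'I_l -> 'cV[int]_l) (hgamma : complementary_roots R H X beta gamma)
  (E : fieldType) (iota : {rmorphism C -> E}) (d : E -> E)
  (hd : derivation d) (hdC : forall a, d (iota a) = 0)
  (z : E) (hz : d z = 1)
  (v : 'I_l -> E) (hv : diff_independent d (rational_field iota z) v)
  (c : 'I_l -> C) (hc : forall i, c i != 0)
  (M : 'M[int]_l) (hM : row_free (map_mx (fun k : int => k%:~R : C) M))
  (s : 'I_l -> E)
  (hsv : forall i, dring_gen d (adjoin (in_image iota) v) (s i))
  (hs : diff_independent d (rational_field iota z) s)
  (f : 'I_p -> E)
  (hf : forall k, dring_gen d (adjoin (in_image iota) v) (f k))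
  (ex : 'I_l -> E) (int_ : 'I_(l + p) -> E)
  (hex : forall i, ex i != 0 /\ d (ex i) * (ex i)^-1 = lin_forms M v i) :
  let XE := ext_mx iota X in
  let Fv := dfield_gen d (adjoin (rational_field iota z) v) in
  let Fs := dfield_gen d (adjoin (rational_field iota z) s) in
  let YLiou := torus_elt XE ex *m unip_elt XE beta int_ in
  let nw0 := map_mx iota (nw w0) in
  let uvf := unip_elt XE beta (concat v f) in
  let Y := uvf *m nw0 *m torus_elt XE ex *m unip_elt XE beta int_ in
  let AGs := A_G XE gamma s in
  forall
  (hLiou : picard_vessiot iota d Fv (A_Liou iota H X beta c M v) YLiou)
  (hLiouG : galois_group_is iota d Fv YLiou (neg_borel R X))
  (hY : map_mx d Y *m invmx Y = AGs)
  (hPV : picard_vessiot iota d Fs AGs Y)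
  (hGal : galois_group_is iota d Fs Y G)
  (I' : {set 'I_l}) (D : {set {set 'I_l}})
  (hD : irreducible_components R I' D),
  let J := opposite_set w0 I' in
  let PJ := parabolic R X nw J in
  let EPJ := fixed_field iota d Fs Y PJ in
  let ks := [seq k <- enum 'I_(l + p)
              | ~~ [exists B in D, supported B (beta k)]] in
  exists2 x : 'I_(l + p) -> E,
    forall k, k \in ks -> EPJ (x k)
    & let g1 := invmx nw0 *m \prod_(k <- rev ks) uroot XE (beta k) (x k) in
      [/\ points iota PJ (g1 *m Y),
          lie_points iota PJ (gauge d g1 AGs) /\
            (forall i j, EPJ (gauge d g1 AGs i j)),
          Psi_pos_unipotent XE beta J (g1 *m uvf *m nw0)
        & forall h, Psi_pos_unipotent XE beta J h -> points iota PJ h].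
Proof.
move=> XE Fv Fs YLiou nw0 uvf Y AGs _ hLiouG _ hPV hGal I' D hD.
have [_ [Gsub _] _ basisX hGL] := hG; have chX := chevalley_of_basis basisX.
have natC k : k.+1%:R != 0 :> C by rewrite ((pcharf0P C).1 charC).
have natE := natr_neq0_map iota natC; have chE := chevalley_map iota chX.
have [dD dM] := hd.
have dX a : map_mx d (XE a) = 0 by apply/matrixP=> i j; rewrite !mxE hdC.
(* The elements $z+k$ have derivative 1, so they are nonzero, and they are pairwise distinct: enough
   points to turn identities in $x$ into polynomial identities. *)
have dzk k : d (z + k%:R) = 1 by rewrite dD hz -(rmorph_nat iota) hdC addr0.
have dinf (q : {poly E}) : (forall x, x != 0 -> d x != 0 -> q.[x] = 0) -> q = 0.
  move=> q0; apply: (poly_eq0_infinite (x := fun k => z + k%:R)) => [i j /addrI|k].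
    exact: (natr_inj_char0 natE).
  apply: q0; rewrite ?dzk ?oner_neq0 //; apply: contra_neq (oner_neq0 E) => zk0.
  by rewrite -(dzk k) zk0 (der0 dD).
(* The exponents are found over $\mathcal E$, where elements of nonzero derivative exist; [hkkC] and
   [hdiagC] bring them down to $C$. *)
have /fin_all_exists [kk hkk] i := hroot_diag chE natE dD dM dX dinf (simple_root R i).
apply: (parabolic_gauge natC chX Gsub hGL hbeta hnw hw0 hd hdC hsv hf _ hLiouG hPV hGal
  (kk := kk) _ _ hD) => [i|i q|i x x0].
- by case: (hex i).
- by case: (hkk i).
by case: (hkk i) => _ /(_ x x0).
Qed.
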